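(* Let $\mathcal G$ be a metric graph. The equality $H^1(\mathcal G)=H^1_0(\mathcal G)$ holds true if and only if all topological ends of $\mathcal G$ have infinite volume.
   Context: Metric graphs. Let $\mathcal G_d=(\mathcal V,\mathcal E)$ be an unoriented graph with countably infinite vertex and edge sets which is locally finite (each vertex $v$ has finite degree), connected and simple (no loops or multiple edges). Given edge lengths $|e|\in(0,\infty)$, $e\in\mathcal E$, the metric graph $\mathcal G=(\mathcal G_d,|\cdot|)$ is the topological space obtained by identifying each edge $e$ with the interval $[0,|e|]$ and gluing together endpoints corresponding to the same vertex. It carries the natural path metric and the Lebesgue measure on its edges, denoted $\mathrm{vol}$. $\mathcal E_v$ is the set of edges incident to $v$; a function $f$ on $\mathcal G$ has edge components $f_e=f|_e$; $f_e'(v)$ denotes the derivative of $f_e$ at the vertex $v$ of $e$ taken in the direction pointing from $v$ into $e$. $L^2(\mathcal G)=\bigoplus_{e}L^2(e)$. Ends. Consider sequences $(U_n)_{n\ge0}$ of non-empty open connected subsets of $\mathcal G$ with compact boundaries, $U_{n+1}\subseteq U_n$ and $\bigcap_n\overline{U_n}=\emptyset$. Two such sequences $(U_n),(U_n')$ are equivalent if for every $n$ there are $j,k$ with $U_n\supseteq U_j'$ and $U_n'\supseteq U_k$. Equivalence classes are called topological ends of $\mathcal G$. A topological end $\gamma$ has finite volume if there is a sequence $(U_n)$ representing $\gamma$ with $\mathrm{vol}(U_n)<\infty$ for some $n$; otherwise it has infinite volume. Sobolev spaces. $H^1(\mathcal G)$ is the space of continuous $f\in L^2(\mathcal G)$ with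 $f_e\in H^1(e)$ for all $e$ and $\|f'\|_{L^2(\mathcal G)}^2=\sum_e\|f_e'\|^2_{L^2(e)}<\infty$, with norm $\|f\|_{H^1}^2=\|f\|_{L^2}^2+\|f'\|_{L^2}^2$. $H^1_0(\mathcal G)$ is the closure in $H^1(\mathcal G)$ of the set of $f\in L^2(\mathcal G)$ that are non-zero only on finitely many edges, satisfy $f_e\in H^2(e)$ for all $e$, and satisfy at every vertex $v$ the Kirchhoff conditions: $f$ is continuous at $v$ and $\sum_{e\in\mathcal E_v}f_e'(v)=0$. *)

(* Defs.v *)
From HB Require Import structures.
From mathcomp Require Import all_boot all_order all_algebra generic_quotient.
From mathcomp Require Import all_classical all_reals all_analysis.
From mathcomp Require Import complex.

Set Implicit Arguments.
Unset Strict Implicit.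
Unset Printing Implicit Defensive.

Import Order.TTheory GRing.Theory Num.Theory.
Import numFieldNormedType.Exports.

Local Open Scope classical_set_scope.
Local Open Scope ring_scope.
Local Open Scope quotient_scope.

(* Every edge carries an orientation (from [source] to [target]); it only fixes
   how the edge is identified with [0, length e].  Injectivity of the unordered
   pair of endpoints excludes multiple edges. *)
Record metric_graph (R : realType) := MetricGraph {
  vertex : choiceType ;
  edge : choiceType ;
  source : edge -> vertex ;
  target : edge -> vertex ;
  length : edge -> R ;
  vertex_countable : countable [set: vertex] ;
  vertex_infinite : infinite_set [set: vertex] ;
  edge_countable : countable [set: edge] ;
  edge_infinite : infinite_set [set: edge] ;
  no_loop : forall e, source e <> target e ;
  no_multiple_edge : injective (fun e => [set source e; target e]) ;
  locally_finite :
    forall v, finite_set [set e | source e = v \/ target e = v] ;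
  graph_connected : forall v w, exists2 p : seq vertex,
    path (fun a b => `[< exists e, [set source e; target e] = [set a; b] >]) v p
    & last v p = w ;
  length_gt0 : forall e, 0 < length e }.

Arguments source {R m} e.
Arguments target {R m} e.
Arguments length {R m} e.

(** * The topological space *)

Section metric_graph_topology.
Context {R : realType} (G : metric_graph R).

Definition edge_itv (e : edge G) : set R := `[0, length e].

Definition edge_sum := {e : edge G & set_type (edge_itv e)}.

Definition lies_at (p : edge_sum) (v : vertex G) : Prop :=
  let: existT e x := p in
  (source e = v /\ set_val x = 0) \/ (target e = v /\ set_val x = length e).

Lemma lies_at_inj p v w : lies_at p v -> lies_at p w -> v = w.
Proof.
case: p => e x /=; have := length_gt0 e.
by move=> l0 [[<- ->]|[<- ->]] [[<- //]|[<- //]] => [h|h];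
  move: l0; rewrite h ltxx.
Qed.

Definition glue_rel (p q : edge_sum) : bool :=
  `[< p = q \/ exists2 v, lies_at p v & lies_at q v >].

Lemma glue_refl : reflexive glue_rel.
Proof. by move=> p; apply/asboolP; left. Qed.

Lemma glue_sym : symmetric glue_rel.
Proof.
by move=> p q; apply/asboolP/asboolP => -[->|[v ? ?]]; by [left|right; exists v].
Qed.

Lemma glue_trans : transitive glue_rel.
Proof.
move=> q p r /asboolP[->//|[v pv qv]] /asboolP[<-|[w qw rw]]; apply/asboolP.
  by right; exists v.
by right; exists v => //; rewrite (lies_at_inj qv qw).
Qed.

Definition glue : equiv_rel edge_sum :=
  EquivRel glue_rel glue_refl glue_sym glue_trans.

Definition point_of := {eq_quot glue}.

HB.instance Definition _ := Topological.copy point_of (quotient_topology point_of).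
HB.instance Definition _ := Quotient.on point_of.

Lemma clamp_edge (e : edge G) (x : R) :
  Num.max 0 (Num.min x (length e)) \in edge_itv e.
Proof.
apply/mem_set; rewrite /edge_itv /= in_itv /=.
by rewrite le_max lexx /= ge_max ltW ?length_gt0 //= ge_min lexx orbT.
Qed.

Definition clamp (e : edge G) (x : R) : set_type (edge_itv e) :=
  SigSub (clamp_edge e x).

(* The identification of [0, length e] with the edge [e], extended to be constant
   on both sides of the interval; only its values on the interval matter. *)
Definition chart (e : edge G) (x : R) : point_of :=
  \pi_point_of (existT _ e (clamp e x)).

End metric_graph_topology.

(** * Volume and topological ends *)

Section ends.
Context {R : realType} (G : metric_graph R).

Definition vol (A : set (point_of G)) : \bar R :=
  \esum_(e in [set: edge G])
    lebesgue_measure (edge_itv e `&` chart e @^-1` A).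

Definition boundary {T : topologicalType} (A : set T) : set T :=
  closure A `\` interior A.

Record end_sequence (U : nat -> set (point_of G)) : Prop := EndSequence {
  end_nonempty : forall n, U n !=set0 ;
  end_open : forall n, open (U n) ;
  end_connected : forall n, connected (U n) ;
  end_compact_boundary : forall n, compact (boundary (U n)) ;
  end_nested : forall n, U n.+1 `<=` U n ;
  end_escaping : \bigcap_n closure (U n) = set0 }.

Definition end_equiv (U U' : nat -> set (point_of G)) : Prop :=
  forall n, exists j k, U' j `<=` U n /\ U k `<=` U' n.

Definition topological_end (gamma : set (nat -> set (point_of G))) : Prop :=
  exists2 U, end_sequence U &
    gamma = [set U' | end_sequence U' /\ end_equiv U U'].

Definition finite_volume (gamma : set (nat -> set (point_of G))) : Prop :=
  exists2 U, gamma U & exists n, (vol (U n) < +oo)%E.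

Definition infinite_volume (gamma : set (nat -> set (point_of G))) : Prop :=
  ~ finite_volume gamma.

End ends.

(** * Sobolev spaces on an interval *)

(* Functions are complex-valued: R[i]^o is R[i] with the topology of its norm. *)

Section interval_sobolev.
Context {R : realType}.
Implicit Types (l : R) (u g : R -> R[i]^o).

Definition L2_normsq_itv l u : \bar R :=
  \int[lebesgue_measure]_(x in `[0, l])
    ((complex.Re (u x)) ^+ 2 + (complex.Im (u x)) ^+ 2)%:E.

Definition L2_itv l u : Prop :=
  [/\ measurable_fun `[0, l] (fun x => complex.Re (u x)),
      measurable_fun `[0, l] (fun x => complex.Im (u x)) &
      (L2_normsq_itv l u < +oo)%E].

(* Compactly supported C^1 functions on the open interval ]0, l[; they are the test
   functions of Brezis, "Functional Analysis, Sobolev Spaces and PDE", Chap. 8. *)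
Definition test_function l (phi : R -> R) : Prop :=
  [/\ forall x, derivable phi x 1, continuous (derive1 phi) &
      exists a b, [/\ 0 < a, b < l & forall x, phi x != 0 -> a <= x <= b]].

Definition is_weak_derivative l u g : Prop := forall phi, test_function l phi ->
  (\int[lebesgue_measure]_(x in `[0, l]) (complex.Re (u x) * derive1 phi x)) =
    - (\int[lebesgue_measure]_(x in `[0, l]) (complex.Re (g x) * phi x)) /\
  (\int[lebesgue_measure]_(x in `[0, l]) (complex.Im (u x) * derive1 phi x)) =
    - (\int[lebesgue_measure]_(x in `[0, l]) (complex.Im (g x) * phi x)).

(* Classes in H^1 and H^2 are represented by their continuous representative. *)
Definition H1_itv l u : Prop :=
  [/\ {within `[0, l], continuous u}, L2_itv l u &
      exists2 g, L2_itv l g & is_weak_derivative l u g].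

Definition H2_itv l u : Prop :=
  H1_itv l u /\ exists2 g, H1_itv l g & is_weak_derivative l u g.

(* Well defined up to a null set as soon as u is in H^1. *)
Definition weak_derivative l u : R -> R[i]^o :=
  xget (cst 0) [set g | L2_itv l g /\ is_weak_derivative l u g].

End interval_sobolev.

(** * Sobolev spaces on the metric graph *)

Section graph_sobolev.
Context {R : realType} (G : metric_graph R).
Implicit Types f g : point_of G -> R[i]^o.

Definition on_edge f (e : edge G) : R -> R[i]^o := f \o chart e.

Definition L2_normsq f : \bar R :=
  \esum_(e in [set: edge G]) L2_normsq_itv (length e) (on_edge f e).

Definition L2_graph f : Prop :=
  (forall e, L2_itv (length e) (on_edge f e)) /\ (L2_normsq f < +oo)%E.

Definition L2_normsq_derivative f : \bar R :=
  \esum_(e in [set: edge G])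
    L2_normsq_itv (length e) (weak_derivative (length e) (on_edge f e)).

Definition H1 : set (point_of G -> R[i]^o) := [set f |
  [/\ continuous f, L2_graph f,
      forall e, H1_itv (length e) (on_edge f e) &
      (L2_normsq_derivative f < +oo)%E]].

Definition H1_norm f : \bar R :=
  sqrte (L2_normsq f + L2_normsq_derivative f)%E.

Definition outward_quotient f (e : edge G) (v : vertex G) (h : R) : R[i]^o :=
  (if source e == v
   then on_edge f e h - on_edge f e 0
   else on_edge f e (length e - h) - on_edge f e (length e)) / h%:C%C.

(* f_e'(v), for an edge e incident to v *)
Definition outward_derivative f (e : edge G) (v : vertex G) : R[i]^o :=
  lim (outward_quotient f e v h @[h --> (0 : R)^'+]).

Definition vertex_point (v : vertex G) (p : point_of G) : Prop :=
  exists e, (source e = v /\ p = chart e 0) \/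
            (target e = v /\ p = chart e (length e)).

Definition kirchhoff f (v : vertex G) : Prop :=
  (forall p, vertex_point v p -> {for p, continuous f}) /\
  \sum_(e \in [set e | source e = v \/ target e = v])
    outward_derivative f e v = 0.

Definition H1_0_core : set (point_of G -> R[i]^o) := [set f |
  [/\ L2_graph f,
      finite_set [set e | exists2 x, edge_itv e x & on_edge f e x != 0],
      forall e, H2_itv (length e) (on_edge f e) &
      forall v, kirchhoff f v]].

Definition H1_0 : set (point_of G -> R[i]^o) := [set f |
  H1 f /\ forall eps : R, 0 < eps ->
    exists2 g, H1_0_core g & (H1_norm (f \- g)%R < eps%:E)%E].

End graph_sobolev.

Arguments H1 {R} G.
Arguments H1_0 {R} G.

(* Main.v *)
(* The key estimate is additive along paths: if u is in H^1 of an edge e, then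
   |u(b)|^2 <= |u(a)|^2 + 2 E(e) for all points a, b of e, where E(e) is the squared
   H^1 norm of u on e, whatever the length of e.  Summed along a simple path it compares
   |f|^2 at two vertices up to the energy of the region crossed.

   If all ends have infinite volume, an f in H^1 is small somewhere in every remote
   component of the graph, hence small at all but finitely many vertices.  To approximate
   f, prescribe at each vertex the soft threshold of f there, follow f closely on a finite
   set of edges carrying almost all its energy, and elsewhere interpolate by functions
   constant near the vertices, whose energy is at most a universal multiple of that of f.

   If an end has finite volume, take f equal to 1 far inside the end and to 0 outside; it
   is in H^1.  A function g with finite edge support vanishes at a vertex where f = 1, and
   since |f - g| is bounded at all vertices by a multiple of its H^1 norm, g is not close
   to f. *)

(* The obstacle is that edge lengths have no positive lower bound. A trace bound with a factor
   larger than 1 in front of |u(a)|^2 would compound along a path, and one that deteriorates on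
   short edges could not be summed. Hence the factor exactly 1 in the key estimate, and an
   interpolant whose increment along an edge is controlled by the increment of f itself. Soft
   thresholding fits because it is 1-Lipschitz, fixes 0 and moves every value by at most its
   threshold c. The first two properties bound the interpolant on each edge by the energy of f
   there; the last keeps the new vertex values close to the old ones on the finitely many edges
   where f is followed closely. So c is chosen after these edges, as the smallest tolerance among
   them. On an interval everything is done for pairs (u, g) of real functions, g being a weak
   derivative of u; real and imaginary parts are treated separately, and thresholding is
   componentwise. *)
Require Import Defs.
From HB Require Import structures.
From mathcomp Require Import all_boot all_order all_algebra generic_quotient.
From mathcomp Require Import all_classical all_reals all_analysis.
From mathcomp Require Import measurable_realfun complex ring lra.

Set Implicit Arguments.
Unset Strict Implicit.
Unset Printing Implicit Defensive.

Import Order.TTheory GRing.Theory Num.Theory.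
Import numFieldNormedType.Exports.

Local Open Scope classical_set_scope.
Local Open Scope ring_scope.
Local Open Scope quotient_scope.

(** * Square-integrable functions on an interval *)

Section sqint.
Context {R : realType}.
Notation mu := (@lebesgue_measure R).
Implicit Types (l : R) (f g h : R -> R).

Definition sqint l f : Prop := measurable_fun `[0, l] f /\
  mu.-integrable `[0, l] (EFin \o (fun x => f x ^+ 2)).

Definition ip l f g : R := \int[mu]_(x in `[0, l]) (f x * g x).

Lemma measurable_0l l : measurable (`[0, l] : set (measurableTypeR R)).
Proof. exact: measurable_itv. Qed.
Hint Resolve measurable_0l : core.

(** The bound |f g| <= f^2 + g^2. Integrability of products is what makes [ip] bilinear on
    square-integrable functions. *)
Lemma sqint_mul l f g : sqint l f -> sqint l g ->
  mu.-integrable `[0, l] (EFin \o (fun x => f x * g x)).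
Proof.
move=> [mf f2] [mg g2]; have fg := integrableD (@measurable_0l l) f2 g2.
apply: le_integrable fg => //.
  by apply/measurable_EFinP; exact: measurable_funM.
move=> x _ /=; rewrite lee_fin [leRHS]ger0_norm ?addr_ge0 ?sqr_ge0//.
by rewrite ler_norml; apply/andP; split; nra.
Qed.

Lemma sqint_cont l f : {within `[0, l], continuous f} -> sqint l f.
Proof.
move=> cf; split; first exact: subspace_continuous_measurable_fun.
apply: continuous_compact_integrable; first exact: segment_compact.
apply/subspace_continuousP => x xl; apply: cvgM;
  by move/subspace_continuousP : cf; exact.
Qed.

Lemma sqint_cst l c : sqint l (cst c).
Proof. by apply: sqint_cont; exact/continuous_subspaceT/cst_continuous. Qed.

Lemma sqint_int l f : sqint l f -> mu.-integrable `[0, l] (EFin \o f).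
Proof.
move=> hf; apply: eq_integrable (sqint_mul hf (sqint_cst l 1)) => //.
by move=> x _ /=; rewrite mulr1.
Qed.

Lemma sqintD l f g : sqint l f -> sqint l g -> sqint l (fun x => f x + g x).
Proof.
move=> hf hg; have [mf f2] := hf; have [mg g2] := hg; split.
  exact: measurable_funD.
have fg := sqint_mul hf hg.
have := integrableD (@measurable_0l l) (integrableD (@measurable_0l l) f2 g2)
  (integrableZl (@measurable_0l l) 2 fg).
apply: eq_integrable => // x _ /=.
by congr EFin; ring.
Qed.

Lemma sqintZ l c f : sqint l f -> sqint l (fun x => c * f x).
Proof.
move=> [mf f2]; split; first exact: measurable_funM.
apply: eq_integrable (integrableZl (@measurable_0l l) (c ^+ 2) f2) => //.
by move=> x _ /=; rewrite exprMn.
Qed.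

Lemma sqintN l f : sqint l f -> sqint l (fun x => - f x).
Proof. by move/(sqintZ (-1)); under eq_fun do rewrite mulN1r. Qed.

Lemma sqintB l f g : sqint l f -> sqint l g -> sqint l (fun x => f x - g x).
Proof. by move=> hf /sqintN; exact: sqintD. Qed.

Lemma le_sqint l f g : measurable_fun `[0, l] f -> sqint l g ->
  (forall x, 0 <= x <= l -> `|f x| <= `|g x|) -> sqint l f.
Proof.
move=> mf [mg g2] fg; split=> //; apply: le_integrable g2 => //.
  by apply/measurable_EFinP; exact: measurable_funX.
move=> x /=; rewrite in_itv/= => /fg; rewrite lee_fin !normrX => h.
by rewrite lerXn2r// nnegrE.
Qed.

Lemma sqrD_le2 (x y : R) : (x + y) ^+ 2 <= 2 * x ^+ 2 + 2 * y ^+ 2.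
Proof.
by rewrite -subr_ge0 (_ : _ - _ = (x - y) ^+ 2) ?sqr_ge0//; ring.
Qed.

Lemma ler_sqr_norm (a b : R) : `|a| <= `|b| -> a ^+ 2 <= b ^+ 2.
Proof.
by move=> ab; rewrite -(real_normK (num_real a)) -(real_normK (num_real b))
  lerXn2r// nnegrE.
Qed.

Lemma ipC l f g : ip l f g = ip l g f.
Proof. by apply: eq_Rintegral => x _; rewrite mulrC. Qed.

Lemma eq_ip l f g f' g' : (forall x, 0 <= x <= l -> f x = f' x) ->
  (forall x, 0 <= x <= l -> g x = g' x) -> ip l f g = ip l f' g'.
Proof.
by move=> e e'; apply: eq_Rintegral => x; rewrite inE/= in_itv/= => h;
  rewrite e// e'.
Qed.

Lemma ipDl l f g h : sqint l f -> sqint l g -> sqint l h ->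
  ip l (fun x => f x + g x) h = ip l f h + ip l g h.
Proof.
move=> hf hg hh; rewrite /ip -RintegralD//; [|exact: sqint_mul..].
by apply: eq_Rintegral => x _; rewrite mulrDl.
Qed.

Lemma ipZl l c f h : sqint l f -> sqint l h ->
  ip l (fun x => c * f x) h = c * ip l f h.
Proof.
move=> hf hh; rewrite /ip -RintegralZl//; last exact: sqint_mul.
by apply: eq_Rintegral => x _; rewrite mulrA.
Qed.

Lemma ipDr l f g h : sqint l f -> sqint l g -> sqint l h ->
  ip l h (fun x => f x + g x) = ip l h f + ip l h g.
Proof. by move=> *; rewrite !(ipC l h) ipDl. Qed.

Lemma ipZr l c f h : sqint l f -> sqint l h ->
  ip l h (fun x => c * f x) = c * ip l h f.
Proof. by move=> *; rewrite !(ipC l h) ipZl. Qed.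

Lemma ipBl l f g h : sqint l f -> sqint l g -> sqint l h ->
  ip l (fun x => f x - g x) h = ip l f h - ip l g h.
Proof.
move=> hf hg hh; rewrite ipDl//; last exact: sqintN.
rewrite -[in RHS]mulN1r -ipZl//; congr (_ + _).
by apply: eq_ip => // x _; rewrite mulN1r.
Qed.

Lemma ipBr l f g h : sqint l f -> sqint l g -> sqint l h ->
  ip l h (fun x => f x - g x) = ip l h f - ip l h g.
Proof. by move=> *; rewrite !(ipC l h) ipBl. Qed.

Lemma ip_ge0 l f : 0 <= ip l f f.
Proof. by apply: Rintegral_ge0 => x _; rewrite -expr2 sqr_ge0. Qed.

Lemma cauchy_schwarz l f g : sqint l f -> sqint l g ->
  ip l f g ^+ 2 <= ip l f f * ip l g g.
Proof.
move=> hf hg.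
have key c : 0 <= ip l f f + 2 * c * ip l f g + c ^+ 2 * ip l g g.
  have := ip_ge0 l (fun x => f x + c * g x).
  have hcg := sqintZ c hg; have hs := sqintD hf hcg.
  by rewrite ipDl// !ipDr// !ipZl// !ipZr// (ipC l g f) => h; lra.
have g0 := ip_ge0 l g; have [gz|gnz] := eqVneq (ip l g g) 0.
  suff -> : ip l f g = 0 by rewrite expr0n gz mulr0.
  apply/eqP; apply: contraT => fg0.
  (* With <g, g> = 0 the quadratic is affine in c, and this c gives it the value -1. *)
  have := key (- (ip l f f + 1) / (2 * ip l f g)); rewrite gz mulr0 addr0.
  have -> : ip l f f + 2 * (- (ip l f f + 1) / (2 * ip l f g)) * ip l f g = -1.
    by field.
  by rewrite oppr_ge0 ler10.
have gp : 0 < ip l g g by rewrite lt_def gnz.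
(* The minimiser of the quadratic in c. *)
have := key (- ip l f g / ip l g g).
have -> : ip l f f + 2 * (- ip l f g / ip l g g) * ip l f g +
  (- ip l f g / ip l g g) ^+ 2 * ip l g g =
  (ip l f f * ip l g g - ip l f g ^+ 2) / ip l g g by field.
by rewrite pmulr_lge0 ?invr_gt0// subr_ge0.
Qed.

Lemma le_ip l f g : sqint l f -> sqint l g ->
  (forall x, 0 <= x <= l -> `|f x| <= `|g x|) -> ip l f f <= ip l g g.
Proof.
move=> hf hg fg; apply: le_Rintegral => //; [exact: sqint_mul..|].
move=> x /=; rewrite in_itv/= => /fg h.
by rewrite -!expr2 ler_sqr_norm.
Qed.

Lemma ip_sumsq l f g : sqint l f -> sqint l g ->
  ip l (fun x => f x + g x) (fun x => f x + g x) <= 2 * ip l f f + 2 * ip l g g.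
Proof.
move=> hf hg; have := ip_ge0 l (fun x => f x - g x).
have hN := sqintB hf hg; have hD := sqintD hf hg.
by rewrite ipBl// !ipBr// ipDl// !ipDr// (ipC l g f) => h; lra.
Qed.

Lemma EFin_ip l f : sqint l f ->
  (\int[mu]_(x in `[0%R, l]) (f x ^+ 2)%:E = (ip l f f)%:E)%E.
Proof.
by move=> hf; rewrite /ip fineK//; apply: (integrable_fin_num _ (sqint_mul hf hf)).
Qed.

(** Dominated convergence twice: for the squares, which makes the limit square integrable, then for
    (F n - f)^2, bounded by 4 h^2 because |f| <= |h| in the limit. *)
Lemma ip_cvg0 l (F : nat -> R -> R) f h : (forall n, measurable_fun `[0, l] (F n)) ->
  measurable_fun `[0, l] f -> sqint l h ->
  (forall n x, 0 <= x <= l -> `|F n x| <= `|h x|) ->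
  {ae mu, forall x, 0 <= x <= l -> F n x @[n --> \oo] --> f x} ->
  sqint l f /\
  ip l (fun x => F n x - f x) (fun x => F n x - f x) @[n --> \oo] --> 0.
Proof.
move=> mF mf hh Fh Ff.
have aeF := ae_filter_ringOfSetsType mu.
have [||||| f2i _ _] := @dominated_convergence _ _ R mu `[0, l]%classic (@measurable_0l l)
  (fun n x => (F n x ^+ 2)%:E) (fun x => (f x ^+ 2)%:E) (fun x => (h x ^+ 2)%:E).
- by move=> n; apply/measurable_EFinP/measurable_funX; exact: mF.
- by apply/measurable_EFinP/measurable_funX; exact: mf.
- apply: filterS Ff => x Fx xl; apply/cvg_EFin; first exact: nearW.
  by have {}Fx := Fx xl; apply: cvgM.
- exact: hh.2.
- apply: aeW => x n; rewrite /= in_itv/= => /(Fh n).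
  by rewrite lee_fin => ?; rewrite ger0_norm ?sqr_ge0//; apply: ler_sqr_norm.
have hf : sqint l f by split.
split => //.
have [||||| _ _] := @dominated_convergence _ _ R mu `[0, l]%classic (@measurable_0l l)
  (fun n x => ((F n x - f x) ^+ 2)%:E) (cst 0%:E) (fun x => (4 * h x ^+ 2)%:E).
- move=> n; apply/measurable_EFinP/measurable_funX.
  by apply: measurable_funB; [exact: mF|exact: mf].
- exact: measurable_cst.
- apply: filterS Ff => x Fx xl; apply/cvg_EFin; first exact: nearW.
  have {}Fx := Fx xl; rewrite -[X in _ --> X](mulr0 (0 : R)).
  by apply: cvgM; rewrite -[X in _ --> X](subrr (f x)); apply: cvgB => //;
    exact: cvg_cst.
- exact: (integrableZl (@measurable_0l l) 4 hh.2).
- apply: filterS Ff => x Fx n; rewrite /= in_itv/= => xl.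
  have fh : `|f x| <= `|h x|.
    apply: (ler_cvg_to (cvg_norm (Fx xl)) (cvg_cst _)).
    by apply: nearW => m; exact: Fh.
  have Fhx := Fh n x xl.
  rewrite lee_fin ger0_norm ?sqr_ge0// -(real_normK (num_real (h x))).
  rewrite -(real_normK (num_real (_ - _))) -[4]/(2 * 2)%:R natrM -expr2 -exprMn.
  rewrite lerXn2r ?nnegrE ?mulr_ge0//; have := ler_normB (F n x) (f x); lra.
rewrite integral0 => /fine_cvg; apply: cvg_trans.
apply: near_eq_cvg; apply: nearW => n /=.
by congr fine; apply: eq_integral.
Qed.

End sqint.
#[global] Hint Resolve measurable_0l : core.

(** * Steklov averages and density of test functions *)

Section steklov.
Context {R : realType}.
Notation mu := (@lebesgue_measure R).
Implicit Types (a b M d x : R) (g : R -> R).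

Definition bounded_supported a b M g : Prop :=
  [/\ measurable_fun [set: R] g, forall x, `|g x| <= M &
      forall x, g x != 0 -> a <= x <= b].

(** Integration from minus infinity gives, for bounded functions of compact support, a primitive on
    the whole line that is constant on either side of the support. *)
Definition antiderivative g x : R := \int[mu]_(t in `]-oo, x]) g t.

(** The mean of [g] over [x, x + d]. The window is one-sided, so averaging extends the support to
    the left only. *)
Definition steklov d g x : R :=
  (antiderivative g (x + d) - antiderivative g x) / d.

Lemma bounded_integrable M g (A : set (measurableTypeR R)) :
  measurable A -> (mu A < +oo)%E -> measurable_fun A g ->
  (forall x, `|g x| <= M) -> mu.-integrable A (EFin \o g).
Proof.
move=> mA Aoo mg gM; apply: measurable_bounded_integrable => //.
by exists M; split; [exact: num_real|move=> N MN x _; exact: le_trans (ltW MN)].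
Qed.

Lemma bounded_supportedE a b M g : bounded_supported a b M g ->
  g = g \_ `[a, b].
Proof.
move=> [_ _ sg]; apply/funext => x; rewrite /patch.
case: ifPn => //; rewrite notin_setE/= in_itv/= => h.
by apply/eqP; apply: contraT => /sg /h.
Qed.

Lemma bounded_supported_integrable a b M g : bounded_supported a b M g ->
  mu.-integrable [set: measurableTypeR R] (EFin \o g).
Proof.
move=> bs; have [mg gM sg] := bs; rewrite (bounded_supportedE bs) -restrict_EFin.
apply/integrable_restrict => //=; rewrite setTI.
apply: (@bounded_integrable M) => //; last exact: measurable_funTS.
by rewrite lebesgue_measure_itv/=; case: ifP => // _; rewrite -EFinB ltry.
Qed.

Lemma bounded_supported_locally a b M g : bounded_supported a b M g ->
  locally_integrable [set: R] g.
Proof.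
move=> bs; have [mg gM sg] := bs; rewrite (bounded_supportedE bs).
apply: integrable_locally; first exact: measurable_itv.
by apply: integrableS (bounded_supported_integrable bs) => //.
Qed.

Lemma antiderivativeB a b M g x y : bounded_supported a b M g -> x <= y ->
  antiderivative g y - antiderivative g x = \int[mu]_(t in `]x, y]) g t.
Proof.
move=> bs xy; rewrite /antiderivative Rintegral_itvB//.
by apply: integrableS (bounded_supported_integrable bs).
Qed.

Lemma lebesgue_measure_oc x y : x <= y ->
  (mu `]x, y]%classic = (y - x)%:E)%E.
Proof.
move=> xy; rewrite lebesgue_measure_itv/= lte_fin; case: ltP => // yx.
by rewrite (@le_anti _ _ x y) ?subrr// xy.
Qed.

Lemma antiderivative_lip a b M g x y : bounded_supported a b M g -> x <= y ->
  `|antiderivative g y - antiderivative g x| <= M * (y - x).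
Proof.
move=> bs xy; have [mg gM sg] := bs; rewrite (antiderivativeB bs)//.
have ig : mu.-integrable `]x, y] (EFin \o g).
  by apply: integrableS (bounded_supported_integrable bs).
have mxy := lebesgue_measure_oc xy.
apply: le_trans (le_normr_Rintegral _ ig) _ => //.
have -> : M * (y - x) = \int[mu]_(t in `]x, y]) (cst M t).
  by rewrite Rintegral_cst//; congr (_ * _); exact: esym (congr1 fine mxy).
apply: le_Rintegral => //.
  exact: integrable_norm.
apply: (@bounded_integrable `|M|) => //.
by have /= := ltry (y - x); rewrite -[X in (X < _)%E -> _]mxy.
Qed.

Lemma antiderivative_cst a b M g x y : bounded_supported a b M g -> x <= y ->
  (y < a) || (b <= x) -> antiderivative g y = antiderivative g x.
Proof.
move=> bs xy out; have [_ _ sg] := bs; apply/eqP.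
rewrite -subr_eq0 (antiderivativeB bs)//; apply/eqP.
rewrite /Rintegral integral0_eq// => t /=; rewrite in_itv/= => /andP[xt ty].
congr EFin; apply/eqP; apply: contraT => /sg /andP[at_ tb].
case/orP: out => h; first by have := le_trans at_ ty; rewrite leNgt h.
by have := lt_le_trans xt tb; rewrite ltNge h.
Qed.

Lemma steklov_le a b M d g x : 0 < d -> bounded_supported a b M g ->
  `|steklov d g x| <= M.
Proof.
move=> d0 bs; rewrite /steklov normrM normfV (gtr0_norm d0) ler_pdivrMr//.
have := antiderivative_lip (x := x) (y := x + d) bs.
by rewrite lerDl ltW// [x + d]addrC addrK => /(_ isT); rewrite (addrC d).
Qed.

Lemma antiderivative_continuous a b M g : bounded_supported a b M g ->
  continuous (antiderivative g).
Proof.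
move=> bs x; apply/cvgrPdist_le => /= e e0.
have M0 : 0 <= M by have [_ /(_ 0) + _] := bs; exact: le_trans.
near=> y.
have lip : `|antiderivative g x - antiderivative g y| <= M * `|x - y|.
  have [xy|/ltW yx] := leP x y.
    by rewrite distrC [`|x - y|]distrC [`|y - x|]ger0_norm ?subr_ge0//;
      exact: antiderivative_lip bs xy.
  by rewrite [`|x - y|]ger0_norm ?subr_ge0//; exact: antiderivative_lip bs yx.
apply: (le_trans lip).
apply: (@le_trans _ _ (M * (e / (M + 1)))); last first.
  by rewrite mulrA ler_pdivrMr ?ltr_wpDl// mulrDr mulr1 mulrC lerDl ltW.
apply: ler_wpM2l => //; near: y.
have e1 : 0 < e / (M + 1) by rewrite divr_gt0// ltr_wpDl.
by apply: cvgr_dist_le => //; exact: cvg_id.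
Unshelve. all: by end_near. Qed.

Lemma steklov_continuous a b M d g : bounded_supported a b M g ->
  continuous (steklov d g).
Proof.
move=> bs x; apply: cvgM; last exact: cvg_cst.
apply: cvgB.
  apply: (continuous_comp (f := +%R^~ d)); last exact: antiderivative_continuous bs _.
  by apply: cvgD; [exact: cvg_id|exact: cvg_cst].
exact: antiderivative_continuous bs _.
Qed.

Lemma steklov_supported a b M d g : 0 < d -> bounded_supported a b M g ->
  bounded_supported (a - d) b M (steklov d g).
Proof.
move=> d0 bs; split.
- by apply: continuous_measurable_fun; exact: steklov_continuous bs.
- by move=> x; exact: steklov_le bs.
move=> x; apply: contraR => h; apply/eqP; rewrite /steklov.
have xd : x <= x + d by rewrite lerDl ltW.
rewrite (antiderivative_cst bs xd) ?subrr ?mul0r//.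
by move: h; rewrite negb_and -!ltNge ltrBrDr => /orP[->|/ltW ->]; rewrite ?orbT.
Qed.

Lemma antiderivative_derive a b M g x : bounded_supported a b M g ->
  continuous g -> is_derive x 1 (antiderivative g) (g x).
Proof.
move=> bs cg.
have ig y : mu.-integrable `]-oo, y] (EFin \o g).
  by apply: integrableS (bounded_supported_integrable bs).
have [D E] := @continuous_FTC1 R g -oo%O x (x + 1) (ltr_pwDr ltr01 (lexx x))
  (ig _) (ltNyr _) (cg x).
apply: DeriveDef; [exact: D|by rewrite -derive1E E].
Qed.

Lemma steklov_derive a b M d g x : 0 < d -> bounded_supported a b M g ->
  continuous g -> is_derive x 1 (steklov d g) ((g (x + d) - g x) / d).
Proof.
move=> d0 bs cg.
have h y := antiderivative_derive y bs cg.
rewrite /steklov.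
have h1 : is_derive x 1 (fun y => antiderivative g (y + d)) (g (x + d)).
  have := @is_derive1_comp R (antiderivative g) (fun y => y + d) x (g (x + d)) 1.
  rewrite mulr1; apply; exact: is_derive_shift.
have := is_deriveZ (d^-1) (is_deriveB h1 (h x)).
rewrite [X in is_derive _ _ _ X -> _]mulrC.
rewrite [X in is_derive _ _ X _ -> _](_ : _ = (fun y => (antiderivative g (y + d) - antiderivative g y) / d))//.
by apply/funext => y; rewrite [RHS]mulrC.
Qed.

(** Lebesgue differentiation: these averages are difference quotients of the antiderivative along
    the steps 1/(n+1). *)
Lemma steklov_cvg_ae a b M g : bounded_supported a b M g ->
  {ae mu, forall x, steklov n.+1%:R^-1 g x @[n --> \oo] --> g x}.
Proof.
move=> bs.
have ig y : mu.-integrable `]-oo, y] (EFin \o g).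
  by apply: integrableS (bounded_supported_integrable bs).
have := FTC1Ny ig (bounded_supported_locally bs).
apply: filterS; first exact: (ae_filter_ringOfSetsType mu).
move=> x [D <-].
have /cvg_dnbhs_at_right/cvg_at_rightP/(_ (fun n => n.+1%:R^-1)) := D.
rewrite derive1E => H; apply: cvg_trans (H _); last first.
  split; last exact: cvg_harmonic.
  by move=> n; rewrite invr_gt0 ltr0n.
apply: near_eq_cvg; apply: nearW => n /=.
by rewrite /steklov invrK [RHS]mulrC [x + _]addrC [_%:A]mulr1.
Qed.

Lemma bounded_supported_sqint a b M l g : bounded_supported a b M g -> sqint l g.
Proof.
move=> [mg gM _]; apply: (@le_sqint _ _ _ (cst M)).
- exact: measurable_funTS.
- exact: sqint_cst.
by move=> x _; apply: le_trans (gM x) _; exact: ler_norm.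
Qed.

(** The bound [d < a] keeps the left end a - d of the new support positive, so a second smoothing is
    possible. *)
Lemma smoothing a b M l g e : 0 < a -> 0 < e -> bounded_supported a b M g ->
  exists2 d, 0 < d < a & let k := steklov d g in
    ip l (fun x => k x - g x) (fun x => k x - g x) < e.
Proof.
move=> a0 e0 bs.
have [] := @ip_cvg0 R l (fun n => steklov n.+1%:R^-1 g) g (cst M).
- move=> n; apply: measurable_funTS; apply: continuous_measurable_fun.
  exact: steklov_continuous bs.
- by apply: measurable_funTS; case: bs.
- exact: sqint_cst.
- move=> n x _; apply: le_trans (ler_norm _).
  by apply: steklov_le bs; rewrite invr_gt0.
- have := steklov_cvg_ae bs; apply: filterS; last by move=> x + _.
  exact: (ae_filter_ringOfSetsType mu).
move=> _ /cvgrPdist_lt/(_ _ e0) H.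
have /cvgrPdist_lt/(_ _ a0) H' := @cvg_harmonic R.
near \oo => n.
exists n.+1%:R^-1.
  rewrite invr_gt0 ltr0n/=.
  have : `|0 - harmonic n| < a by near: n; exact: H'.
  by rewrite sub0r normrN gtr0_norm ?harmonic_gt0.
have : `|0 - ip l (fun x => steklov n.+1%:R^-1 g x - g x)
                  (fun x => steklov n.+1%:R^-1 g x - g x)| < e.
  by near: n; exact: H.
by rewrite sub0r normrN ger0_norm ?ip_ge0.
Unshelve. all: by end_near. Qed.

(* One Steklov average makes [g] continuous, a second one makes it C^1. *)
Lemma test_function_dense_bounded a b M l g e : 0 < a -> b < l -> 0 < e ->
  bounded_supported a b M g ->
  exists2 k, test_function l k & ip l (fun x => k x - g x) (fun x => k x - g x) < e.
Proof.
move=> a0 bl e0 bs.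
(* [ip_sumsq] doubles each of the two errors: 2 (e/4) + 2 (e/4) = e. *)
have e4 : 0 < e / 4 by rewrite divr_gt0.
have [d /andP[d0 da] h1] := smoothing l a0 e4 bs.
have bs1 := steklov_supported d0 bs.
have ad : 0 < a - d by rewrite subr_gt0.
have [d' /andP[d'0 d'a] h2] := smoothing l ad e4 bs1.
have bs2 := steklov_supported d'0 bs1.
set k1 := steklov d g in h1 bs1 h2 bs2.
set k2 := steklov d' k1 in h2 bs2.
have ck1 : continuous k1 by exact: steklov_continuous bs.
have dk x := steklov_derive x d'0 bs1 ck1.
exists k2; last first.
  have s0 := bounded_supported_sqint l bs.
  have s1 := bounded_supported_sqint l bs1.
  have s2 := bounded_supported_sqint l bs2.
  have := ip_sumsq (sqintB s2 s1) (sqintB s1 s0).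
  rewrite (@eq_ip _ l (fun x => k2 x - k1 x + (k1 x - g x)) _
    (fun x => k2 x - g x) (fun x => k2 x - g x)).
  - by move=> h; apply: (le_lt_trans h); move: h1 h2 => /=; lra.
  - by move=> x _; ring.
  - by move=> x _; ring.
split.
- by move=> x; case: (dk x).
- rewrite (_ : derive1 k2 = fun x => (k1 (x + d') - k1 x) / d').
    move=> x; apply: cvgM; last exact: cvg_cst.
    apply: cvgB; last exact: ck1.
    apply: (continuous_comp (f := +%R^~ d')); last exact: ck1.
    by apply: cvgD; [exact: cvg_id|exact: cvg_cst].
  by apply/funext => x; rewrite derive1E; case: (dk x).
exists (a - d - d'), b; split=> //; first lra.
by case: bs2.
Qed.

(** Cutting [g] off near the ends of the interval and where it is large gives bounded functions
    supported inside ]0, l[, which converge to [g] in L^2 by domination. *)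
Lemma test_function_dense l g e : 0 < l -> 0 < e -> sqint l g ->
  exists2 k, test_function l k & ip l (fun x => k x - g x) (fun x => k x - g x) < e.
Proof.
move=> l0 e0 sg.
have [mg _] := sg.
pose g0 : R -> R := g \_ `[0, l].
have mg0 : measurable_fun [set: R] g0.
  by apply/(measurable_restrictT _ _).1 => //; exact: measurable_itv.
pose D n : set R := `[n.+1%:R^-1, l - n.+1%:R^-1] `&` [set x | `|g0 x| <= n%:R].
have mD n : measurable (D n : set (measurableTypeR R)).
  apply: measurableI => //.
  have := @measurable_fun_le _ _ R [set: R] (fun x => `|g0 x|) (cst n%:R).
  rewrite setTI; apply => //; exact: measurableT_comp.
pose G n := g0 \_ (D n).
have GE n x : G n x = if x \in D n then g0 x else 0 by [].
have mG n : measurable_fun [set: R] (G n).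
  apply/(measurable_restrictT _ _).1; first exact: mD.
  exact: measurable_funTS.
have [] := @ip_cvg0 R l G g g.
- by move=> n; exact: measurable_funTS.
- exact: mg.
- exact: sg.
- move=> n x xl; rewrite GE; case: ifP => _; last by rewrite normr0.
  by rewrite /g0 patchE mem_set//= in_itv.
(* The end points lie in no [D n], so pointwise convergence may fail there. *)
- have : {ae mu, forall x : R, x != 0 /\ x != l}.
    exists [set 0; l]; split; [exact: measurableU| |].
      by apply: countable_lebesgue_measure0; exact/finite_set_countable/finite_set2.
    by move=> x /= /not_andP[] /negP; rewrite negbK => /eqP; [left|right].
  apply: filterS; first exact: (ae_filter_ringOfSetsType mu).
  move=> x [x0 xl] /andP[x0' xl'].
  have {x0 x0'}x0 : 0 < x by rewrite lt_def x0.
  have {xl xl'}xl : 0 < l - x by rewrite subr_gt0 lt_def eq_sym xl.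
  have H (y : R) : 0 < y -> \forall n \near \oo, n.+1%:R^-1 <= y.
    move=> y0; have /cvgrPdist_le/(_ _ y0) := @cvg_harmonic R.
    by apply: filterS => m; rewrite sub0r normrN ger0_norm// ltW// harmonic_gt0.
  apply: cvg_near_cst.
  near=> n.
  rewrite GE; case: ifPn => [_|].
    by rewrite /g0 patchE mem_set//= in_itv/= !ltW// -subr_gt0.
  rewrite notin_setE => -[]; split => /=; last first.
    by near: n; exact: nbhs_infty_ger.
  rewrite in_itv/=; apply/andP; split; first by near: n; exact: H.
  rewrite lerBrDr addrC -lerBrDr; near: n; exact: H.
move=> _ /cvgrPdist_lt/(_ (e / 4)); rewrite divr_gt0// => /(_ isT) H.
near \oo => n.
have HG : ip l (fun x => G n x - g x) (fun x => G n x - g x) < e / 4.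
  have : `|0 - ip l (fun x => G n x - g x) (fun x => G n x - g x)| < e / 4.
    by near: n; exact: H.
  by rewrite sub0r normrN ger0_norm ?ip_ge0.
have bs : bounded_supported n.+1%:R^-1 (l - n.+1%:R^-1) n%:R (G n).
  split=> // x; rewrite GE; case: ifPn; rewrite ?inE.
  - by case.
  - by rewrite normr0.
  - by case; rewrite /= in_itv.
  - by rewrite eqxx.
have [||| k tk hk] := @test_function_dense_bounded _ _ _ l (G n) (e / 4) _ _ _ bs.
- by rewrite invr_gt0.
- by rewrite ltrBlDr ltrDl invr_gt0.
- by rewrite divr_gt0.
exists k => //.
have sG := bounded_supported_sqint l bs.
have sk : sqint l k.
  apply: sqint_cont; apply: continuous_subspaceT => x.
  by apply: differentiable_continuous; apply/derivable1_diffP; case: tk.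
have := ip_sumsq (sqintB sk sG) (sqintB sG sg).
rewrite (@eq_ip _ l (fun x => k x - G n x + (G n x - g x)) _
    (fun x => k x - g x) (fun x => k x - g x)).
- by move=> h; apply: (le_lt_trans h); move: HG hk => /=; lra.
- by move=> x _; ring.
- by move=> x _; ring.
Unshelve. all: by end_near. Qed.

End steklov.

(** * Weak derivatives *)

Section weak_derivative.
Context {R : realType}.
Notation mu := (@lebesgue_measure R).
Implicit Types (l : R) (f g h u v w phi k : R -> R).

Lemma test_function_continuous l phi : test_function l phi -> continuous phi.
Proof.
move=> [d _ _] x.
by apply: differentiable_continuous; apply/derivable1_diffP.
Qed.

Lemma test_function_sqint l phi : test_function l phi -> sqint l phi.
Proof.
by move/test_function_continuous => c; apply: sqint_cont; exact: continuous_subspaceT.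
Qed.

Lemma test_function_sqint_derive l phi : test_function l phi ->
  sqint l (derive1 phi).
Proof. by move=> [_ c _]; apply: sqint_cont; exact: continuous_subspaceT. Qed.

Lemma test_function_lin l c phi k : test_function l phi -> test_function l k ->
  test_function l (fun x => c * phi x + k x).
Proof.
move=> [d1 c1 [a [b [a0 bl ab]]]] [d2 c2 [a' [b' [a'0 b'l ab']]]].
have D (x : R) : is_derive x 1 (fun x => c * phi x + k x) (c * derive1 phi x + derive1 k x).
  have D1 : is_derive x 1 phi (derive1 phi x) by split; [exact: d1|rewrite derive1E].
  have D2 : is_derive x 1 k (derive1 k x) by split; [exact: d2|rewrite derive1E].
  exact: (is_deriveD (is_deriveZ c D1) D2).
split.
- by move=> x; case: (D x).
- rewrite (_ : derive1 _ = fun x => c * derive1 phi x + derive1 k x).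
    move=> x; apply: cvgD; last exact: c2.
    by apply: cvgM; [exact: cvg_cst|exact: c1].
  by apply/funext => x; rewrite derive1E; case: (D x).
exists (Num.min a a'), (Num.max b b'); split.
- by rewrite lt_min a0.
- by rewrite gt_max bl.
move=> x; rewrite ge_min le_max; have [->|/ab /andP[-> ->]//] := eqVneq (phi x) 0.
by rewrite mulr0 add0r => /ab' /andP[-> ->]; rewrite !orbT.
Qed.

Lemma test_function0 l : 0 < l -> test_function l (cst 0).
Proof.
move=> l0; split.
- by move=> x; exact: derivable_cst.
- rewrite (_ : derive1 _ = cst 0); first exact: cst_continuous.
  by apply/funext => x; rewrite derive1_cst.
by exists (l / 4), (l / 2); split; [lra|lra|move=> x; rewrite eqxx].
Qed.

Lemma test_function_bounded l k : test_function l k ->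
  exists a b M, [/\ 0 < a, b < l & bounded_supported a b M k].
Proof.
move=> tk; have ck := test_function_continuous tk.
have [_ _ [a [b [a0 bl ab]]]] := tk; exists a, b.
have [M kM] : exists M, forall x, a <= x <= b -> `|k x| <= M.
  have [ltab|leab] := ltP b a.
    by exists 0 => x /andP[ax xb]; have := le_trans ax xb; rewrite leNgt ltab.
  have [] := @EVT_max R (fun x => `|k x|) a b leab.
    by apply: continuous_subspaceT => x; apply: cvg_norm; exact: ck.
  by move=> c _ H; exists (`|k c|) => x xab; apply: H; rewrite in_itv.
exists (Num.max M 0); split=> //; split=> //.
  exact: continuous_measurable_fun.
move=> x; rewrite le_max; have [->|/ab/kM ->//] := eqVneq (k x) 0.
by rewrite normr0 lexx orbT.
Qed.

(** Counterpart of [antiderivative] for functions controlled only on [0, l]; the two agree on x >= 0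
    for bounded functions supported to the right of 0. *)
Definition primitive g x : R := \int[mu]_(t in `[0, x]) g t.

(* A profile is constant near both ends of [0, l], so functions glued from profiles
   satisfy the Kirchhoff conditions trivially. *)
Definition profile l w k : Prop :=
  test_function l k /\ forall x : R, is_derive x 1 w (k x).

Lemma profile_antiderivative l k c : test_function l k ->
  profile l (fun x => c + antiderivative k x) k.
Proof.
move=> tk; split=> // x; have [a [b [M [_ _ bs]]]] := test_function_bounded tk.
have := is_deriveD (is_derive_cst c x 1)
  (antiderivative_derive x bs (test_function_continuous tk)).
by rewrite add0r.
Qed.

Lemma profile_continuous l w k : profile l w k -> continuous w.
Proof.
move=> [_ d] x; apply: differentiable_continuous; apply/derivable1_diffP.
by case: (d x).
Qed.

Lemma profile_sqint l w k : profile l w k -> sqint l w.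
Proof.
by move/profile_continuous => c; apply: sqint_cont; exact: continuous_subspaceT.
Qed.

Lemma C1_byparts l w k phi : 0 < l -> (forall x : R, is_derive x 1 w (k x)) ->
  continuous k -> test_function l phi -> ip l w (derive1 phi) = - ip l k phi.
Proof.
move=> l0 wk ck tphi; have cphi := test_function_continuous tphi.
have [dphi cdphi [a [b [a0 bl ab]]]] := tphi.
have cw x : {for x, continuous w}.
  by apply: differentiable_continuous; apply/derivable1_diffP; case: (wk x).
rewrite /ip (@Rintegration_by_parts R w phi k (derive1 phi) 0 l l0).
- have -> : phi l = 0.
    by apply/eqP; apply: contraT => /ab /andP[_]; rewrite leNgt bl.
  have -> : phi 0 = 0.
    by apply/eqP; apply: contraT => /ab /andP[]; rewrite leNgt a0.
  by rewrite !mulr0 subrr sub0r.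
- exact: continuous_subspaceT.
- split.
  + by move=> x _; case: (wk x).
  + by apply: cvg_at_right_filter; exact: cw.
  + by apply: cvg_at_left_filter; exact: cw.
- by move=> x _; rewrite derive1E; case: (wk x).
- exact: continuous_subspaceT.
- split.
  + by move=> x _; exact: dphi.
  + by apply: cvg_at_right_filter; exact: cphi.
  + by apply: cvg_at_left_filter; exact: cphi.
- by [].
Qed.

Lemma indic_sqint l a b : sqint l (\1_(`]a, b] : set R)).
Proof.
apply: (@le_sqint _ _ _ (cst 1)); [|exact: sqint_cst|].
  by apply: measurable_indic; exact: measurable_itv.
by move=> x _; rewrite indicE /=; case: (_ \in _); rewrite ?normr0 ?normr1.
Qed.

Lemma ip_indic l a b g : 0 <= a -> b <= l ->
  ip l g (\1_(`]a, b] : set R)) = \int[mu]_(t in `]a, b]) g t.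
Proof.
move=> a0 bl; rewrite -[in RHS](_ : `[0, l] `&` `]a, b] = `]a, b]%classic).
  rewrite Rintegral_mkcondr; apply: eq_Rintegral => x _.
  by rewrite patchE indicE; case: ifP => xab; rewrite ?mulr1 ?mulr0.
apply: setIidr => x /=; rewrite !in_itv/= => /andP[ax xb].
by rewrite (le_trans a0 (ltW ax)) (le_trans xb bl).
Qed.

Lemma ip_indic2 l a b : 0 <= a -> a <= b -> b <= l ->
  ip l (\1_(`]a, b] : set R)) (\1_(`]a, b] : set R)) = b - a.
Proof.
move=> a0 ab bl; rewrite ip_indic// (@eq_Rintegral _ _ _ _ _ (cst 1)).
  by rewrite Rintegral_cst// mul1r; exact: (congr1 fine (lebesgue_measure_oc ab)).
by move=> x xab; rewrite indicE xab.
Qed.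

Lemma integrable_sub l g (A : set (measurableTypeR R)) : sqint l g ->
  measurable A -> A `<=` `[0, l] -> mu.-integrable A (EFin \o g).
Proof. by move=> sg mA Al; apply: integrableS (sqint_int sg). Qed.

Lemma primitiveB l a b g : sqint l g -> 0 <= a -> a <= b -> b <= l ->
  primitive g b - primitive g a = ip l g (\1_(`]a, b] : set R)).
Proof.
move=> sg a0 ab bl; rewrite ip_indic// /primitive Rintegral_itvB//.
  apply: (integrable_sub sg) => // x /=; rewrite !in_itv/= => /andP[-> xb].
  exact: le_trans xb bl.
Qed.

Lemma primitive0 g : primitive g 0 = 0.
Proof. by rewrite /primitive set_itv1 Rintegral_set1. Qed.

(** Cauchy-Schwarz against the indicator of ]a, b], whose squared norm is b - a. *)
Lemma primitive_holder l a b g : sqint l g -> 0 <= a -> a <= b -> b <= l ->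
  (primitive g b - primitive g a) ^+ 2 <= (b - a) * ip l g g.
Proof.
move=> sg a0 ab bl; rewrite (primitiveB sg)//.
apply: (le_trans (cauchy_schwarz sg (indic_sqint _ _ _))).
by rewrite ip_indic2// mulrC.
Qed.

Lemma primitive_continuous l g : 0 < l -> sqint l g ->
  {within `[0, l], continuous (primitive g)}.
Proof.
move=> l0 sg; apply: parameterized_integral_continuous; first exact: ltW.
exact: sqint_int.
Qed.

Lemma primitive_sqint l g : 0 < l -> sqint l g -> sqint l (primitive g).
Proof. by move=> l0 sg; apply: sqint_cont; exact: primitive_continuous. Qed.

Lemma primitive_antiderivative a b M k x : 0 < a -> bounded_supported a b M k ->
  0 <= x -> antiderivative k x = primitive k x.
Proof.
move=> a0 bs x0; have [_ _ sk] := bs.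
have -> : antiderivative k x = antiderivative k x - antiderivative k 0.
  rewrite [X in _ - X](_ : _ = 0) ?subr0// /antiderivative /Rintegral.
  rewrite integral0_eq// => t /=; rewrite in_itv/= => t0; congr EFin; apply/eqP.
  by apply: contraT => /sk /andP[at_ _]; move: (lt_le_trans a0 at_); rewrite ltNge t0.
rewrite (antiderivativeB bs)// /primitive Rintegral_itv_obnd_cbnd//.
by apply: integrableS (bounded_supported_integrable bs).
Qed.

Lemma ip_cst l c : 0 <= l -> ip l (cst c) (cst c) = l * c ^+ 2.
Proof.
move=> l0; rewrite [LHS](_ : _ = \int[mu]_(_ in `[0, l]) (c ^+ 2)); last first.
  by apply: eq_Rintegral => x _.
rewrite Rintegral_cst//.
have := lebesgue_measure_itv (`[0, l] : interval R); rewrite /= lte_fin.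
have := l0; rewrite le_eqVlt => /orP[/eqP <-|->].
  by rewrite ltxx => /(congr1 fine) /= ->; rewrite mulr0 mul0r.
by rewrite -EFinB subr0 => /(congr1 fine) /= ->; rewrite mulrC.
Qed.

Lemma le_ip_cst l M f : 0 <= l -> sqint l f ->
  (forall x, 0 <= x <= l -> f x ^+ 2 <= M) -> ip l f f <= l * M.
Proof.
move=> l0 sf fM; have M0 : 0 <= M.
  by apply: le_trans (fM 0 _); rewrite ?sqr_ge0// lexx.
apply: (@le_trans _ _ (ip l (cst (Num.sqrt M)) (cst (Num.sqrt M)))).
  apply: le_ip => //; first exact: sqint_cst.
  move=> x xl; rewrite /= -(@ler_sqr R) ?nnegrE//.
  by rewrite !real_normK ?num_real// sqr_sqrtr// fM.
by rewrite ip_cst// sqr_sqrtr.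
Qed.

Lemma primitive_sub l g h x : sqint l g -> sqint l h -> 0 <= x <= l ->
  primitive (fun t => g t - h t) x = primitive g x - primitive h x.
Proof.
move=> sg sh /andP[x0 xl]; have sub : `[0, x] `<=` `[0, l]%classic.
  by move=> t /=; rewrite !in_itv/= => /andP[-> /le_trans]; exact.
by rewrite /primitive RintegralB//; exact: (@integrable_sub l).
Qed.

Lemma primitive_bound l g : 0 < l -> sqint l g ->
  ip l (primitive g) (primitive g) <= l * (l * ip l g g).
Proof.
move=> l0 sg; apply: le_ip_cst; [exact: ltW|exact: primitive_sqint|].
move=> x /andP[x0 xl].
have := primitive_holder sg (lexx _) x0 xl; rewrite primitive0 !subr0 => h.
by apply: le_trans h _; rewrite ler_wpM2r ?ip_ge0.
Qed.

Definition weakd l u g : Prop := forall phi, test_function l phi ->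
  ip l u (derive1 phi) = - ip l g phi.

(** The form in which density arguments conclude: [e] is the squared approximation error and [C]
    depends only on the fixed data. *)
Lemma eq0_small (a C : R) : (forall e, 0 < e -> a ^+ 2 <= e * C) -> a = 0.
Proof.
move=> h; apply/eqP; rewrite -sqrf_eq0; apply: contraT => a0.
have {}a0 : 0 < a ^+ 2 by rewrite lt_def a0 sqr_ge0.
have C0 : 0 < C by have := h 1 ltr01; rewrite mul1r; exact: lt_le_trans.
have e0 : 0 < a ^+ 2 / (2 * C) by apply: divr_gt0 => //; apply: mulr_gt0.
have := h _ e0.
rewrite (_ : a ^+ 2 / (2 * C) * C = a ^+ 2 / 2); last by field; lra.
lra.
Qed.

(** For a test function in place of [g] this is classical integration by parts. Both sides are
    continuous in [g] for the L^2 norm, so density gives the general case. *)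
Lemma weakd_primitive l g : 0 < l -> sqint l g -> weakd l (primitive g) g.
Proof.
move=> l0 sg phi tphi; apply/eqP; rewrite -subr_eq0 opprK; apply/eqP.
have sphi := test_function_sqint tphi.
have sphi' := test_function_sqint_derive tphi.
have sPg := primitive_sqint l0 sg.
apply: (@eq0_small _ (2 * (l * l * ip l (derive1 phi) (derive1 phi) +
  ip l phi phi))) => e e0.
have [k tk ke] := test_function_dense l0 e0 sg.
have sk := test_function_sqint tk.
have [a [b [M [a0 bl bs]]]] := test_function_bounded tk.
have kE x : 0 <= x <= l -> antiderivative k x = primitive k x.
  by move=> /andP[x0 _]; exact: primitive_antiderivative a0 bs x0.
have sPk := primitive_sqint l0 sk.
have byp : ip l (primitive k) (derive1 phi) = - ip l k phi.
  have ck := test_function_continuous tk.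
  rewrite -(C1_byparts l0 (fun x => antiderivative_derive x bs ck) ck tphi).
  by apply: eq_ip => // x xl; rewrite kE.
have -> : ip l (primitive g) (derive1 phi) + ip l g phi =
  - (ip l (primitive (fun t => k t - g t)) (derive1 phi)
     + ip l (fun t => k t - g t) phi).
  rewrite (@eq_ip _ l (primitive (fun t => k t - g t)) _
    (fun x => primitive k x - primitive g x) (derive1 phi))//; last first.
    by move=> x; exact: primitive_sub.
  by rewrite !ipBl// byp; ring.
rewrite sqrrN; set h := fun t => k t - g t; have sh : sqint l h by exact: sqintB.
have h1 := cauchy_schwarz (primitive_sqint l0 sh) sphi'.
have h2 := cauchy_schwarz sh sphi.
have h3 := primitive_bound l0 sh.
have h4 := ip_ge0 l (derive1 phi); have h5 := ip_ge0 l phi.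
have h6 : ip l (primitive h) (primitive h) <= l * (l * e).
  by apply: le_trans h3 _; rewrite !ler_pM2l// ltW.
move: h1 h2; set A := ip l (primitive h) (derive1 phi); set B := ip l h phi.
move=> h1 h2.
have h1' : A ^+ 2 <= l * (l * e) * ip l (derive1 phi) (derive1 phi).
  by apply: le_trans h1 _; rewrite ler_wpM2r.
have h2' : B ^+ 2 <= e * ip l phi phi.
  by apply: le_trans h2 _; rewrite ler_wpM2r// ltW.
have := sqrD_le2 A B.
move: (ip l phi phi) (ip l (derive1 phi) _) h1' h2' => Q P h1' h2' h7.
apply: le_trans h7 _.
rewrite (_ : e * _ = 2 * (l * (l * e) * P) + 2 * (e * Q)); last by ring.
by apply: lerD; rewrite ler_pM2l.
Qed.

(** Fundamental lemma of the calculus of variations: if k is a test function close to w, then <w, w>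
    = <w - k, w>, which Cauchy-Schwarz makes small. *)
Lemma ip_test_eq0 l w : 0 < l -> sqint l w ->
  (forall k, test_function l k -> ip l w k = 0) -> ip l w w = 0.
Proof.
move=> l0 sw wk; apply: (@eq0_small _ (ip l w w)) => e e0.
have [k tk ke] := test_function_dense l0 e0 sw.
have sk := test_function_sqint tk.
rewrite [X in X ^+ 2](_ : _ = ip l (fun x => w x - k x) w); last first.
  by rewrite ipBl// (ipC l k) (wk k tk) subr0.
have swk := sqintB sw sk.
apply: le_trans (cauchy_schwarz swk sw) _; rewrite ler_wpM2r ?ip_ge0//.
have := sqintB sk sw => skw.
rewrite (_ : ip _ _ _ = ip l (fun x => k x - w x) (fun x => k x - w x)) ?ltW//.
by apply: eq_Rintegral => x _; ring.
Qed.

Lemma ip_eq0_cauchy l f g : sqint l f -> sqint l g -> ip l f f = 0 -> ip l f g = 0.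
Proof.
move=> sf sg f0; have := cauchy_schwarz sf sg; rewrite f0 mul0r => h.
by apply/eqP; rewrite -sqrf_eq0 eq_le h sqr_ge0.
Qed.

Lemma weakd_unique l u g1 g2 : 0 < l -> sqint l g1 -> sqint l g2 ->
  weakd l u g1 -> weakd l u g2 ->
  ip l (fun x => g1 x - g2 x) (fun x => g1 x - g2 x) = 0.
Proof.
move=> l0 s1 s2 w1 w2; apply: ip_test_eq0 => //; first exact: sqintB.
move=> k tk; have := w1 k tk; rewrite w2// ipBl//; last exact: test_function_sqint tk.
by move=> /oppr_inj ->; rewrite subrr.
Qed.

(** The null difference is orthogonal to both functions. *)
Lemma ip_unique l f g : sqint l f -> sqint l g ->
  ip l (fun x => f x - g x) (fun x => f x - g x) = 0 -> ip l f f = ip l g g.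
Proof.
move=> sf sg h; have sB := sqintB sf sg.
have h1 := ip_eq0_cauchy sB sf h; have h2 := ip_eq0_cauchy sB sg h.
by move: h1 h2; rewrite !ipBl// (ipC l g f) => h1 h2; lra.
Qed.

End weak_derivative.

(** * The fundamental theorem of calculus for weak derivatives *)

Section h1.
Context {R : realType}.
Notation mu := (@lebesgue_measure R).
Implicit Types (l : R) (f g h u v w phi k : R -> R).

(** The minimum of w^2 on [a, b] is at most its mean there. *)
Lemma mean_point l a b w : {within `[0, l], continuous w} -> 0 <= a -> a < b ->
  b <= l -> exists2 t, a <= t <= b & w t ^+ 2 * (b - a) <= ip l w w.
Proof.
move=> cw a0 ab bl; have sw := sqint_cont cw.
have [] := @EVT_min R (fun x => w x ^+ 2) a b (ltW ab).
  have : {within `[0, l], continuous (fun x => w x ^+ 2)}.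
    apply/subspace_continuousP => x xl; apply: cvgM;
      by move/subspace_continuousP : cw; exact.
  apply: continuous_subspaceW => x /=; rewrite !in_itv/= => /andP[ax xb].
  by rewrite (le_trans a0 ax) (le_trans xb bl).
move=> t; rewrite in_itv/= => tab tmin; exists t => //.
have sI := indic_sqint l a b.
have -> : w t ^+ 2 * (b - a) =
  ip l (fun x => w t * \1_(`]a, b] : set R) x) (fun x => w t * \1_(`]a, b] : set R) x).
  by rewrite ipZl// ?ipZr// ?ip_indic2 ?(ltW ab)//; [ring|exact: sqintZ].
apply: le_ip => //; first exact: sqintZ.
move=> x xl; rewrite indicE; case: (boolP (x \in _)) => [|_].
  rewrite inE/= in_itv/= mulr1 => /andP[ax xb].
  have := tmin x; rewrite in_itv/= (ltW ax) xb => /(_ isT).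
  rewrite -(real_normK (num_real (w t))) -(real_normK (num_real (w x))).
  by rewrite ler_sqr ?nnegrE.
by rewrite mulr0 normr0.
Qed.

Lemma cont_ip_eq0 l w : 0 < l -> {within `[0, l], continuous w} ->
  ip l w w = 0 -> forall x, 0 <= x <= l -> w x = 0.
Proof.
move=> l0 cw w0 x xl; apply/eqP; apply: contraT => wx.
have wx0 : 0 < `|w x| by rewrite normr_gt0.
have xl' : (`[0, l]%classic : set R) x by rewrite /= in_itv.
have /subspace_continuousP/(_ x xl')/cvgrPdist_lt/(_ _ wx0) := cw.
rewrite near_withinE => /nbhs_ballP[d /= d0 H].
have [x0 xl0] := andP xl; have d2 : 0 < d / 2 by rewrite divr_gt0.
have [t [tl td wt]] : exists t, [/\ 0 <= t <= l, `|x - t| < d & w t = 0].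
  (* A short interval on the side of x with more room stays inside [0, l]; its mean point is a zero
     of w closer to x than d. *)
  have [xm|xm] := ltP x (l / 2).
    have [||t /andP[t1 t2]] := @mean_point l x (Num.min l (x + d / 2)) w cw x0.
    - by rewrite lt_min; apply/andP; split; lra.
    - by rewrite ge_min lexx.
    rewrite w0 pmulr_lle0; last by rewrite subr_gt0 lt_min; apply/andP; split; lra.
    move=> wt; exists t; move: t2; rewrite le_min => /andP[tl td]; split.
    - by rewrite tl (le_trans x0).
    - by rewrite distrC ger0_norm ?subr_ge0//; lra.
    - by apply/eqP; rewrite -sqrf_eq0 eq_le wt sqr_ge0.
  have [|||t /andP[t1 t2]] := @mean_point l (Num.max 0 (x - d / 2)) x w cw.
  - by rewrite le_max lexx.
  - by rewrite gt_max; apply/andP; split; lra.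
  - by [].
  rewrite w0 pmulr_lle0; last by rewrite subr_gt0 gt_max; apply/andP; split; lra.
  move=> wt; exists t; move: t1; rewrite ge_max => /andP[t0 td]; split.
  - by rewrite t0 (le_trans t2).
  - by rewrite ger0_norm ?subr_ge0//; lra.
  - by apply/eqP; rewrite -sqrf_eq0 eq_le wt sqr_ge0.
have := H t td; rewrite /= in_itv/= tl => /(_ isT).
by rewrite /from_subspace wt subr0 ltxx.
Qed.

Lemma ip0l l f : ip l (cst 0) f = 0.
Proof.
rewrite /ip (@eq_Rintegral _ _ _ _ _ (cst 0)) ?Rintegral_cst ?mul0r//.
by move=> t _; rewrite mul0r.
Qed.

(** A test function k with squared distance below l/4 from the constant 1 satisfies (<k, 1> - l)^2
    <= l^2 / 4, so its integral is positive and can be normalised. *)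
Lemma bump_exists l : 0 < l ->
  exists2 k, test_function l k & ip l k (cst 1) = 1.
Proof.
move=> l0; have s1 := @sqint_cst R l 1.
have l4 : 0 < l / 4 by rewrite divr_gt0.
have [k tk kl] := test_function_dense l0 l4 s1.
have sk := test_function_sqint tk; have sk1 := sqintB sk s1.
have := cauchy_schwarz sk1 s1.
rewrite [X in X ^+ 2 <= _]ipBl// !ip_cst ?(ltW l0)// expr1n mulr1 => h.
have kp : 0 < ip l k (cst 1).
  have h' : (ip l k (cst 1) - l) ^+ 2 <= l / 4 * l.
    by apply: (le_trans h); rewrite ler_pM2r// ltW.
  by rewrite ltNge; apply/negP => k0; nra.
exists (fun x => (ip l k (cst 1))^-1 * k x + 0).
  by apply: test_function_lin => //; exact: test_function0.
under [X in ip l X _]eq_fun do rewrite addr0.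
by rewrite ipZl// mulVf// gt_eqF.
Qed.

Lemma ip1_antiderivative l k : 0 < l -> test_function l k ->
  antiderivative k 0 = 0 /\ antiderivative k l = ip l k (cst 1).
Proof.
move=> l0 tk; have [a [b [M [a0 bl bs]]]] := test_function_bounded tk.
split; first by rewrite (primitive_antiderivative a0 bs)// primitive0.
rewrite (primitive_antiderivative a0 bs) ?ltW//.
by apply: eq_Rintegral => x _; rewrite mulr1.
Qed.

(** Du Bois-Reymond's lemma. The constant is the mean of [w] against a bump of integral 1. *)
Lemma weakd0_const l w : 0 < l -> {within `[0, l], continuous w} ->
  weakd l w (cst 0) -> exists c, forall x, 0 <= x <= l -> w x = c.
Proof.
move=> l0 cw ww; have sw := sqint_cont cw.
have [b tb b1] := bump_exists l0; have sb := test_function_sqint tb.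
exists (ip l w b); set m := ip l w b => x xl.
have sm := @sqint_cst R l m; have s1 := @sqint_cst R l 1.
have cwm : {within `[0, l], continuous (fun x => w x - m)}.
  apply/subspace_continuousP => y yl; apply: cvgB; last exact: cvg_cst.
  by move/subspace_continuousP : cw; exact.
suff H : ip l (fun x => w x - m) (fun x => w x - m) = 0.
  by apply/eqP; rewrite -subr_eq0; apply/eqP; exact: (cont_ip_eq0 l0 cwm H xl).
apply: ip_test_eq0 => //; first exact: sqintB.
move=> k tk; have sk := test_function_sqint tk.
(* Subtracting a multiple of the bump makes the integral zero, so the antiderivative vanishes on
   both sides of the support and is itself a test function. Testing [w] against it gives <w, k> = m
   <1, k>. *)
pose k' x := - ip l k (cst 1) * b x + k x.
have tk' : test_function l k' by exact: test_function_lin.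
have [A0 Al] := ip1_antiderivative l0 tk'.
have Al0 : antiderivative k' l = 0.
  by rewrite Al ipDl// ?ipZl ?b1 ?mulr1 ?addNr//; exact: sqintZ.
have [p [q [M [p0 ql bs]]]] := test_function_bounded tk'.
have dA x' := antiderivative_derive x' bs (test_function_continuous tk').
have DA : derive1 (antiderivative k') = k'.
  by apply/funext => y; rewrite derive1E; case: (dA y).
have tA : test_function l (antiderivative k').
  split; [by move=> y; case: (dA y)| |].
    by rewrite DA; exact: test_function_continuous tk'.
  exists p, q; split => // y; apply: contraR; rewrite negb_and -!ltNge => yout.
  case/orP: yout => yp.
    have [y0|y0] := leP y 0.
      by rewrite -(antiderivative_cst bs y0) ?A0 ?p0.
    by rewrite (antiderivative_cst bs (ltW y0)) ?A0 ?yp.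
  have [yl|yl] := leP y l.
    by rewrite -(antiderivative_cst bs yl) ?Al0 ?(ltW yp) ?orbT.
  by rewrite (antiderivative_cst bs (ltW yl)) ?Al0 ?(ltW ql) ?orbT.
have := ww _ tA; rewrite DA {1}/k'.
rewrite ipDr// ?ipZr//; last exact: sqintZ.
rewrite ip0l.
rewrite -/m oppr0 => h; rewrite ipBl//.
rewrite (_ : ip l (cst m) k = m * ip l (cst 1) k).
  by rewrite (ipC l (cst 1)); lra.
rewrite -ipZl//; apply: eq_ip => // t _.
by rewrite mulr1.
Qed.

(** The weak derivative is an explicit argument, so that sums, glueings and norms can be computed on
    the pair instead of on a chosen derivative. *)
Definition h1 l u g : Prop :=
  [/\ {within `[0, l], continuous u}, sqint l g & weakd l u g].

(** The difference of [u] and [primitive g] is continuous with weak derivative zero, hence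
    constant. *)
Lemma h1_ftc l u g : 0 < l -> h1 l u g ->
  forall x, 0 <= x <= l -> u x = u 0 + primitive g x.
Proof.
move=> l0 [cu sg wu].
have cP := primitive_continuous l0 sg.
have cw : {within `[0, l], continuous (fun x => u x - primitive g x)}.
  by apply/subspace_continuousP => y yl; apply: cvgB;
    [move/subspace_continuousP : cu|move/subspace_continuousP : cP]; exact.
have [] := weakd0_const l0 cw.
  move=> phi tphi; have sphi := test_function_sqint_derive tphi.
  rewrite ipBl//; [|exact: sqint_cont|exact: primitive_sqint].
  rewrite wu// weakd_primitive// subrr.
  by rewrite ip0l oppr0.
move=> c wc x xl; have := wc _ xl; have := wc 0; rewrite lexx (ltW l0) => /(_ isT).
rewrite primitive0 subr0 => -> /eqP; rewrite subr_eq => /eqP ->.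
by [].
Qed.

Lemma h1_diff l u g a b : 0 < l -> h1 l u g -> 0 <= a -> a <= b -> b <= l ->
  (u b - u a) ^+ 2 <= (b - a) * ip l g g.
Proof.
move=> l0 hu a0 ab bl; have [cu sg wu] := hu.
rewrite (h1_ftc l0 hu (x := b)) ?(le_trans a0 ab)//.
rewrite (h1_ftc l0 hu (x := a)) ?(le_trans ab bl) ?a0//.
by rewrite opprD addrACA subrr add0r primitive_holder.
Qed.

End h1.

(** * Estimates in the Sobolev space of an interval *)

Section h1_estimates.
Context {R : realType}.
Notation mu := (@lebesgue_measure R).
Implicit Types (l : R) (f g h u v w phi k : R -> R).

Lemma h1_diff_sym l u g a b : 0 < l -> h1 l u g -> 0 <= a <= l -> 0 <= b <= l ->
  (u b - u a) ^+ 2 <= `|b - a| * ip l g g.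
Proof.
move=> l0 hu /andP[a0 al] /andP[b0 bl]; have [ab|/ltW ba] := leP a b.
  by rewrite [`|_|]ger0_norm ?subr_ge0// h1_diff.
by rewrite -opprB sqrrN distrC [`|_|]ger0_norm ?subr_ge0// h1_diff.
Qed.

(* p^2 - q^2 = (p - t)^2 - (q - t)^2 + 2 t (p - q) *)
Lemma diff_sqr_bound (p q t r Qu Qg : R) : 0 < r -> r <= 1 -> 0 <= Qg ->
  (p - q) ^+ 2 <= r * Qg -> (p - t) ^+ 2 <= r * Qg ->
  t ^+ 2 * r <= Qu -> p ^+ 2 <= q ^+ 2 + Qu + 2 * Qg.
Proof.
move=> r0 r1 Qg0 pq pt tu.
(* Young's inequality with weight r: 2 t (p - q) <= (p - q)^2 / r + r t^2. *)
have h1 : 2 * t * (p - q) <= Qg + Qu.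
  rewrite -(ler_pM2l r0) mulrDr.
  have : 0 <= (p - q - r * t) ^+ 2 by exact: sqr_ge0.
  have : r * (t ^+ 2 * r) <= r * Qu by rewrite ler_pM2l.
  by nra.
have h2 : r * Qg <= Qg by rewrite ler_piMl.
have := sqr_ge0 (q - t).
by nra.
Qed.

(** The reference value t of [diff_sqr_bound] is taken at a mean point between a and b, with r = |b
    - a|. *)
Lemma h1_edge_short l u g a b : 0 < l -> h1 l u g -> 0 <= a <= l -> 0 <= b <= l ->
  `|b - a| <= 1 -> u b ^+ 2 <= u a ^+ 2 + ip l u u + 2 * ip l g g.
Proof.
move=> l0 hu al bl ab1; have [cu sg wu] := hu.
have Qu := ip_ge0 l u; have Qg := ip_ge0 l g.
have [<-|ab] := eqVneq a b; first by lra.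
have r0 : 0 < `|b - a| by rewrite normr_gt0 subr_eq0 eq_sym.
have [t [tl bt ut]] : exists t, [/\ 0 <= t <= l, `|b - t| <= `|b - a| &
    u t ^+ 2 * `|b - a| <= ip l u u].
  have [/andP[a0 al'] /andP[b0 bl']] := (al, bl).
  case: (ltgtP a b) ab r0 => // ab _ r0.
    have [t /andP[t1 t2] ut] := mean_point cu a0 ab bl'; exists t.
    split; first by rewrite (le_trans a0 t1) (le_trans t2 bl').
      by rewrite !ger0_norm ?subr_ge0 ?(ltW ab)// lerB.
    by rewrite ger0_norm// subr_ge0 ltW.
  have [t /andP[t1 t2] ut] := mean_point cu b0 ab al'; exists t.
  split; first by rewrite (le_trans b0 t1) (le_trans t2 al').
    by rewrite !ler0_norm ?subr_le0 ?(ltW ab)// lerN2 lerB.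
  by rewrite distrC ger0_norm// subr_ge0 ltW.
apply: (@diff_sqr_bound _ _ (u t) _ _ _ r0) => //; first exact: h1_diff_sym.
apply: (le_trans (h1_diff_sym l0 hu tl bl)).
by rewrite ler_wpM2r.
Qed.

(** Some window of width min(l, 1) inside [0, l] contains b; compare with a mean point of that
    window. *)
Lemma h1_sup l u g b : 0 < l -> h1 l u g -> 0 <= b <= l ->
  Num.min l 1 * u b ^+ 2 <= 2 * (ip l u u + ip l g g).
Proof.
move=> l0 hu bl; have [cu sg wu] := hu.
have Qu := ip_ge0 l u; have Qg := ip_ge0 l g.
set r := Num.min l 1.
have r0 : 0 < r by rewrite /r lt_min l0 ltr01.
have rl : r <= l by rewrite /r ge_min lexx.
have r1 : r <= 1 by rewrite /r ge_min lexx orbT.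
(* The left end of the window, moved away from b only when the window would leave [0, l]. *)
pose c := Num.min b (l - r).
have cb : c <= b by rewrite /c ge_min lexx.
have cl : c <= l - r by rewrite /c ge_min lexx orbT.
have [b0 bl'] := andP bl.
have c0 : 0 <= c by rewrite /c le_min b0 subr_ge0.
have bc : b <= c + r by rewrite /c; case: (leP b (l - r)) => _; lra.
have [||t /andP[t1 t2] ut] := @mean_point _ l c (c + r) u cu c0.
- by rewrite ltrDl.
- by rewrite -lerBrDr.
have tl : 0 <= t <= l.
  by rewrite (le_trans c0 t1) (le_trans t2)// -lerBrDr.
have bt : `|b - t| <= r by rewrite ler_norml; apply/andP; split; lra.
have := h1_edge_short l0 hu tl bl (le_trans bt r1).
move: ut; rewrite addrAC subrr add0r => ut h.
have h' : r * u b ^+ 2 <= r * (u t ^+ 2 + ip l u u + 2 * ip l g g).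
  by rewrite ler_pM2l.
apply: (le_trans h').
have : r * ip l u u <= ip l u u by rewrite ler_piMl.
have : r * ip l g g <= ip l g g by rewrite ler_piMl.
by rewrite !mulrDr; lra.
Qed.

(** For points at distance more than 1, [h1_sup] bounds u(b)^2 without u(a). The coefficient 1 of
    u(a)^2 is what allows summation along a path. *)
Lemma h1_edge l u g a b : 0 < l -> h1 l u g -> 0 <= a <= l -> 0 <= b <= l ->
  u b ^+ 2 <= u a ^+ 2 + 2 * (ip l u u + ip l g g).
Proof.
move=> l0 hu al bl.
have Qu := ip_ge0 l u; have Qg := ip_ge0 l g.
have [ab|ab] := leP `|b - a| 1.
  by have := h1_edge_short l0 hu al bl ab; lra.
have l1 : 1 <= l.
  apply: le_trans (ltW ab) _; rewrite ler_norml.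
  by case/andP: al => *; case/andP: bl => *; apply/andP; split; lra.
have := h1_sup l0 hu bl; rewrite (min_idPr l1) mul1r => h.
by apply: le_trans h _; rewrite lerDr sqr_ge0.
Qed.

(** A C^1 step from 0 to 1 and its derivative. Rescaling or translating this single pair keeps the
    constants of the interpolation independent of the edge. *)
Lemma unit_bump : exists B b (M : R), [/\ profile 1 B b,
  forall x, `|b x| <= M, forall x, `|B x| <= M,
  (forall x, x <= 0 -> B x = 0) & (forall x, 1 <= x -> B x = 1)].
Proof.
have [b tb b1] := @bump_exists R 1 ltr01.
have [p [q [M [p0 q1 bs]]]] := test_function_bounded tb.
have [B0 B1] := ip1_antiderivative ltr01 tb; rewrite b1 in B1.
have Bneg x : x <= 0 -> antiderivative b x = 0.
  by move=> x0; rewrite -(antiderivative_cst bs x0) ?B0// p0.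
have Bpos x : 1 <= x -> antiderivative b x = 1.
  by move=> x0; rewrite (antiderivative_cst bs x0) ?B1// (ltW q1) orbT.
have [_ bM _] := bs.
exists (antiderivative b), b, M; split => //.
  split=> // x; exact: (antiderivative_derive x bs (test_function_continuous tb)).
have M0 : 0 <= M by apply: le_trans (bM 0).
have lip x : 0 <= x -> `|antiderivative b x| <= M * x.
  by move=> x0; have := antiderivative_lip bs x0; rewrite B0 !subr0.
move=> x; have [x0|x0] := leP x 0; first by rewrite Bneg// normr0.
have [x1|x1] := leP 1 x; last first.
  by apply: (le_trans (lip x (ltW x0))); rewrite ler_piMr// ltW.
by rewrite Bpos// -B1; apply: (le_trans (lip 1 ler01)); rewrite mulr1.
Qed.

Lemma is_derive_affine (B b : R -> R) (c d x : R) :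
  (forall x : R, is_derive x 1 B (b x)) ->
  is_derive x 1 (fun y => B (c * y + d)) (c * b (c * x + d)).
Proof.
move=> DB; rewrite mulrC.
apply: (@is_derive1_comp R B (fun y => c * y + d) x _ c (DB _)).
have := is_deriveD (is_deriveZ c (is_derive_id x 1)) (is_derive_cst d x 1).
by rewrite addr0 [X in is_derive _ _ _ X]mulr1.
Qed.

Lemma test_function_affine l b (c d : R) : test_function 1 b -> 0 < c ->
  d <= 0 -> 1 <= c * l + d -> test_function l (fun x => b (c * x + d)).
Proof.
move=> [db cb [p [q [p0 q1 pq]]]] c0 d0 cl.
have Db (x : R) : is_derive x 1 b (derive1 b x).
  by split; [exact: db|rewrite derive1E].
split.
- by move=> x; case: (is_derive_affine c d x Db).
- rewrite (_ : derive1 _ = fun x => c * derive1 b (c * x + d)); last first.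
    by apply/funext => x; rewrite derive1E; case: (is_derive_affine c d x Db).
  move=> x; apply: cvgM; first exact: cvg_cst.
  apply: (continuous_comp (f := fun x => c * x + d)); last exact: cb.
  by apply: cvgD; [apply: cvgM; [exact: cvg_cst|exact: cvg_id]|exact: cvg_cst].
exists ((p - d) / c), ((q - d) / c); split.
- by rewrite divr_gt0// subr_gt0 (le_lt_trans d0).
- by rewrite ltr_pdivrMr// mulrC ltrBlDr (lt_le_trans q1).
by move=> x /pq; rewrite ler_pdivrMr// ler_pdivlMr// lerBlDr lerBrDr (mulrC x).
Qed.

End h1_estimates.

(** * Interpolation and approximation with prescribed end values *)

Section h1_approximation.
Context {R : realType}.
Notation mu := (@lebesgue_measure R).
Implicit Types (l : R) (f g h u v w phi k : R -> R).

Lemma test_functionZ l c k : 0 < l -> test_function l k ->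
  test_function l (fun x => c * k x).
Proof.
move=> l0 tk; have := test_function_lin c tk (test_function0 l0).
by congr test_function; apply/funext => x; rewrite addr0.
Qed.

Lemma le_ip_itv l a b c f : sqint l f -> 0 <= a -> a <= b -> b <= l -> 0 <= c ->
  (forall x, a <= x <= b -> f x ^+ 2 <= c) ->
  (forall x, 0 <= x <= l -> ~~ (a <= x <= b) -> f x = 0) ->
  ip l f f <= c * (b - a).
Proof.
move=> sf a0 ab bl c0 fc f0.
pose J := `[a, b]%classic : set R.
have sJ : sqint l (\1_J : R -> R).
  apply: (@le_sqint _ _ _ (cst 1)); [|exact: sqint_cst|].
    by apply: measurable_indic; exact: measurable_itv.
  by move=> x _; rewrite indicE /=; case: (_ \in _); rewrite ?normr0 ?normr1.
have JJ : ip l (\1_J : R -> R) (\1_J : R -> R) = b - a.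
  have -> : ip l (\1_J : R -> R) (\1_J : R -> R) = \int[mu]_(x in `[0, l] `&` J) (cst 1 x).
    rewrite Rintegral_mkcondr; apply: eq_Rintegral => x _.
    by rewrite patchE indicE; case: ifP => _; rewrite ?mulr1 ?mulr0.
  rewrite (_ : `[0, l] `&` J = J).
    rewrite Rintegral_cst ?mul1r//; last exact: measurable_itv.
    have := lebesgue_measure_itv (`[a, b] : interval R); rewrite /= lte_fin.
    by case: ltP => [_|ba] /(congr1 fine) /= -> //; rewrite (@le_anti _ _ a b) ?subrr// ab.
  apply: setIidr => x; rewrite /J/= !in_itv/= => /andP[ax xb].
  by rewrite (le_trans a0 ax) (le_trans xb bl).
rewrite -JJ -[c]sqr_sqrtr// expr2 -mulrA -ipZr// -ipZl//; last exact: sqintZ.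
apply: le_ip => //; first exact: sqintZ.
move=> x xl; rewrite indicE; case: (boolP (x \in J)) => [|].
  rewrite inE /J/= in_itv/= mulr1 => xab.
  rewrite -ler_sqr ?nnegrE// !real_normK ?num_real// sqr_sqrtr//; exact: fc.
rewrite notin_setE /J/= in_itv/= => /negP xab.
by rewrite f0// mulr0.
Qed.

Lemma profile_bump l B b c d s : 0 < l -> profile 1 B b -> 0 < c -> d <= 0 ->
  1 <= c * l + d ->
  profile l (fun x => s * B (c * x + d)) (fun x => s * (c * b (c * x + d))).
Proof.
move=> l0 [tb DB] c0 d0 cl; split.
  by apply: test_functionZ => //; apply: test_functionZ => //; exact: test_function_affine.
by move=> x; apply: is_deriveZ; exact: is_derive_affine.
Qed.

Lemma profileD l w1 k1 w2 k2 : profile l w1 k1 -> profile l w2 k2 ->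
  profile l (fun x => w1 x + w2 x) (fun x => k1 x + k2 x).
Proof.
move=> [t1 D1] [t2 D2]; split; last by move=> x; exact: is_deriveD.
have := test_function_lin 1 t1 t2.
by congr test_function; apply/funext => x; rewrite mul1r.
Qed.

Lemma profile_cst l c : 0 < l -> profile l (cst c) (cst 0).
Proof. by move=> l0; split; [exact: test_function0|move=> x; exact: is_derive_cst]. Qed.

(** There is no energy bound here: it serves a cutoff that is non-constant on finitely many edges
    only, and the last clause handles all the others. *)
Lemma profile_between l (a b : R) : 0 < l ->
  exists w k, [/\ profile l w k, w 0 = a, w l = b &
    a = b -> w = cst a /\ k = cst 0].
Proof.
move=> l0; have [B [bb [M [pB _ _ B0 B1]]]] := @unit_bump R.
have li : 0 < l^-1 by rewrite invr_gt0.
have e1 : 1 <= l^-1 * l + 0 by rewrite addr0 mulVf ?gt_eqF.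
exists (fun x => cst a x + (b - a) * B (l^-1 * x + 0)).
exists (fun x => cst 0 x + (b - a) * (l^-1 * bb (l^-1 * x + 0))); split.
- by apply: profileD; [exact: profile_cst|exact: profile_bump].
- by rewrite mulr0 addr0 B0// mulr0 addr0.
- by rewrite B1//= mulr1 addrC subrK.
- by move=> ->; split; apply/funext => x; rewrite subrr mul0r addr0.
Qed.

(* The constant does not depend on [l]: for l <= 1 a rescaled bump joins the two end
   values, for l > 1 two bumps of unit width do. *)
Lemma interpolation : exists2 C : R, 0 <= C & forall l u g, 0 < l -> h1 l u g ->
  forall a b : R, `|a| <= `|u 0| -> `|b| <= `|u l| -> `|b - a| <= `|u l - u 0| ->
  exists w k, [/\ profile l w k, w 0 = a, w l = b,
    ip l w w + ip l k k <= C * (ip l u u + ip l g g) &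
    a = 0 -> b = 0 -> w = cst 0].
Proof.
have [B [bb [M [pB bM BM B0 B1]]]] := @unit_bump R.
have M0 : 0 <= M by apply: le_trans (bM 0).
have [[tb DB] [_ _ [p [q [p0 q1 pq]]]]] := (pB, pB.1).
(* The sum of the constants of the two cases: 4 + 3 M^2 for l <= 1 and 4 (1 + M)^2 + 12 M^2 for l >
   1. *)
exists (4 * (1 + M) ^+ 2 + 15 * M ^+ 2 + 4).
  by rewrite !addr_ge0// mulr_ge0// sqr_ge0.
move=> l u g l0 hu a b au bu abu; have [cu sg wu] := hu.
have Qu := ip_ge0 l u; have Qg := ip_ge0 l g.
set S := ip l u u + ip l g g; have S0 : 0 <= S by exact: addr_ge0.
have ll : 0 <= l <= l by rewrite ltW/=.
have l00 : 0 <= (0 : R) <= l by rewrite lexx ltW.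
have u0S := h1_sup l0 hu l00; have ulS := h1_sup l0 hu ll.
have a2 := ler_sqr_norm au; have b2 := ler_sqr_norm bu.
have ab2 := ler_sqr_norm abu.
have BM2 x : B x ^+ 2 <= M ^+ 2.
  by rewrite -(real_normK (num_real (B x))) ler_sqr ?nnegrE.
have bM2 x : bb x ^+ 2 <= M ^+ 2.
  by rewrite -(real_normK (num_real (bb x))) ler_sqr ?nnegrE.
have M20 : 0 <= M ^+ 2 by exact: sqr_ge0.
have [l1|l1] := leP l 1.
  have li : 0 < l^-1 by rewrite invr_gt0.
  have e1 : 1 <= l^-1 * l + 0 by rewrite addr0 mulVf ?gt_eqF.
  have pw : profile l (fun x => cst a x + (b - a) * B (l^-1 * x + 0))
      (fun x => cst 0 x + (b - a) * (l^-1 * bb (l^-1 * x + 0))).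
    by apply: profileD; [exact: profile_cst|exact: profile_bump].
  rewrite (min_idPl l1) in u0S ulS.
  have ulg := h1_diff l0 hu (lexx 0) (ltW l0) (lexx l); rewrite subr0 in ulg.
  eexists; eexists; split; first exact: pw.
  - by rewrite /= mulr0 addr0 B0// mulr0 addr0.
  - by rewrite /= B1//= mulr1 addrC subrK.
  - have sw := profile_sqint pw; have sk := test_function_sqint pw.1.
    (* The rescaled slope costs (b - a)^2 M^2 / l, which explodes on short edges unless (b - a)^2 is
       at most l times the derivative energy of [u]. *)
    have ab_le : (b - a) ^+ 2 <= l * ip l g g by exact: le_trans ab2 ulg.
    have hw := @le_ip_cst _ l (2 * a ^+ 2 + 2 * (l * ip l g g * M ^+ 2)) _ (ltW l0) sw.
    have {}hw := hw _.
    have hk := @le_ip_cst _ l (l * ip l g g * (l^-1 ^+ 2 * M ^+ 2)) _ (ltW l0) sk.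
    apply: le_trans (lerD (hw _) (hk _)) _.
    + move=> x _; apply: le_trans (sqrD_le2 _ _) _.
      by rewrite lerD2l ler_pM2l// exprMn ler_pM ?sqr_ge0.
    + move=> x _; rewrite add0r !exprMn; apply: ler_pM; rewrite ?sqr_ge0//.
        by rewrite mulr_ge0 ?sqr_ge0.
      by rewrite ler_wpM2l ?sqr_ge0.
    + rewrite (_ : l * (l * ip l g g * (l^-1 ^+ 2 * M ^+ 2)) = M ^+ 2 * ip l g g); last first.
        by field; rewrite gt_eqF.
      have h1 : l * a ^+ 2 <= 2 * S.
        by apply: le_trans u0S; rewrite ler_pM2l.
      have h2 : l * (l * ip l g g) <= S.
        rewrite mulrA; apply: (@le_trans _ _ (1 * ip l g g)).
          by rewrite ler_wpM2r// mulr_ile1// ltW.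
        by rewrite mul1r lerDr.
      have h3 : ip l g g <= S by rewrite lerDr.
      have h4 : 0 <= (1 + M) ^+ 2 * S by rewrite mulr_ge0 ?sqr_ge0.
      have h5 : l * (l * ip l g g) * M ^+ 2 <= S * M ^+ 2 by rewrite ler_wpM2r.
      have h6 : M ^+ 2 * ip l g g <= M ^+ 2 * S by rewrite ler_wpM2l.
      have h7 : 0 <= M ^+ 2 * S by rewrite mulr_ge0.
      clearbody S; move: h1 h2 h3 h4 h5 h6 h7; clear.
      set A := ip l g g; clearbody A => *; lra.
  - by move=> -> ->; apply/funext => x; rewrite /= subrr mul0r addr0.
rewrite (min_idPr (ltW l1)) !mul1r in u0S ulS.
have c1 : 1 <= 1 * l + 0 by rewrite addr0 mul1r ltW.
have c2 : 1 <= 1 * l + - (l - 1) by rewrite mul1r opprB addrC subrK.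
have d2 : - (l - 1) <= 0 by rewrite oppr_le0 subr_ge0 ltW.
(* The first piece descends from a to 0 on [0, 1], the second climbs from 0 to b on [l - 1, l]. *)
have p1 : profile l (fun x => a + - a * B (1 * x + 0)) (fun x => 0 + - a * (1 * bb (1 * x + 0))).
  by apply: (profileD (profile_cst a l0)); exact: profile_bump.
have p2 := profile_bump b l0 pB ltr01 d2 c2.
have pw := profileD p1 p2.
eexists; eexists; split; first exact: pw.
- by rewrite /= !mulr0 !add0r !B0// !mulr0 !addr0.
- by rewrite /= !B1// !mulr1 subrr add0r.
- have S1 : a ^+ 2 <= 2 * S by exact: le_trans a2 u0S.
  have S2 : b ^+ 2 <= 2 * S by exact: le_trans b2 ulS.
  have l10 : 0 <= l - 1 by rewrite subr_ge0 ltW.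
  have l1l : l - 1 <= l by rewrite gerBl.
  have lB : l - (l - 1) = 1 by rewrite opprB addrC subrK.
  have w1 : ip l (fun x => a + - a * B (1 * x + 0)) (fun x => a + - a * B (1 * x + 0))
      <= 2 * S * (1 + M) ^+ 2 * (1 - 0).
    apply: le_ip_itv => //; [exact: profile_sqint p1|exact: ltW| | |].
    + by rewrite mulr_ge0 ?sqr_ge0 ?mulr_ge0.
    + move=> x _; rewrite mulNr -{1}[a]mulr1 -mulrBr exprMn ler_pM ?sqr_ge0//.
      rewrite -(real_normK (num_real _)) ler_sqr ?nnegrE ?addr_ge0//.
      by apply: le_trans (ler_normB _ _) _; rewrite normr1 lerD2l.
    + move=> x /andP[x0 xl]; rewrite x0/= -ltNge => x1.
      by rewrite B1 ?mul1r ?addr0 ?(ltW x1)// mulr1 subrr.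
  have w2 : ip l (fun x => b * B (1 * x + - (l - 1))) (fun x => b * B (1 * x + - (l - 1)))
      <= 2 * S * M ^+ 2 * (l - (l - 1)).
    apply: le_ip_itv => //; [exact: profile_sqint p2| | |].
    + by rewrite mulr_ge0 ?mulr_ge0.
    + by move=> x _; rewrite exprMn ler_pM ?sqr_ge0.
    + move=> x /andP[x0 xl]; rewrite xl andbT -ltNge => x1.
      by rewrite B0 ?mulr0// mul1r subr_le0 ltW.
  have k1 : ip l (fun x => 0 + - a * (1 * bb (1 * x + 0))) (fun x => 0 + - a * (1 * bb (1 * x + 0)))
      <= 2 * S * M ^+ 2 * (1 - 0).
    apply: le_ip_itv => //; [exact: test_function_sqint p1.1|exact: ltW| | |].
    + by rewrite mulr_ge0 ?mulr_ge0.
    + by move=> x _; rewrite add0r mul1r exprMn sqrrN ler_pM ?sqr_ge0.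
    + move=> x /andP[x0 xl]; rewrite x0/= -ltNge => x1.
      rewrite (_ : bb _ = 0) ?mulr0 ?addr0//; apply/eqP; apply: contraT => /pq.
      by rewrite mul1r ?addr0 => /andP[_]; rewrite leNgt (lt_trans q1).
  have k2 : ip l (fun x => b * (1 * bb (1 * x + - (l - 1)))) (fun x => b * (1 * bb (1 * x + - (l - 1))))
      <= 2 * S * M ^+ 2 * (l - (l - 1)).
    apply: le_ip_itv => //; [exact: test_function_sqint p2.1| | |].
    + by rewrite mulr_ge0 ?mulr_ge0.
    + by move=> x _; rewrite mul1r exprMn ler_pM ?sqr_ge0.
    + move=> x /andP[x0 xl]; rewrite xl andbT -ltNge => x1.
      rewrite (_ : bb _ = 0) ?mulr0//; apply/eqP; apply: contraT => /pq.
      rewrite mul1r => /andP[h _]; move: (lt_le_trans p0 h).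
      by rewrite subr_gt0 ltNge (ltW x1).
  (* The two pieces overlap when l < 2, so their norms are combined by [ip_sumsq] and not by
     disjointness. *)
  have iw := ip_sumsq (profile_sqint p1) (profile_sqint p2).
  have ik := ip_sumsq (test_function_sqint p1.1) (test_function_sqint p2.1).
  apply: (le_trans (lerD iw ik)).
  rewrite lB subr0 !mulr1 in w1 w2 k1 k2.
  have h4 : 0 <= M ^+ 2 * S by rewrite mulr_ge0 ?sqr_ge0.
  move: w1 w2 k1 k2.
  set W1 := ip l _ _; set W2 := ip l _ _; set K1 := ip l _ _; set K2 := ip l _ _.
  clearbody W1 W2 K1 K2 S; move: h4 S0; clear => *; lra.
- by move=> -> ->; apply/funext => x; rewrite /= oppr0 !mul0r !addr0.
Qed.

End h1_approximation.

(** * Approximation by profiles with prescribed end values *)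

Section h1_approx.
Context {R : realType}.
Implicit Types (l : R) (f g h u v w phi k : R -> R).

(** Approximate the derivative by a test function, correct its integral by a multiple of a bump so
    that the primitive from a arrives exactly at b, and integrate. The correction is small because
    the increment of [u] is the integral of [g]. *)
Lemma h1_approx l u g (e : R) : 0 < l -> h1 l u g -> 0 < e ->
  exists2 d : R, 0 < d & forall a b, `|a - u 0| <= d -> `|b - u l| <= d ->
  exists w k, [/\ profile l w k, w 0 = a, w l = b &
    ip l (fun x => u x - w x) (fun x => u x - w x) +
    ip l (fun x => g x - k x) (fun x => g x - k x) <= e].
Proof.
move=> l0 hu e0; have [cu sg wu] := hu.
have [bb tb b1] := @bump_exists R l l0; have sb := test_function_sqint tb.
have Qb := ip_ge0 l bb.
(* The total error in units of n: 2 l n + (2 l^2 + 1) q', where q' is the squared error of the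
   derivative, at most (2 + 6 (2 + l) <bb, bb>) n. *)
pose D : R := 2 * l + (2 * l ^+ 2 + 1) * (2 + 6 * (2 + l) * ip l bb bb).
have D0 : 0 < D.
  have : 0 <= (2 * l ^+ 2 + 1) * (2 + 6 * (2 + l) * ip l bb bb).
    by rewrite mulr_ge0// addr_ge0// mulr_ge0 ?sqr_ge0// mulr_ge0// addr_ge0// ltW.
  by rewrite /D; lra.
pose n := e / D; have n0 : 0 < n by exact: divr_gt0.
have [k0 tk0 kn] := test_function_dense l0 n0 sg; have sk0 := test_function_sqint tk0.
exists (Num.sqrt n); first by rewrite sqrtr_gt0.
move=> a b au bu.
have au2 : (a - u 0) ^+ 2 <= n.
  rewrite -[leRHS](sqr_sqrtr (ltW n0)); apply: ler_sqr_norm.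
  by rewrite [leRHS]ger0_norm ?sqrtr_ge0.
have bu2 : (b - u l) ^+ 2 <= n.
  rewrite -[leRHS](sqr_sqrtr (ltW n0)); apply: ler_sqr_norm.
  by rewrite [leRHS]ger0_norm ?sqrtr_ge0.
have s1 := @sqint_cst R l 1.
pose c := b - a - ip l k0 (cst 1).
pose k x := c * bb x + k0 x.
have tk : test_function l k by exact: test_function_lin.
have sk := test_function_sqint tk.
have [p [q [M [p0 ql bs]]]] := test_function_bounded tk.
have [A0 Al] := ip1_antiderivative l0 tk.
have kE x : 0 <= x <= l -> antiderivative k x = primitive k x.
  by move=> /andP[x0 _]; exact: primitive_antiderivative p0 bs x0.
have pw := profile_antiderivative a tk.
exists (fun x => a + antiderivative k x), k; split=> //.
- by rewrite A0 addr0.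
- rewrite Al ipDl//; last exact: sqintZ.
  by rewrite ipZl// b1 /c; ring.
have skg := sqintB sk0 sg.
have Qe : ip l (fun x => k0 x - g x) (fun x => k0 x - g x) <= n by exact: ltW.
have pl x : ip l x (cst 1) = primitive x l.
  by apply: eq_Rintegral => y _; rewrite mulr1.
(* c is a sum of two end errors and the integral of k0 - g, with squares at most n, n and l n; the 3
   comes from squaring a sum of three terms. *)
have c2 : c ^+ 2 <= 3 * (2 + l) * n.
  have ll : 0 <= l <= l by rewrite lexx ltW.
  have ul := h1_ftc l0 hu ll.
  have -> : c = (b - u l) - (a - u 0) - primitive (fun x => k0 x - g x) l.
    by rewrite (primitive_sub sk0 sg ll) /c pl ul; ring.
  have h := primitive_holder skg (lexx 0) (ltW l0) (lexx l).
  rewrite primitive0 !subr0 in h.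
  have {}h : primitive (fun x => k0 x - g x) l ^+ 2 <= l * n.
    by apply: le_trans h _; rewrite ler_pM2l.
  move: au2 bu2 h; set X := a - _; set Y := b - _; set Z := primitive _ _.
  clearbody X Y Z; clear -n => h1 h2 h3.
  have h4 := sqrD_le2 (Y - X) (- Z).
  have : (Y - X - Z) ^+ 2 <= 3 * (X ^+ 2 + Y ^+ 2 + Z ^+ 2).
    rewrite -subr_ge0 (_ : _ - _ = (Y + X) ^+ 2 + (Y + Z) ^+ 2 + (X - Z) ^+ 2).
      by rewrite !addr_ge0 ?sqr_ge0.
    by ring.
  by clearbody n; lra.
have sgk := sqintB sg sk.
set q' := ip l (fun x => g x - k x) (fun x => g x - k x).
have q2 : q' <= (2 + 6 * (2 + l) * ip l bb bb) * n.
  have scb := sqintZ c sb.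
  have := ip_sumsq skg scb.
  rewrite (@eq_ip _ l (fun x => k0 x - g x + c * bb x) _ (fun x => - (g x - k x))
    (fun x => - (g x - k x))); [|by move=> x _; rewrite /k; ring..].
  rewrite (_ : ip l (fun x => - (g x - k x)) _ = q'); last first.
    by apply: eq_Rintegral => x _; rewrite mulrNN.
  rewrite ipZl// ipZr// => h; apply: le_trans h _.
  have : c ^+ 2 * ip l bb bb <= 3 * (2 + l) * n * ip l bb bb by rewrite ler_wpM2r.
  move: Qe; set X := ip l _ _; set Y := ip l _ _; clear -n.
  by clearbody X Y n; lra.
have q0 : 0 <= q' by exact: ip_ge0.
have uw : ip l (fun x => u x - (a + antiderivative k x))
    (fun x => u x - (a + antiderivative k x)) <= l * (2 * n + 2 * (l * q')).
  apply: le_ip_cst; [exact: ltW|exact: (sqintB (sqint_cont cu) (profile_sqint pw))|].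
  move=> x xl; rewrite (h1_ftc l0 hu xl) kE//.
  have [x0 xl'] := andP xl.
  have -> : u 0 + primitive g x - (a + primitive k x) =
     - (a - u 0) + primitive (fun t => g t - k t) x.
    by rewrite (primitive_sub sg sk xl); ring.
  apply: le_trans (sqrD_le2 _ _) _; rewrite sqrrN lerD ?ler_pM2l//.
  have := primitive_holder sgk (lexx 0) x0 xl'; rewrite primitive0 !subr0 => h.
  by apply: le_trans h _; rewrite ler_wpM2r.
apply: le_trans (lerD uw (lexx _)) _.
have -> : e = D * n by rewrite /n mulrC divfK ?gt_eqF.
have : (2 * l ^+ 2 + 1) * q' <= (2 * l ^+ 2 + 1) * ((2 + 6 * (2 + l) * ip l bb bb) * n).
  by rewrite ler_wpM2l// addr_ge0// mulr_ge0// sqr_ge0.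
rewrite /D; clear -n; set X := ip l bb bb; clearbody X q' n.
by lra.
Qed.

Lemma h1B l u g (u' g' : R -> R) : h1 l u g -> h1 l u' g' ->
  h1 l (fun x => u x - u' x) (fun x => g x - g' x).
Proof.
move=> [cu sg wu] [cu' sg' wu']; split; [|exact: sqintB|].
  apply/subspace_continuousP => x xl; apply: cvgB;
    [move/subspace_continuousP : cu|move/subspace_continuousP : cu']; exact.
move=> phi tphi; have sphi := test_function_sqint tphi.
have sphi' := test_function_sqint_derive tphi.
rewrite !ipBl//; [|exact: sqint_cont..].
by rewrite wu// wu'// opprB opprK addrC.
Qed.

Lemma profile_h1 l w k : 0 < l -> profile l w k -> h1 l w k.
Proof.
move=> l0 [tk Dw]; have ck := test_function_continuous tk; split.
- by apply: continuous_subspaceT; exact: profile_continuous (conj tk Dw).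
- exact: test_function_sqint.
- by move=> phi tphi; exact: C1_byparts.
Qed.

Lemma test_function_h1 l k : 0 < l -> test_function l k -> h1 l k (derive1 k).
Proof.
move=> l0 tk; have [dk ck _] := tk; split.
- by apply: continuous_subspaceT; exact: test_function_continuous tk.
- exact: test_function_sqint_derive tk.
- move=> phi tphi; apply: C1_byparts => // x.
  by split; [exact: dk|rewrite derive1E].
Qed.

End h1_approx.

(** * Reduction of complex-valued functions to real and imaginary parts *)

Section complex_sobolev.
Context {R : realType}.
Implicit Types (l : R) (u g : R -> R[i]^o).
Local Notation Re := (@complex.Re R).
Local Notation Im := (@complex.Im R).

Lemma normc_ge_Im (x : R[i]) : `|Im x|%:C%C <= `|x|.
Proof.
by case: x => a b; rewrite normc_def lecR /= -sqrtr_sqr ler_wsqrtr// lerDr sqr_ge0.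
Qed.

Lemma Re_continuous : continuous (Re : R[i]^o -> R).
Proof.
move=> z A /nbhs_ballP[e /= e0 eA].
apply/nbhs_ballP; exists e%:C%C; first by rewrite /= ltcR.
move=> t /= zt; apply: eA; rewrite /ball /= -ltcR; apply: le_lt_trans zt.
by have := normc_ge_Re (z - t); rewrite raddfB.
Qed.

Lemma Im_continuous : continuous (Im : R[i]^o -> R).
Proof.
move=> z A /nbhs_ballP[e /= e0 eA].
apply/nbhs_ballP; exists e%:C%C; first by rewrite /= ltcR.
move=> t /= zt; apply: eA; rewrite /ball /= -ltcR; apply: le_lt_trans zt.
by have := normc_ge_Im (z - t); rewrite raddfB.
Qed.

Lemma Complex_cvg (T : Type) (F : set_system T) (FF : Filter F) (a b : T -> R) (x y : R) :
  a @ F --> x -> b @ F --> y ->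
  ((fun t => Complex (a t) (b t)) : T -> R[i]^o) @ F --> (Complex x y : R[i]^o).
Proof.
move=> ax by_; apply/cvgrPdist_lt => /= e e0.
have [e0' ei] : 0 < Re e /\ Im e = 0.
  by move: e0; rewrite ltcE /= => /andP[/eqP -> ->].
have e2 : 0 < Re e / 2 by rewrite divr_gt0.
have eE : e = (Re e)%:C%C by rewrite [LHS]complexE ei mulr0 addr0.
near=> t; rewrite eE normc_def ltcR /=.
have h1 : `|x - a t| < Re e / 2 by near: t; exact: cvgr_dist_lt.
have h2 : `|y - b t| < Re e / 2 by near: t; exact: cvgr_dist_lt.
rewrite -[ltRHS](@ger0_norm _ (Re e)) ?ltW// -sqrtr_sqr ltr_sqrt ?exprn_gt0//.
rewrite -(real_normK (num_real (x - a t))) -(real_normK (num_real (y - b t))).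
have := normr_ge0 (x - a t); have := normr_ge0 (y - b t); nra.
Unshelve. all: by end_near. Qed.

Definition ch1 l u g : Prop :=
  h1 l (Re \o u) (Re \o g) /\ h1 l (Im \o u) (Im \o g).

Definition cip l u : R := ip l (Re \o u) (Re \o u) + ip l (Im \o u) (Im \o u).

Lemma cip_ge0 l u : 0 <= cip l u.
Proof. by rewrite addr_ge0// ip_ge0. Qed.

Lemma L2_normsq_itvE l u : sqint l (Re \o u) -> sqint l (Im \o u) ->
  L2_normsq_itv l u = (cip l u)%:E.
Proof.
move=> sr si; rewrite /L2_normsq_itv /cip EFinD -!EFin_ip//.
have ir := sr.2; have ii := si.2.
by rewrite -(integralD_EFin _ ir ii).
Qed.

Lemma L2_itvP l u : L2_itv l u <-> sqint l (Re \o u) /\ sqint l (Im \o u).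
Proof.
split=> [[mr mi Lu]|[sr si]]; last first.
  by split; [case: sr|case: si|rewrite L2_normsq_itvE// ltry].
have mr2 : measurable_fun `[0, l] (fun x => Re (u x) ^+ 2) by exact: measurable_funX.
have mi2 : measurable_fun `[0, l] (fun x => Im (u x) ^+ 2) by exact: measurable_funX.
have msum : lebesgue_measure.-integrable (`[0, l] : set (measurableTypeR R))
    (EFin \o (fun x => Re (u x) ^+ 2 + Im (u x) ^+ 2)).
  apply/integrableP; split.
    by apply/measurable_EFinP; exact: measurable_funD.
  move: Lu; rewrite /L2_normsq_itv; congr (_ < _)%E; apply: eq_integral => x _ /=.
  by rewrite ger0_norm ?addr_ge0 ?sqr_ge0.
split; split => //; apply: le_integrable msum => //.
- exact/measurable_EFinP.
- by move=> x _ /=; rewrite lee_fin !ger0_norm ?addr_ge0 ?sqr_ge0// lerDl sqr_ge0.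
- exact/measurable_EFinP.
- by move=> x _ /=; rewrite lee_fin !ger0_norm ?addr_ge0 ?sqr_ge0// lerDr sqr_ge0.
Qed.

Lemma ch1_H1_itv l u g : ch1 l u g -> H1_itv l u.
Proof.
move=> [[cr sr wr] [ci si wi]]; split.
- apply/subspace_continuousP => x xl.
  have -> : u = fun t => Complex (Re (u t)) (Im (u t)).
    by apply/funext => t; case: (u t).
  by apply: Complex_cvg; [move/subspace_continuousP : cr|
    move/subspace_continuousP : ci]; exact.
- by apply/L2_itvP; split; exact: sqint_cont.
- exists g; first by apply/L2_itvP.
  by move=> phi tphi; split; [exact: wr|exact: wi].
Qed.

Lemma H1_itv_ch1 l u : H1_itv l u -> ch1 l u (weak_derivative l u).
Proof.
move=> [cu Lu [g Lg wg]]; rewrite /weak_derivative.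
case: xgetP => [h _ [/L2_itvP[sr si] wh]|/(_ g)[]//].
split; split => //.
- apply/subspace_continuousP => x xl; apply: continuous_cvg; first exact: Re_continuous.
  by move/subspace_continuousP : cu; exact.
- by move=> phi tphi; have [] := wh _ tphi.
- apply/subspace_continuousP => x xl; apply: continuous_cvg; first exact: Im_continuous.
  by move/subspace_continuousP : cu; exact.
- by move=> phi tphi; have [] := wh _ tphi.
Qed.

(** [weak_derivative] is a choice made by [xget]; uniqueness up to a null set lets any known weak
    derivative compute its norm. *)
Lemma cip_weak_derivative l u g : 0 < l -> ch1 l u g ->
  cip l (weak_derivative l u) = cip l g.
Proof.
move=> l0 hu; have [[_ sr' wr'] [_ si' wi']] := H1_itv_ch1 (ch1_H1_itv hu).
have [[cr sr wr] [ci si wi]] := hu.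
by congr (_ + _); apply: ip_unique => //; apply: weakd_unique; eassumption.
Qed.

End complex_sobolev.

(** * Points and vertex stars of a metric graph *)

Section metric_graph_points.
Context {R : realType} (G : metric_graph R).
Implicit Types (e : edge G) (v w : vertex G) (x y : R) (p : point_of G).

Lemma set_val_clamp e x : 0 <= x <= length e -> set_val (clamp e x) = x.
Proof. by move=> /andP[x0 xl]; rewrite /clamp set_valE /= (min_idPl xl) (max_idPr x0). Qed.

Lemma clamp_set_val e (t : set_type (edge_itv e)) : clamp e (set_val t) = t.
Proof.
apply: val_inj => /=; case: t => x /= xl.
have := set_mem xl; rewrite /edge_itv/= in_itv/= => /andP[x0 xl'].
by rewrite set_valE/= (min_idPl xl') (max_idPr x0).
Qed.

Lemma set_val_itv e (t : set_type (edge_itv e)) : 0 <= set_val t <= length e.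
Proof. by case: t => x /= xl; have := set_mem xl; rewrite /edge_itv/= in_itv. Qed.

Definition clampr e x : R := Num.max 0 (Num.min x (length e)).

Lemma clampr_itv e x : 0 <= clampr e x <= length e.
Proof. by have := set_mem (clamp_edge e x); rewrite /edge_itv/= in_itv. Qed.

Lemma clampr_id e x : 0 <= x <= length e -> clampr e x = x.
Proof. by move=> /andP[x0 xl]; rewrite /clampr (min_idPl xl) (max_idPr x0). Qed.

Lemma chart_clampr e x : chart e (clampr e x) = chart e x.
Proof.
rewrite /chart; congr (\pi _); congr existT; apply: val_inj => /=.
exact: clampr_id (clampr_itv e x).
Qed.

Lemma chart_surj p : exists e x, 0 <= x <= length e /\ p = chart e x.
Proof.
rewrite -[p]reprK; case: (repr p) => e t; exists e, (set_val t).
by rewrite set_val_itv /chart clamp_set_val.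
Qed.

Lemma clampr_continuous e : continuous (clampr e).
Proof.
move=> x; apply: (@continuous_max R R (cst 0) (fun x => Num.min x (length e))).
  exact: cvg_cst.
apply: (@continuous_min R R id (cst (length e))); first exact: cvg_id.
exact: cvg_cst.
Qed.

Lemma chart_continuous e : continuous (chart e).
Proof.
move=> x.
have c1 : {for x, continuous (clamp e)}.
  by apply: continuous_comp_initial; exact: clampr_continuous.
have c2 := @existT_continuous (edge G) (fun e => set_type (edge_itv e)) e (clamp e x).
have c3 := @pi_continuous _ (point_of G) (existT _ e (clamp e x) : edge_sum G).
exact: (continuous_comp (continuous_comp c1 c2) c3).
Qed.

(** The topology is the quotient of the disjoint union of the edges. Since charts clamp their
    argument, preimages are open in the whole line and restrict to the edges. *)
Lemma open_chartP (U : set (point_of G)) :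
  open U <-> forall e, open (chart e @^-1` U).
Proof.
split=> [oU e|oU].
  by apply: open_comp => // x _; exact: chart_continuous.
apply/sigT_openP => e.
exists (chart e @^-1` U) => //.
by apply/seteqP; split => t /=; rewrite /chart clamp_set_val.
Qed.

Lemma continuous_chartP (Z : topologicalType) (f : point_of G -> Z) :
  (forall e, continuous (f \o chart e)) -> continuous f.
Proof.
move=> cf; apply/continuousP => A oA; apply/open_chartP => e.
by rewrite -comp_preimage; move/continuousP : (cf e); exact.
Qed.

(* With [Z := Prop] this also defines sets of points edge by edge. *)
Definition glue_fun (Z : Type) (F : edge G -> R -> Z) p : Z :=
  let: existT e t := repr p in F e (set_val t).

Definition compatible (Z : Type) (F : edge G -> R -> Z) (phi : vertex G -> Z) :=
  forall e, F e 0 = phi (source e) /\ F e (length e) = phi (target e).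

(** [repr] may return an end point of any edge at a vertex; compatibility makes the value
    independent of that choice. *)
Lemma glue_funE (Z : Type) (F : edge G -> R -> Z) phi : compatible F phi ->
  forall e x, glue_fun F (chart e x) = F e (clampr e x).
Proof.
move=> cF e x; rewrite /glue_fun /chart.
set q : edge_sum G := existT _ e (clamp e x).
have lies e' t v : lies_at (existT _ e' t : edge_sum G) v -> F e' (set_val t) = phi v.
  by move=> [[<- ->]|[<- ->]]; have [] := cF e'.
have /eqmodP/asboolP := reprK (\pi_(point_of G) q).
move: (repr _) => r [->|[v]]; first by rewrite /q set_valE.
by case: r => e' t /lies -> /lies; rewrite set_valE.
Qed.

Lemma glue_funE_in (Z : Type) (F : edge G -> R -> Z) phi : compatible F phi ->
  forall e x, 0 <= x <= length e -> glue_fun F (chart e x) = F e x.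
Proof. by move=> cF e x xl; rewrite (glue_funE cF) clampr_id. Qed.

Lemma incident_edge v : exists e, source e = v \/ target e = v.
Proof.
have [w wv] : exists w, w <> v.
  apply: contrapT => /forallNP h; apply: (@vertex_infinite _ G).
  rewrite (_ : [set: vertex G] = [set v]); first exact: finite_set1.
  by apply/seteqP; split => // w _ /=; apply: contrapT => /h.
have [p] := graph_connected v w; case: p => [_ /= vw|u p /= /andP[/asboolP[e ee] _] _].
  by case: (wv (esym vw)).
exists e; have : [set source e; target e] v by rewrite ee; left.
by move=> []; [left|right].
Qed.

(** Points are classes of edge points, so a vertex becomes a point only through an incident edge;
    the default of [xget] is built from one. *)
Definition vpoint v : point_of G :=
  xget (chart (projT1 (cid (incident_edge v))) 0) [set p | vertex_point v p].

Lemma chart_glue e x e' x' v : lies_at (existT _ e (clamp e x)) v ->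
  lies_at (existT _ e' (clamp e' x')) v -> chart e x = chart e' x'.
Proof. by move=> h h'; apply/eqmodP/asboolP; right; exists v. Qed.

Lemma lies_source e : lies_at (existT _ e (clamp e 0)) (source e).
Proof. by left; split => //; rewrite set_val_clamp// lexx ltW// length_gt0. Qed.

Lemma lies_target e : lies_at (existT _ e (clamp e (length e))) (target e).
Proof. by right; split => //; rewrite set_val_clamp// lexx ltW// length_gt0. Qed.

Lemma vertex_point_unique v p q : vertex_point v p -> vertex_point v q -> p = q.
Proof.
move=> [e he] [e' he'].
by case: he he' => -[<- ->] [] [ee ->]; apply: chart_glue;
  (exact: lies_source || exact: lies_target ||
   (rewrite -ee; exact: lies_source) || (rewrite -ee; exact: lies_target)).
Qed.

Lemma vpointP v : vertex_point v (vpoint v).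
Proof.
rewrite /vpoint; case: xgetP => // h; have [e [s|t]] := incident_edge v.
  by case: (h (chart e 0)); exists e; left.
by case: (h (chart e (length e))); exists e; right.
Qed.

Lemma chart0 e : chart e 0 = vpoint (source e).
Proof. by apply: vertex_point_unique (vpointP _); exists e; left. Qed.

Lemma chartl e : chart e (length e) = vpoint (target e).
Proof. by apply: vertex_point_unique (vpointP _); exists e; right. Qed.

Lemma glue_fun_vpoint (Z : Type) (F : edge G -> R -> Z) phi : compatible F phi ->
  forall v, glue_fun F (vpoint v) = phi v.
Proof.
move=> cF v; have [e [<-|<-]] := incident_edge v.
  by rewrite -chart0 (glue_funE_in cF) ?(cF e).1// lexx ltW// length_gt0.
by rewrite -chartl (glue_funE_in cF) ?(cF e).2// lexx ltW// length_gt0.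
Qed.

(* The union of the open stars of the vertices in [C]. *)
Definition in_star (C : set (vertex G)) e x : Prop :=
  (C (source e) /\ x < length e) \/ (C (target e) /\ 0 < x).

Definition star (C : set (vertex G)) : set (point_of G) := glue_fun (in_star C).

Lemma in_star_compatible C : compatible (in_star C) C.
Proof.
move=> e; have l0 := length_gt0 e; split; apply/propext; split; rewrite /in_star.
- by case=> [[]//|[_]]; rewrite ltxx.
- by left.
- by case=> [[_]|[]//]; rewrite ltxx.
- by right.
Qed.

Lemma starE C e x : star C (chart e x) = in_star C e (clampr e x).
Proof. exact: glue_funE (in_star_compatible C) e x. Qed.

Lemma starE_in C e x : 0 <= x <= length e -> star C (chart e x) = in_star C e x.
Proof. exact: glue_funE_in (in_star_compatible C) e x. Qed.

Lemma star_vpoint C v : star C (vpoint v) = C v.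
Proof. exact: glue_fun_vpoint (in_star_compatible C) v. Qed.

Lemma star_chart C e : chart e @^-1` star C =
  [set x | (C (source e) /\ x < length e) \/ (C (target e) /\ 0 < x)].
Proof.
have l0 := length_gt0 e; apply/seteqP; split => x /=; rewrite starE /in_star /clampr;
  by rewrite gt_max gt_min lt_max lt_min !ltxx l0 /= andbT orbF.
Qed.

Lemma open_star C : open (star C).
Proof.
apply/open_chartP => e; rewrite star_chart.
have [cs|cs] := asboolP (C (source e)); have [ct|ct] := asboolP (C (target e)).
- rewrite (_ : [set _ | _] = [set x | x < length e] `|` [set x | 0 < x]).
    by apply: openU; [exact: open_lt|exact: open_gt].
  by apply/seteqP; split => x /=; tauto.
- rewrite (_ : [set _ | _] = [set x | x < length e]); first exact: open_lt.
  by apply/seteqP; split => x /=; tauto.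
- rewrite (_ : [set _ | _] = [set x | 0 < x]); first exact: open_gt.
  by apply/seteqP; split => x /=; tauto.
- rewrite (_ : [set _ | _] = set0); first exact: open0.
  by apply/seteqP; split => x /=; tauto.
Qed.

End metric_graph_points.

(** * Paths and connectivity inside sets of vertices *)

Section graph_paths.
Context {R : realType} (G : metric_graph R).
Implicit Types (e : edge G) (u v w : vertex G) (A C : set (vertex G)).

Definition adj v w : bool :=
  `[< exists e : edge G, [set source e; target e] = [set v; w] >].

Definition incident v : set (edge G) := [set e | source e = v \/ target e = v].

Lemma adjP v w : adj v w -> exists e : edge G,
  (source e = v /\ target e = w) \/ (source e = w /\ target e = v).
Proof.
move=> /asboolP[e ee]; exists e; have st := @no_loop _ _ e.
have : [set source e; target e] v by rewrite ee; left.
have : [set source e; target e] w by rewrite ee; right.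
have : [set v; w] (source e) by rewrite -ee; left.
have : [set v; w] (target e) by rewrite -ee; right.
by move=> /= [tv|tw] [sv|sw] vv ww; [case: st; congruence|right|left|case: st; congruence].
Qed.

Lemma edge_adj e : adj (source e) (target e).
Proof. by apply/asboolP; exists e. Qed.

Lemma adj_sym v w : adj v w = adj w v.
Proof.
by apply/asboolP/asboolP => -[e ee]; exists e; rewrite ee setUC.
Qed.

Lemma finite_adj v : finite_set [set w | adj v w].
Proof.
have fv := @locally_finite _ _ v.
apply: (@sub_finite_set _ _ ((@source _ _ @` incident v) `|` (@target _ _ @` incident v))).
  move=> w /adjP[e [[sv tw]|[sw tv]]].
    by right; exists e => //; left.
  by left; exists e => //; right.
by rewrite finite_setU; split; exact: finite_image.
Qed.

Lemma finite_edges_at C : finite_set C ->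
  finite_set [set e | C (source e) \/ C (target e)].
Proof.
move=> fC; apply: (@sub_finite_set _ _ (\bigcup_(v in C) incident v)).
  by move=> e [Cs|Ct]; [exists (source e) => //; left|exists (target e) => //; right].
by apply: bigcup_finite => // v _; exact: locally_finite.
Qed.

Definition conn A v w : Prop :=
  exists p, [/\ path adj v p, last v p = w & forall u, u \in v :: p -> A u].

Lemma conn_refl A v : A v -> conn A v v.
Proof. by move=> Av; exists [::]; split => // u; rewrite inE => /eqP ->. Qed.

Lemma conn_trans A u v w : conn A u v -> conn A v w -> conn A u w.
Proof.
move=> [p [pp pl pA]] [q [qp ql qA]]; exists (p ++ q); split.
- by rewrite cat_path pp pl qp.
- by rewrite last_cat pl.
move=> x; rewrite -cat_cons mem_cat => /orP[/pA//|xq]; apply: qA.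
by rewrite inE xq orbT.
Qed.

Lemma conn_sym A v w : conn A v w -> conn A w v.
Proof.
move=> [p [pp <- pA]]; exists (rev (belast v p)); split.
- by rewrite rev_path; under eq_path do rewrite adj_sym.
- by case: p {pp pA} => //= x p; rewrite rev_cons last_rcons.
move=> x; rewrite inE mem_rev => /orP[/eqP ->|/mem_belast]; apply: pA.
  exact: mem_last.
Qed.

Lemma conn_sub A B v w : A `<=` B -> conn A v w -> conn B v w.
Proof. by move=> AB [p [pp pl pA]]; exists p; split => // u /pA/AB. Qed.

Lemma conn_l A v w : conn A v w -> A v.
Proof. by move=> [p [_ _ pA]]; apply: pA; rewrite mem_head. Qed.

Lemma conn_r A v w : conn A v w -> A w.
Proof. by move=> /conn_sym/conn_l. Qed.

Lemma conn_adj A v w : adj v w -> A v -> A w -> conn A v w.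
Proof.
move=> vw Av Aw; exists [:: w]; split => //=; first by rewrite vw.
by move=> u; rewrite !inE => /orP[] /eqP ->.
Qed.

Lemma conn_setT v w : conn setT v w.
Proof. by have [p pp pl] := graph_connected v w; exists p. Qed.

(** The path is first made simple: its edges are then distinct, and the sum of [N] along it is
    bounded by the total over the edges inside [A]. *)
Lemma path_estimate (N : edge G -> R) (val : vertex G -> R) A v w :
  (forall e, val (source e) <= val (target e) + N e) ->
  (forall e, val (target e) <= val (source e) + N e) ->
  conn A v w -> exists s : seq (edge G), [/\ uniq s,
    forall e, e \in s -> A (source e) /\ A (target e) &
    val w <= val v + \sum_(e <- s) N e].
Proof.
move=> h1 h2 [p [pp <- pA]]; case: (shortenP pp) => q qp uq qs.
have {pA}qA u : u \in v :: q -> A u.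
  by move=> uq'; apply: pA; move: uq'; rewrite !inE => /orP[->//|/qs ->]; rewrite orbT.
suff [s [us sA sN]] : exists s : seq (edge G), [/\ uniq s,
    forall e, e \in s -> source e \in v :: q /\ target e \in v :: q &
    val (last v q) <= val v + \sum_(e <- s) N e].
  by exists s; split => // e /sA [? ?]; split; exact: qA.
elim: q v qp uq {pp qs qA p} => [|x q IH] v /=.
  by move=> _ _; exists [::]; split => //; rewrite big_nil addr0.
move=> /andP[/adjP[e ee] xq] /andP[vq /(IH _ xq)[s [us sq sN]]].
exists (e :: s); split => /=.
(* The edges in [s] have both ends on the rest of the path, which avoids v, whereas v is an end of
   e. *)
- rewrite us andbT; apply/negP => /sq[se te].
  by case: ee => -[]; [move=> h _|move=> _ h]; rewrite h in se te;
    move: vq; rewrite ?se ?te.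
- move=> e'; rewrite inE => /orP[/eqP ->|/sq[h h']]; last first.
    by rewrite inE h orbT inE h' orbT.
  by case: ee => -[-> ->]; rewrite !inE !eqxx ?orbT.
rewrite big_cons; apply: (le_trans sN); rewrite addrA lerD2r.
by case: ee => -[<- <-]; [exact: h2|exact: h1].
Qed.

End graph_paths.

(** * Unions of open stars and their connectedness *)

Section stars.
Context {R : realType} (G : metric_graph R).
Implicit Types (e : edge G) (u v w : vertex G) (A C : set (vertex G)).

Lemma starU C1 C2 : star (C1 `|` C2) = star C1 `|` star C2.
Proof.
apply/seteqP; split => p; have [e [x [xl ->]]] := chart_surj p;
  rewrite /= !starE_in// /in_star /setU/=; tauto.
Qed.

Lemma star_bigcup (I : Type) (D : set I) (C : I -> set (vertex G)) :
  star (\bigcup_(i in D) C i) = \bigcup_(i in D) star (C i).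
Proof.
apply/seteqP; split => p; have [e [x [xl ->]]] := chart_surj p.
  rewrite /= starE_in// => -[[[i Di Ci] h]|[[i Di Ci] h]]; exists i => //;
    rewrite starE_in//; [by left|by right].
move=> [i Di]; rewrite !starE_in// => -[[Ci h]|[Ci h]]; [left|right];
  by split => //; exists i.
Qed.

Lemma star_cover p : exists v, star [set v] p.
Proof.
have [e [x [xl ->]]] := chart_surj p; have [x1|x1] := eqVneq x (length e).
  exists (target e); rewrite starE_in//; right; split => //.
  by rewrite x1 length_gt0.
exists (source e); rewrite starE_in//; left; split => //.
by rewrite lt_def eq_sym x1; case/andP: xl.
Qed.

Lemma star_sub C1 C2 : C1 `<=` C2 -> star C1 `<=` star C2.
Proof.
move=> h p; have [e [x [xl ->]]] := chart_surj p.
by rewrite !starE_in// => -[[/h ? ?]|[/h ? ?]]; [left|right].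
Qed.

Lemma star_disjoint C1 C2 : C1 `&` C2 = set0 ->
  (forall e, ~ (C1 (source e) /\ C2 (target e))) ->
  (forall e, ~ (C2 (source e) /\ C1 (target e))) -> star C1 `&` star C2 = set0.
Proof.
move=> C12 h1 h2; rewrite -subset0 => p; have [e [x [xl ->]]] := chart_surj p.
move=> []; rewrite !starE_in//.
have C12' v : C1 v -> C2 v -> False.
  by move=> c1 c2; have : (C1 `&` C2) v by []; rewrite C12.
by move=> [[c1 _]|[c1 _]] [[c2 _]|[c2 _]]; [exact: (C12' _ c1 c2)|
  exact: (h1 e (conj c1 c2))|exact: (h2 e (conj c2 c1))|exact: (C12' _ c1 c2)].
Qed.

Lemma star1_connected v : connected (star [set v]).
Proof.
pose J e : set R := [set x | 0 <= x <= length e /\ in_star [set v] e x].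
have -> : star [set v] = \bigcup_(e in incident v) (chart e @` J e).
  apply/seteqP; split => p.
    have [e [x [xl ->]]] := chart_surj p; rewrite starE_in// => h.
    exists e; last by exists x.
    by case: h => -[h _]; [left|right].
  by move=> [e ev [x [xl h] <-]]; rewrite starE_in.
apply: bigcup_connected.
  exists (vpoint v) => e ev; have l0 := length_gt0 e.
  case: ev => ev.
    exists 0; last by rewrite chart0 ev.
    by split; [rewrite lexx ltW|left; rewrite ev].
  exists (length e); last by rewrite chartl ev.
  by split; [rewrite lexx ltW|right; rewrite ev].
move=> e ev; apply: connected_continuous_connected.
  apply/connected_intervalP => x y [xl hx] [yl hy] z /andP[xz zy].
  have [x0 _] := andP xl; have [_ yl'] := andP yl.
  split; first by rewrite (le_trans x0 xz) (le_trans zy yl').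
  have st := @no_loop _ _ e.
  case: hx hy => -[/= hx1 hx2] [] [/= hy1 hy2].
  - by left; split => //; exact: le_lt_trans hy2.
  - by case: st; rewrite hx1 hy1.
  - by case: st; rewrite hx1 hy1.
  - by right; split => //; exact: lt_le_trans xz.
by apply: continuous_subspaceT; exact: chart_continuous.
Qed.

Lemma star_path_connected v p : path (@adj _ G) v p ->
  connected (star [set u | u \in v :: p]).
Proof.
elim: p v => [|w p IH] v /=.
  move=> _; rewrite (_ : [set u | _] = [set v]); first exact: star1_connected.
  by apply/seteqP; split => u /=; rewrite inE => /eqP.
move=> /andP[/adjP[e ee] /IH cp].
rewrite (_ : [set u | _] = [set v] `|` [set u | u \in w :: p]); last first.
  apply/seteqP; split => u /=; rewrite !inE.
    by case/orP => [/eqP ->|->]; [left|right].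
  by case=> [->|->]; rewrite ?eqxx ?orbT.
rewrite starU; apply: connectedU => //; last exact: star1_connected.
(* The midpoint of the joining edge lies in both stars. *)
have l0 := length_gt0 e; exists (chart e (length e / 2)).
have l2 : 0 <= length e / 2 <= length e by apply/andP; split; lra.
split; rewrite starE_in// /in_star/=.
  by case: ee => -[h h']; [left|right]; split => //; lra.
by case: ee => -[h h']; [right; rewrite h'|left; rewrite h]; split;
  rewrite ?inE ?eqxx//; lra.
Qed.

(** The stars along the paths in [A] from v are connected and share the point v. *)
Lemma star_component_connected A v : connected (star [set w | conn A v w]).
Proof.
have [Av|nAv] := pselect (A v); last first.
  rewrite (_ : [set w | _] = \bigcup_(i in set0) (fun _ => set0) (i : nat)); last first.
    by rewrite bigcup_set0 -subset0 => w /conn_l.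
  by rewrite star_bigcup bigcup_set0; exact: connected0.
pose D := [set p | path (@adj _ G) v p /\ forall u, u \in v :: p -> A u].
have -> : [set w | conn A v w] = \bigcup_(p in D) [set u | u \in v :: p].
  apply/seteqP; split => w /=.
    by move=> [p [pp <- pA]]; exists p => //=; exact: mem_last.
  move=> [p [pp pA] /= wp]; move/splitPl : wp pp pA => [p1 p2 <-] pp pA.
  exists p1; split => //; first by move: pp; rewrite cat_path => /andP[].
  by move=> u up; apply: pA; rewrite -cat_cons mem_cat up.
rewrite star_bigcup; apply: bigcup_connected.
  by exists (vpoint v) => p _; rewrite star_vpoint /= mem_head.
by move=> p [pp _]; exact: star_path_connected.
Qed.

End stars.

(** * Ends obtained from nested components *)

Section component_ends.
Context {R : realType} (G : metric_graph R).
Implicit Types (e : edge G) (u v w : vertex G) (A C S : set (vertex G)).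

Lemma closure_disjoint (T : topologicalType) (W U : set T) p :
  open W -> W p -> W `&` U = set0 -> ~ closure U p.
Proof.
move=> oW Wp WU /(_ W (open_nbhs_nbhs (conj oW Wp)))[q [Uq Wq]].
by have : (W `&` U) q by []; rewrite WU.
Qed.

Definition edge_interior e : set (point_of G) :=
  glue_fun (fun e' x => e' = e /\ 0 < x < length e').

Lemma edge_interior_compatible e :
  compatible (fun e' x => e' = e /\ 0 < x < length e') (fun _ => False).
Proof.
by move=> e'; split; apply/propext; split => // -[_]; rewrite ltxx ?andbF.
Qed.

Lemma edge_interiorE e e' x : 0 <= x <= length e' ->
  edge_interior e (chart e' x) = (e' = e /\ 0 < x < length e').
Proof. exact: (glue_funE_in (edge_interior_compatible e)). Qed.

Lemma open_edge_interior e : open (edge_interior e).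
Proof.
apply/open_chartP => e'.
have [ee|ee] := pselect (e' = e); last first.
  rewrite (_ : _ @^-1` _ = set0); first exact: open0.
  rewrite -subset0 => x /=; rewrite -chart_clampr edge_interiorE ?clampr_itv//.
  by case.
rewrite (_ : _ @^-1` _ = [set x | 0 < x] `&` [set x | x < length e']).
  exact: openI (@open_gt _ _) (@open_lt _ _).
have l0 := length_gt0 e'.
have H x : (0 < clampr e' x < length e') = (0 < x) && (x < length e').
  by rewrite /clampr gt_max gt_min lt_max lt_min !ltxx l0 /= andbT orbF.
apply/seteqP; split => x /=; rewrite -chart_clampr edge_interiorE ?clampr_itv// H.
  by move=> [_ /andP[]].
by move=> [-> ->].
Qed.

Lemma star_component_disjoint A r v : A v -> ~ conn A r v ->
  star [set v] `&` star [set w | conn A r w] = set0.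
Proof.
move=> Av nv.
have H w : adj v w -> ~ conn A r w.
  move=> vw rw; apply: nv; apply: (conn_trans rw).
  by apply: conn_adj => //; [rewrite adj_sym|exact: conn_r rw].
apply: star_disjoint.
- by rewrite -subset0 => w [-> ].
- by move=> e [/= sv]; apply: H; rewrite -sv; exact: edge_adj.
- by move=> e [/= h se]; apply: H h; rewrite -se adj_sym edge_adj.
Qed.

(** Only removed vertices can be boundary points: an open edge is contained in the star of the
    component or disjoint from it, and a vertex of [A] outside the component has an open star
    disjoint from it. *)
Lemma boundary_component A r : finite_set (~` A) ->
  finite_set (boundary (star [set w | conn A r w])).
Proof.
move=> fA; apply: sub_finite_set (finite_image (@vpoint _ G) fA).
set C := [set w | conn A r w].
have V v : closure (star C) (vpoint v) -> ~ star C (vpoint v) -> (~` A) v.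
  rewrite star_vpoint => cv nC Av; move: cv; apply: closure_disjoint.
  - exact: open_star [set v].
  - by rewrite star_vpoint.
  - exact: star_component_disjoint.
have int : interior (star C) = star C by apply/interior_id; exact: open_star.
move=> p [cp]; rewrite int.
have [e [x [xl pE]]] := chart_surj p; rewrite pE in cp * => np.
have [x0|x0] := eqVneq x 0.
  by rewrite x0 chart0 in cp np *; exists (source e) => //; exact: V.
have [x1|x1] := eqVneq x (length e).
  by rewrite x1 chartl in cp np *; exists (target e) => //; exact: V.
exfalso; move: cp; apply: (@closure_disjoint _ (edge_interior e)); first exact: open_edge_interior.
  by rewrite edge_interiorE// !lt_def x0 eq_sym x1.
rewrite -subset0 => q; have [e' [y [yl ->]]] := chart_surj q.
move=> []; rewrite edge_interiorE// starE_in// => -[ee _]; subst e'.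
move: np; rewrite starE_in//; have [x0' xl'] := andP xl.
move=> np [[h _]|[h _]]; apply: np.
  by left; rewrite lt_def eq_sym x1.
by right; rewrite lt_def x0.
Qed.

Definition component_sequence (A : nat -> set (vertex G))
    (C : nat -> set (vertex G)) : Prop :=
  [/\ forall n, exists2 r, A n r & C n = [set w | conn (A n) r w],
      forall n, C n.+1 `<=` C n,
      forall n, finite_set (~` A n) &
      forall F, finite_set F -> exists n, F `<=` ~` A n].

Lemma component_sequence_end (A C : nat -> set (vertex G)) : component_sequence A C ->
  end_sequence (fun n => star (C n)).
Proof.
move=> [AC Cn fA exh]; split.
- move=> n; have [r Ar ->] := AC n; exists (vpoint r).
  by rewrite star_vpoint; exact: conn_refl.
- by move=> n; exact: open_star.
- by move=> n; have [r Ar ->] := AC n; exact: star_component_connected.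
- move=> n; have [r Ar ->] := AC n; apply: finite_compact.
  exact: boundary_component.
- by move=> n; exact: star_sub.
rewrite -subset0 => p cp; have [v vp] := star_cover p.
(* Once v and all its neighbours are removed, the open star of v, which contains p, misses the star
   of the component. *)
have fF : finite_set ([set v] `|` [set w | adj v w]).
  by rewrite finite_setU; split; [exact: finite_set1|exact: finite_adj].
have [n nF] := exh _ fF.
have := cp n I; apply: closure_disjoint vp _; first exact: open_star.
have [r Ar Cr] := AC n; have CA w : C n w -> A n w by rewrite Cr; exact: conn_r.
apply: star_disjoint.
- rewrite -subset0 => w [-> /CA]; apply: (nF v); by left.
- by move=> e' [/= se /CA]; apply: nF; right; rewrite /= -se edge_adj.
- by move=> e' [/CA + /= se]; apply: nF; right; rewrite /= -se adj_sym edge_adj.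
Qed.

(** A path from v0 to v in A either stays in A or leaves the finite complement for the last time at
    a neighbour of a removed vertex. *)
Lemma finite_representatives A : finite_set (~` A) ->
  exists2 B, finite_set B & forall v, A v -> exists2 b, B b & conn A b v.
Proof.
move=> fA; have [v0 _] := infinite_setN0 (@vertex_infinite _ G).
exists ([set v0] `|` \bigcup_(u in ~` A) [set w | adj u w]).
  rewrite finite_setU; split; first exact: finite_set1.
  by apply: bigcup_finite => // u _; exact: finite_adj.
move=> v Av; have [p pp pl] := graph_connected v0 v.
suff : conn A v0 v \/ exists2 b, (\bigcup_(u in ~` A) [set w | adj u w]) b & conn A b v.
  by move=> [h|[b Bb bv]]; [exists v0 => //; left|exists b => //; right].
elim: p v0 pp pl => [|y p IH] x /=.
  by move=> _ ->; left; exact: conn_refl.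
move=> /andP[xy yp] pl; have [yv|h] := IH y yp pl; last by right.
have [Ax|nAx] := pselect (A x).
  by left; apply: (conn_trans _ yv); apply: conn_adj => //; exact: conn_l yv.
by right; exists y => //; exists x.
Qed.

(** König's lemma: at each stage a component with infinitely many vertices of [S] splits into
    finitely many pieces and finitely many removed vertices, so some piece keeps infinitely many. *)
Lemma koenig S : infinite_set S ->
  exists A C : nat -> set (vertex G),
    component_sequence A C /\ forall n, infinite_set (S `&` C n).
Proof.
move=> infS; have [i ii] := countable_injP _ (@vertex_countable _ G).
pose A n : set (vertex G) := [set v | (n <= i v)%N].
have fA n : finite_set (~` A n).
  apply: (@sub_finite_set _ _ (i @^-1` `I_n)).
    by move=> v /= /negP; rewrite -ltnNge.
  apply: finite_preimage; last exact: finite_II.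
  by move=> x y _ _; apply: ii; rewrite inE.
have exh F : finite_set F -> exists n, F `<=` ~` A n.
  move=> fF; have [n nF] : exists n, i @` F `<=` `I_n.
    have [s sF] := (finite_seqP _).1 fF; exists (\max_(v <- s) i v).+1.
    move=> _ [v Fv <-] /=; rewrite ltnS; apply: leq_bigmax_seq => //.
    by move: Fv; rewrite sF.
  by exists n => v Fv; have := nF (i v) (ex_intro2 _ _ v Fv erefl); rewrite /= ltnNge => /negP.
have step n r : infinite_set (S `&` [set w | conn (A n) r w]) ->
    exists r', conn (A n) r r' /\ infinite_set (S `&` [set w | conn (A n.+1) r' w]).
  move=> inf; have [B fB hB] := finite_representatives (fA n.+1).
  have [b [Bb binf]] : exists b, B b /\ infinite_set
      ((S `&` [set w | conn (A n) r w]) `&` [set w | conn (A n.+1) b w]).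
    apply: contrapT => /forallNP h; apply: inf.
    apply: (@sub_finite_set _ _ (~` A n.+1 `|` \bigcup_(b in B)
      ((S `&` [set w | conn (A n) r w]) `&` [set w | conn (A n.+1) b w]))).
      move=> w Sw; have [Aw|] := pselect (A n.+1 w); last by left.
      by right; have [b Bb bw] := hB w Aw; exists b.
    rewrite finite_setU; split => //; apply: bigcup_finite => // b Bb.
    by apply: contrapT => hb; apply: (h b).
  (* The new root is taken in both the old and the new component, which gives nestedness. *)
  have [r' [[Sr' rr'] br']] := infinite_setN0 binf.
  exists r'; split => //; move: binf; apply: contra_not; apply: sub_finite_set => w [[Sw _] bw]; split => //.
  exact: conn_trans (conn_sym br') bw.
have [v0 _] := infinite_setN0 (@vertex_infinite _ G).
pose next n r := xget v0 [set r' | conn (A n) r r' /\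
  infinite_set (S `&` [set w | conn (A n.+1) r' w])].
have nextP n r : infinite_set (S `&` [set w | conn (A n) r w]) ->
    conn (A n) r (next n r) /\
    infinite_set (S `&` [set w | conn (A n.+1) (next n r) w]).
  move=> inf; rewrite /next; case: xgetP => [r' _ []//|h].
  by have [r' hr'] := step _ _ inf; case: (h r').
pose fix r n := if n is m.+1 then next m (r m) else v0.
have rinf n : infinite_set (S `&` [set w | conn (A n) (r n) w]).
  (* [A 0] contains all vertices, so the first component is the whole graph. *)
  elim: n => [|n /nextP[]//]; move: infS; apply: contra_not.
  apply: sub_finite_set => w Sw; split => //.
  by apply: conn_sub (conn_setT v0 w).
have rconn n : conn (A n) (r n) (r n.+1) by have [] := nextP _ _ (rinf n).
exists A, (fun n => [set w | conn (A n) (r n) w]); split; last first.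
  exact: rinf.
split => // n.
  by exists (r n) => //; exact: conn_l (rconn n).
move=> w /= h; apply: (conn_trans (rconn n)).
by apply: conn_sub h => v; rewrite /A /=; exact: ltnW.
Qed.

End component_ends.

(** * Energy of a function on the graph *)

Section esum_real.
Context {R : realType} {I : choiceType}.
Implicit Types (D : set I) (N : I -> R) (c : R) (s : seq I).

Lemma esum_leP D N c :
  (\esum_(i in D) (N i)%:E <= c%:E)%E <->
  forall s, uniq s -> (forall i, i \in s -> D i) -> \sum_(i <- s) N i <= c.
Proof.
split=> [h s us sD|h].
  rewrite -lee_fin; apply: le_trans h; apply: ereal_sup_ubound.
  exists [set` s]; first by split => //; exact: finite_seq.
  by rewrite -fsbig_seq// sumEFin.
apply: ge_ereal_sup => _ [X [fX XD] <-].
rewrite fsumEFin// lee_fin fsbig_finite//=; apply: h.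
  exact: finmap.fset_uniq.
by move=> i; rewrite in_fset_set// inE => /XD.
Qed.

Lemma esum_lty_le D N : (forall i, 0 <= N i) ->
  (\esum_(i in D) (N i)%:E < +oo)%E ->
  exists2 c, 0 <= c & (\esum_(i in D) (N i)%:E <= c%:E)%E.
Proof.
move=> N0 h; have h0 : (0 <= \esum_(i in D) (N i)%:E)%E.
  by apply: esum_ge0 => i _; rewrite lee_fin.
exists (fine (\esum_(i in D) (N i)%:E)); first exact: fine_ge0.
by rewrite fineK// ge0_fin_numE.
Qed.

Lemma esum_scale D N c K : 0 <= K ->
  (\esum_(i in D) (N i)%:E <= c%:E)%E -> (\esum_(i in D) (K * N i)%:E <= (K * c)%:E)%E.
Proof.
move=> K0 /esum_leP h; apply/esum_leP => s us sD.
by rewrite -mulr_sumr ler_wpM2l// h.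
Qed.

(** A finite set whose partial sum is within [e] of the supremum. *)
Lemma esum_tail N (e : R) : (forall i, 0 <= N i) -> 0 < e ->
  (\esum_(i in [set: I]) (N i)%:E < +oo)%E ->
  exists2 F, finite_set F & (\esum_(i in ~` F) (N i)%:E <= e%:E)%E.
Proof.
move=> N0 e0 h; have h0 : (0 <= \esum_(i in [set: I]) (N i)%:E)%E.
  by apply: esum_ge0 => i _; rewrite lee_fin.
have hf : \esum_(i in [set: I]) (N i)%:E \is a fin_num by rewrite ge0_fin_numE.
have [_ [X [fX _] <-]] := ub_ereal_sup_adherent e0 hf.
rewrite -/(esum _ _) => hX; exists X => //.
have N0' i : [set: I] i -> (0 <= (N i)%:E)%E by rewrite lee_fin.
rewrite (@esumID R I X setT _ N0') !setTI in hX h0 h hf.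
rewrite esum_fset// in hX h hf; last by move=> i _; rewrite lee_fin.
rewrite fsumEFin// in hX h hf.
move: hX h hf; set T := esum _ _; case: T => [t| |]//.
move=> h _ _; have {}h : (((\sum_(i \in X) N i) + t - e)%:E <
  (\sum_(i \in X) N i)%:E)%E := h.
by move: h; rewrite lte_fin lee_fin; lra.
Qed.

Lemma esum_finite_support N F : (forall i, 0 <= N i) -> finite_set F ->
  (forall i, ~ F i -> N i = 0) -> (\esum_(i in [set: I]) (N i)%:E < +oo)%E.
Proof.
move=> N0 fF NF.
have N0' i : [set: I] i -> (0 <= (N i)%:E)%E by rewrite lee_fin.
rewrite (@esumID R I F setT _ N0') !setTI [X in (_ + X)%E]esum1; last by move=> i /NF ->.
rewrite adde0 esum_fset//; last by move=> i _; rewrite lee_fin.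
by rewrite fsumEFin// ltry.
Qed.

Lemma finite_min F (d : I -> R) : finite_set F -> (forall i, 0 < d i) ->
  exists2 c, 0 < c & forall i, F i -> c <= d i.
Proof.
move=> /finite_seqP[s ->] d0; elim: s => [|i s [c c0 cs]].
  by exists 1.
exists (Num.min c (d i)); first by rewrite lt_min c0 d0.
move=> j /=; rewrite inE ge_min => /orP[/eqP ->|/cs ->//]; by rewrite lexx orbT.
Qed.

End esum_real.

(** * Edgewise energy, vertex values and volume *)

Section energy.
Context {R : realType} (G : metric_graph R).
Implicit Types (f g : point_of G -> R[i]^o) (e : edge G) (v w : vertex G).
Local Notation Re := (@complex.Re R).
Local Notation Im := (@complex.Im R).

Definition sqnorm (z : R[i]^o) : R := Re z ^+ 2 + Im z ^+ 2.

Definition edgewise_H1 f : Prop := forall e, H1_itv (length e) (on_edge f e).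

Definition energy f e : R := cip (length e) (on_edge f e) +
  cip (length e) (weak_derivative (length e) (on_edge f e)).

Lemma energy_ge0 f e : 0 <= energy f e.
Proof. by rewrite addr_ge0// cip_ge0. Qed.

Lemma H1_itv_sqint l (u : R -> R[i]^o) : H1_itv l u ->
  sqint l (Re \o u) /\ sqint l (Im \o u).
Proof. by case=> _ /L2_itvP. Qed.

Lemma H1_itv_sqint_derivative l (u : R -> R[i]^o) : H1_itv l u ->
  sqint l (Re \o weak_derivative l u) /\ sqint l (Im \o weak_derivative l u).
Proof. by move/H1_itv_ch1 => [[_ ? _] [_ ? _]]. Qed.

Lemma L2_normsqE f : edgewise_H1 f ->
  L2_normsq f = \esum_(e in [set: edge G]) (cip (length e) (on_edge f e))%:E.
Proof.
move=> hf; apply: eq_esum => e _; have [? ?] := H1_itv_sqint (hf e).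
exact: L2_normsq_itvE.
Qed.

Lemma L2_normsq_derivativeE f : edgewise_H1 f ->
  L2_normsq_derivative f = \esum_(e in [set: edge G])
    (cip (length e) (weak_derivative (length e) (on_edge f e)))%:E.
Proof.
move=> hf; apply: eq_esum => e _; have [? ?] := H1_itv_sqint_derivative (hf e).
exact: L2_normsq_itvE.
Qed.

Lemma energyE f : edgewise_H1 f -> (L2_normsq f + L2_normsq_derivative f =
  \esum_(e in [set: edge G]) (energy f e)%:E)%E.
Proof.
move=> hf; rewrite L2_normsqE// L2_normsq_derivativeE// -esumD;
  by [|move=> e _; rewrite lee_fin cip_ge0].
Qed.

Lemma H1_energy f : H1 G f -> edgewise_H1 f /\
  (\esum_(e in [set: edge G]) (energy f e)%:E < +oo)%E.
Proof.
move=> [_ [_ Lf] Hf Df]; split => //; rewrite -energyE//.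
by rewrite lte_add_pinfty.
Qed.

Lemma H1_norm_lt f (eps : R) : edgewise_H1 f -> 0 < eps ->
  (H1_norm f < eps%:E)%E <->
  (\esum_(e in [set: edge G]) (energy f e)%:E < (eps ^+ 2)%:E)%E.
Proof.
move=> hf e0; rewrite /H1_norm energyE//.
have : (0 <= \esum_(e in [set: edge G]) (energy f e)%:E)%E.
  by apply: esum_ge0 => e _; rewrite lee_fin energy_ge0.
case: (\esum_(e in _) _) => [x| |]//=; rewrite lee_fin => x0; rewrite !lte_fin.
rewrite -[X in _ < X <-> _](@ger0_norm _ eps) ?ltW// -sqrtr_sqr.
by rewrite ltr_sqrt// exprn_gt0.
Qed.

Lemma edge_estimate f e (a b : R) : edgewise_H1 f ->
  0 <= a <= length e -> 0 <= b <= length e ->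
  sqnorm (f (chart e b)) <= sqnorm (f (chart e a)) + 2 * energy f e.
Proof.
move=> hf al bl; have [hr hi] := H1_itv_ch1 (hf e); have l0 := length_gt0 e.
have := h1_edge l0 hr al bl; have := h1_edge l0 hi al bl.
by rewrite /sqnorm /energy /cip /=; lra.
Qed.

Lemma vertex_estimate f e : edgewise_H1 f ->
  sqnorm (f (vpoint (source e))) <= sqnorm (f (vpoint (target e))) + 2 * energy f e /\
  sqnorm (f (vpoint (target e))) <= sqnorm (f (vpoint (source e))) + 2 * energy f e.
Proof.
move=> hf; have l0 := ltW (length_gt0 e).
by rewrite -chart0 -chartl; split; apply: edge_estimate; rewrite ?lexx ?l0.
Qed.

Lemma edge_sup f e (b : R) : edgewise_H1 f -> 0 <= b <= length e ->
  Num.min (length e) 1 * sqnorm (f (chart e b)) <= 2 * energy f e.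
Proof.
move=> hf bl; have [hr hi] := H1_itv_ch1 (hf e); have l0 := length_gt0 e.
have := h1_sup l0 hr bl; have := h1_sup l0 hi bl.
by rewrite /sqnorm /energy /cip /= mulrDr; lra.
Qed.

Lemma conn_estimate f A v w : edgewise_H1 f -> conn A v w ->
  exists s : seq (edge G), [/\ uniq s,
    forall e, e \in s -> A (source e) /\ A (target e) &
    sqnorm (f (vpoint w)) <= sqnorm (f (vpoint v)) + 2 * \sum_(e <- s) energy f e].
Proof.
move=> hf; move/(@path_estimate _ _ (fun e => 2 * energy f e)
  (fun v => sqnorm (f (vpoint v)))) => [e|e|s [us sA]].
- by have [] := vertex_estimate e hf.
- by have [] := vertex_estimate e hf.
by rewrite -mulr_sumr => h; exists s.
Qed.

Lemma le_cip_cst l (u : R -> R[i]^o) c : 0 < l -> 0 <= c ->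
  sqint l (Re \o u) -> sqint l (Im \o u) ->
  (forall x, 0 <= x <= l -> c <= sqnorm (u x)) -> c * l <= cip l u.
Proof.
move=> l0 c0 sr si h.
have -> : c * l = ip l (cst (Num.sqrt c)) (cst (Num.sqrt c)).
  by rewrite ip_cst ?ltW// sqr_sqrtr// mulrC.
rewrite /cip /ip -RintegralD//; [|exact: sqint_mul..].
have sc := @sqint_cst R l (Num.sqrt c).
apply: le_Rintegral => //; first exact: sqint_mul.
  by apply: (integrableD _ (sqint_mul sr sr) (sqint_mul si si)).
move=> x /=; rewrite in_itv/= => /h; rewrite -expr2 sqr_sqrtr//.
Qed.

Lemma vol_star_le (C : set (vertex G)) (N : edge G -> R) :
  (forall e, 0 <= N e) ->
  (forall e, C (source e) \/ C (target e) -> length e <= N e) ->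
  (vol (star C) <= \esum_(e in [set: edge G]) (N e)%:E)%E.
Proof.
move=> N0 CN; apply: le_esum => e _.
have [Ce|nCe] := pselect (C (source e) \/ C (target e)).
  apply: (@le_trans _ _ (length e)%:E); last by rewrite lee_fin CN.
  have : (lebesgue_measure (edge_itv e) = (length e)%:E)%E.
    by rewrite /edge_itv lebesgue_measure_itv/= lte_fin length_gt0 -EFinB subr0.
  move=> <-; apply: le_measure; rewrite ?inE; last exact: subIsetl.
    apply: measurableI; first exact: measurable_itv.
    by apply: open_measurable; exact: ((open_chartP _).1 (@open_star _ _ C) e).
  exact: measurable_itv.
rewrite (_ : _ `&` _ = set0) ?measure0 ?lee_fin//.
rewrite -subset0 => x [xl]; rewrite /= starE => -[[h _]|[h _]]; apply: nCe;
  by [left|right].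
Qed.

(* Otherwise a nested sequence of components, each containing infinitely many such
   vertices, is an end.  Having infinite volume it meets points where [f] is small, and
   paths inside a remote component carry little energy. *)
Lemma finite_level f (eps : R) :
  (forall gamma : set (nat -> set (point_of G)),
     topological_end gamma -> infinite_volume gamma) ->
  H1 G f -> 0 < eps -> finite_set [set v | eps < sqnorm (f (vpoint v))].
Proof.
move=> inf /H1_energy[hf sf] eps0; apply: contrapT => /koenig[A [C [cs hC]]].
have eU := component_sequence_end cs.
have infU n : vol (star (C n)) = +oo%E.
  apply/eqP; rewrite eq_le leey /= leNgt; apply/negP => vn.
  apply: (inf [set U' | end_sequence U' /\ end_equiv (fun n => star (C n)) U']).
    by exists (fun n => star (C n)); [exact: eU|].
  exists (fun n => star (C n)); last by exists n.
  by split; [exact: eU|move=> m; exists m, m; split].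
(* A point with |f|^2 < n0 yields a vertex below 3 n0, and the path to v adds at most 2 n0; the
   total 5 n0 stays below eps = 8 n0. *)
pose n0 := eps / 8; have n00 : 0 < n0 by rewrite divr_gt0.
have [F fF tail] := esum_tail (energy_ge0 f) n00 sf.
have [AC Cn fA exh] := cs.
(* At this stage all ends of the edges in [F] are removed, so edges touching [A n] belong to the
   tail. *)
have [n nF] : exists n, (@source _ _ @` F) `|` (@target _ _ @` F) `<=` ~` A n.
  by apply: exh; rewrite finite_setU; split; exact: finite_image.
have AF e : A n (source e) \/ A n (target e) -> ~ F e.
  move=> h Fe; case: h; apply: nF; [left|right]; by exists e.
have tail1 := (esum_leP _ _ _).1 tail.
have eN e : A n (source e) \/ A n (target e) -> energy f e <= n0.
  move=> /AF nFe; have := tail1 [:: e] isT; rewrite big_seq1; apply.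
  by move=> e'; rewrite inE => /eqP ->.
have [r Ar Cr] := AC n.
have CA w : C n w -> A n w by rewrite Cr; exact: conn_r.
(* Otherwise |f|^2 >= n0 on all these edges, so each length is at most energy / n0 and the star has
   finite volume. *)
have [e [y [Ce yl ey]]] : exists e y, [/\ C n (source e) \/ C n (target e),
    0 <= y <= length e & sqnorm (f (chart e y)) < n0].
  apply: contrapT => hn.
  suff : (vol (star (C n)) < +oo)%E by rewrite infU.
  have [c c0 hc] := esum_lty_le (energy_ge0 f) sf.
  have := esum_scale (ltW (_ : 0 < n0^-1)) hc; rewrite invr_gt0 => /(_ n00) hc'.
  apply: le_lt_trans (le_trans (vol_star_le _ _) hc') (ltry _).
    by move=> e; rewrite mulr_ge0 ?energy_ge0// invr_ge0 ltW.
  move=> e Ce; rewrite -ler_pdivrMl ?invr_gt0// invrK.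
  have [sr si] := H1_itv_sqint (hf e).
  apply: (@le_trans _ _ (cip (length e) (on_edge f e))); last first.
    by rewrite lerDl cip_ge0.
  apply: le_cip_cst => //; [exact: length_gt0|exact: ltW|].
  move=> x xl; rewrite leNgt; apply/negP => hx.
  by apply: hn; exists e, x.
have [w Cw wy] : exists2 w, C n w & sqnorm (f (vpoint w)) <= 3 * n0.
  have en : energy f e <= n0 by apply: eN; case: Ce => /CA; [left|right].
  case: Ce => Ce.
    exists (source e) => //; have := @edge_estimate f e y 0 hf yl.
    rewrite lexx (ltW (length_gt0 e)) => /(_ isT); rewrite chart0; lra.
  exists (target e) => //; have := @edge_estimate f e y (length e) hf yl.
  rewrite lexx (ltW (length_gt0 e)) => /(_ isT); rewrite chartl; lra.
have [v [/= Sv Cv]] := infinite_setN0 (hC n).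
have cwv : conn (A n) w v.
  by rewrite Cr in Cw Cv; apply: conn_trans (conn_sym Cw) Cv.
have [s [us sA h]] := conn_estimate hf cwv.
have : \sum_(e <- s) energy f e <= n0.
  by apply: tail1 => // e' /sA[h1 _]; apply: AF; left.
move: Sv; rewrite (_ : eps = 8 * n0); last by rewrite /n0; field.
by clearbody n0; lra.
Qed.

End energy.

(** * Functions glued from profiles on the edges *)

Section profiles.
Context {R : realType}.
Implicit Types (l : R) (u w k g : R -> R).

Lemma eq_h1 l u u' g : (forall x, 0 <= x <= l -> u x = u' x) -> h1 l u g -> h1 l u' g.
Proof.
move=> e [cu sg wu]; split=> //.
  apply: subspace_eq_continuous cu => x; rewrite inE/= in_itv/= => xl.
  by rewrite /from_subspace e.
by move=> phi tphi; rewrite -wu//; apply: eq_ip => // x xl; rewrite e.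
Qed.

(** The derivative [k] vanishes outside some [a, b] inside ]0, l[. *)
Lemma profile_near l w k : 0 < l -> profile l w k ->
  exists2 d, 0 < d & forall x, 0 < x < d -> w x = w 0 /\ w (l - x) = w l.
Proof.
move=> l0 pw; have hw := profile_h1 l0 pw.
have [a [b [M [a0 bl bs]]]] := test_function_bounded pw.1.
have W x : 0 <= x <= l -> w x = w 0 + antiderivative k x.
  move=> /andP[x0 xl]; rewrite (h1_ftc l0 hw) ?x0//.
  by rewrite (primitive_antiderivative a0 bs).
have A0 : antiderivative k 0 = 0.
  by rewrite (primitive_antiderivative a0 bs)// primitive0.
exists (Num.min l (Num.min a (l - b))); first by rewrite !lt_min l0 a0 subr_gt0.
move=> x /andP[x0]; rewrite !lt_min => /andP[xl /andP[xa xb]]; split.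
  rewrite W; last by rewrite (ltW x0) (ltW xl).
  by rewrite (antiderivative_cst bs (ltW x0)) ?xa// A0 addr0.
have lx : l - x <= l by rewrite gerBl ltW.
have lx0 : 0 <= l - x by rewrite subr_ge0 ltW.
rewrite W; last by rewrite lx0 lx.
rewrite [RHS]W; last by rewrite (ltW l0) lexx.
rewrite (antiderivative_cst bs lx)//.
by apply/orP; right; rewrite lerBrDr -lerBrDl; exact: ltW.
Qed.

End profiles.

(** * Glueing profiles into functions of the core *)

Section graph_profile.
Context {R : realType} (G : metric_graph R).
Implicit Types (e : edge G) (v : vertex G).
Local Notation Re := (@complex.Re R).
Local Notation Im := (@complex.Im R).
Variables (phi : vertex G -> R[i]^o) (wr kr wi ki : edge G -> R -> R).

Definition graph_profile : Prop := forall e,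
  [/\ profile (length e) (wr e) (kr e), profile (length e) (wi e) (ki e),
    (Complex (wr e 0) (wi e 0) : R[i]^o) = phi (source e) &
    (Complex (wr e (length e)) (wi e (length e)) : R[i]^o) = phi (target e)].

Definition glue_profile : point_of G -> R[i]^o :=
  glue_fun (fun e x => Complex (wr e x) (wi e x) : R[i]^o).

Hypothesis gp : graph_profile.

Lemma glue_profile_compatible :
  compatible (fun e x => Complex (wr e x) (wi e x) : R[i]^o) phi.
Proof. by move=> e; have [_ _ ? ?] := gp e. Qed.

Lemma glue_profileE e x : 0 <= x <= length e ->
  glue_profile (chart e x) = Complex (wr e x) (wi e x).
Proof. exact: glue_funE_in glue_profile_compatible e x. Qed.

Lemma glue_profile_vpoint v : glue_profile (vpoint v) = phi v.
Proof. exact: glue_fun_vpoint glue_profile_compatible v. Qed.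

Lemma glue_profile_continuous : continuous glue_profile.
Proof.
apply: continuous_chartP => e x.
have -> : glue_profile \o chart e =
    fun x => Complex (wr e (clampr e x)) (wi e (clampr e x)) :> R[i]^o.
  by apply/funext => y /=; rewrite /glue_profile (glue_funE glue_profile_compatible).
have [pr pi _ _] := gp e; apply: Complex_cvg.
  by apply: continuous_comp; [exact: clampr_continuous|exact: profile_continuous pr _].
by apply: continuous_comp; [exact: clampr_continuous|exact: profile_continuous pi _].
Qed.

Lemma glue_profile_ch1 e : ch1 (length e) (on_edge glue_profile e)
  (fun x => Complex (kr e x) (ki e x)).
Proof.
have l0 := length_gt0 e; have [pr pi _ _] := gp e; split.
  apply: eq_h1 (profile_h1 l0 pr) => x xl.
  by rewrite /on_edge /= glue_profileE.
apply: eq_h1 (profile_h1 l0 pi) => x xl.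
by rewrite /on_edge /= glue_profileE.
Qed.

Lemma glue_profile_edgewise : edgewise_H1 glue_profile.
Proof. by move=> e; exact: ch1_H1_itv (glue_profile_ch1 e). Qed.

Lemma glue_profile_H2 e : H2_itv (length e) (on_edge glue_profile e).
Proof.
have l0 := length_gt0 e; have [pr pi _ _] := gp e.
split; first exact: glue_profile_edgewise.
exists (fun x => Complex (kr e x) (ki e x)).
  apply: (@ch1_H1_itv _ _ _ (fun x => Complex (derive1 (kr e) x) (derive1 (ki e) x))).
  by split; apply: test_function_h1 => //; [exact: pr.1|exact: pi.1].
have [[_ _ h] [_ _ h']] := glue_profile_ch1 e.
by move=> psi tpsi; split; [exact: h|exact: h'].
Qed.

(** Near a vertex each component is constant, so every outward quotient is eventually zero and the
    Kirchhoff sum vanishes term by term. *)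
Lemma glue_profile_kirchhoff v : kirchhoff glue_profile v.
Proof.
split; first by move=> p _; exact: glue_profile_continuous.
apply: fsbig1 => e ev; have l0 := length_gt0 e; have [pr pi _ _] := gp e.
have [d d0 hd] := profile_near l0 pr; have [d' d'0 hd'] := profile_near l0 pi.
rewrite /outward_derivative; apply: lim_near_cst; first exact: norm_hausdorff.
near=> h; have h0 : 0 < h by near: h; exact: nbhs_right_gt.
have hl : h < length e by near: h; exact: nbhs_right_lt.
have [r1 r2] : wr e h = wr e 0 /\ wr e (length e - h) = wr e (length e).
  by apply: hd; rewrite h0/=; near: h; exact: nbhs_right_lt.
have [i1 i2] : wi e h = wi e 0 /\ wi e (length e - h) = wi e (length e).
  by apply: hd'; rewrite h0/=; near: h; exact: nbhs_right_lt.
have hl' : 0 <= length e - h <= length e by rewrite subr_ge0 (ltW hl) gerBl ltW.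
rewrite /outward_quotient /on_edge /=.
rewrite !glue_profileE// ?lexx ?(ltW l0) ?(ltW h0) ?(ltW hl)//.
by rewrite r1 r2 i1 i2 !subrr if_same mul0r.
Unshelve. all: by end_near. Qed.

Lemma glue_profile_core F : finite_set F ->
  (forall e, ~ F e -> wr e = cst 0 /\ wi e = cst 0) ->
  H1_0_core glue_profile.
Proof.
move=> fF zF; have gz e x : ~ F e -> on_edge glue_profile e x = 0.
  move=> /zF[zr zi]; rewrite /on_edge /= -chart_clampr glue_profileE ?clampr_itv//.
  by rewrite zr zi.
split.
- split; first by move=> e; have [] := glue_profile_edgewise e.
  rewrite L2_normsqE; last exact: glue_profile_edgewise.
  apply: (@esum_finite_support _ _ _ F) => //; first by move=> e; exact: cip_ge0.
  move=> e nF; rewrite /cip.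
  rewrite (@eq_ip _ _ (Re \o _) _ (cst 0) (Re \o on_edge glue_profile e))//; last first.
    by move=> x _; rewrite /= gz.
  rewrite (@eq_ip _ _ (Im \o _) _ (cst 0) (Im \o on_edge glue_profile e))//; last first.
    by move=> x _; rewrite /= gz.
  by rewrite !ip0l addr0.
- apply: sub_finite_set fF => e [x _ h]; apply: contrapT => nF.
  by move: h; rewrite gz// eqxx.
- exact: glue_profile_H2.
- exact: glue_profile_kirchhoff.
Qed.

(** The difference has an explicit weak derivative, which replaces the chosen one in the energy. *)
Lemma energy_sub_glue_profile (f : point_of G -> R[i]^o) e :
  edgewise_H1 f -> H1_itv (length e) (on_edge (f \- glue_profile)%R e) /\
  let u := on_edge f e in let u' := weak_derivative (length e) (on_edge f e) in
  energy (f \- glue_profile)%R e =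
  (ip (length e) (fun x => Re (u x) - wr e x) (fun x => Re (u x) - wr e x) +
   ip (length e) (fun x => Im (u x) - wi e x) (fun x => Im (u x) - wi e x)) +
  (ip (length e) (fun x => Re (u' x) - kr e x) (fun x => Re (u' x) - kr e x) +
   ip (length e) (fun x => Im (u' x) - ki e x) (fun x => Im (u' x) - ki e x)).
Proof.
move=> hf; have l0 := length_gt0 e; have [pr pi _ _] := gp e.
have [hr hi] := H1_itv_ch1 (hf e).
set u := on_edge f e; set u' := weak_derivative _ _.
have hB : ch1 (length e) (on_edge (f \- glue_profile)%R e)
    (fun x => Complex (Re (u' x) - kr e x) (Im (u' x) - ki e x)).
  split.
    apply: eq_h1 (h1B hr (profile_h1 l0 pr)) => x xl.
    by rewrite /on_edge /= glue_profileE// raddfB.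
  apply: eq_h1 (h1B hi (profile_h1 l0 pi)) => x xl.
  by rewrite /on_edge /= glue_profileE// raddfB.
split; first exact: ch1_H1_itv hB.
rewrite /energy (cip_weak_derivative l0 hB); congr (_ + _).
rewrite /cip; congr (_ + _); apply: eq_ip => x xl;
  by rewrite /on_edge /= glue_profileE// raddfB.
Qed.

End graph_profile.

(** * Approximation when all ends have infinite volume *)

Section shrink.
Context {R : realType}.
Implicit Types (c x y : R).

(* Soft thresholding of vertex values makes their support finite. *)
Definition shrink c x : R :=
  if x <= - c then x + c else if x <= c then 0 else x - c.

Lemma shrink_mono c x y : 0 < c -> y <= x -> 0 <= shrink c x - shrink c y <= x - y.
Proof.
by move=> c0 yx; rewrite /shrink; case: (leP x (- c)); case: (leP x c);
  case: (leP y (- c)); case: (leP y c) => *; apply/andP; split; lra.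
Qed.

Lemma shrink_lip c x y : 0 < c -> `|shrink c x - shrink c y| <= `|x - y|.
Proof.
move=> c0; have [yx|/ltW xy] := leP y x.
  by have /andP[h1 h2] := shrink_mono c0 yx; rewrite !ger0_norm// (le_trans h1).
rewrite distrC [`|x - y|]distrC.
by have /andP[h1 h2] := shrink_mono c0 xy; rewrite !ger0_norm// (le_trans h1).
Qed.

Lemma shrink_eq0 c x : 0 < c -> `|x| <= c -> shrink c x = 0.
Proof.
move=> c0; rewrite ler_norml /shrink => /andP[h1 h2]; rewrite h2.
by case: (leP x (- c)) => // h; lra.
Qed.

Lemma shrink_le c x : 0 < c -> `|shrink c x| <= `|x|.
Proof.
move=> c0; have := shrink_lip x 0 c0.
by rewrite (@shrink_eq0 c 0) ?subr0// normr0 ltW.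
Qed.

Lemma shrink_close c x : 0 < c -> `|shrink c x - x| <= c.
Proof.
move=> c0; rewrite /shrink ler_norml; case: (leP x (- c)); case: (leP x c) => *;
  by apply/andP; split; lra.
Qed.

End shrink.

Section approximation.
Context {R : realType} (G : metric_graph R).
Implicit Types (f : point_of G -> R[i]^o) (e : edge G) (v : vertex G).
Local Notation Re := (@complex.Re R).
Local Notation Im := (@complex.Im R).

Lemma ip_sub_le l (u w : R -> R) : sqint l u -> sqint l w ->
  ip l (fun x => u x - w x) (fun x => u x - w x) <= 2 * ip l u u + 2 * ip l w w.
Proof.
move=> su sw; have := ip_sumsq su (sqintN sw).
by rewrite [X in _ <= _ + 2 * X](_ : _ = ip l w w)//;
  apply: eq_Rintegral => x _; rewrite mulrNN.
Qed.

Lemma H1_approximation f (eps : R) :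
  (forall gamma : set (nat -> set (point_of G)),
     topological_end gamma -> infinite_volume gamma) ->
  H1 G f -> 0 < eps ->
  exists2 g, H1_0_core g & (H1_norm (f \- g)%R < eps%:E)%E.
Proof.
move=> inf Hf eps0; have [hf sf] := H1_energy Hf.
have [C C0 interp] := @interpolation R.
(* Off [F] the error u - w has energy at most twice that of u plus twice that of w, the latter at
   most C times the former. *)
pose K := 2 * (1 + C); have K0 : 0 < K by rewrite mulr_gt0// ltr_pwDl.
pose eta := eps ^+ 2 / (4 * K).
have eta0 : 0 < eta by rewrite divr_gt0 ?exprn_gt0// mulr_gt0.
have [F fF tail] := esum_tail (energy_ge0 f) eta0 sf.
have [s0 Fs0] := (finite_seqP F).1 fF.
(* The edges of [F] share a budget of eps^2 / 4, and [eta] leaves as much for the rest; the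
   successor avoids division by zero. *)
pose e1 := eps ^+ 2 / (4 * (size s0).+1%:R).
have e10 : 0 < e1 by rewrite divr_gt0 ?exprn_gt0// mulr_gt0.
have e12 : 0 < e1 / 2 by rewrite divr_gt0.
pose U e := Re \o on_edge f e; pose V e := Im \o on_edge f e.
pose U' e := Re \o weak_derivative (length e) (on_edge f e).
pose V' e := Im \o weak_derivative (length e) (on_edge f e).
have hU e : h1 (length e) (U e) (U' e) by have [] := H1_itv_ch1 (hf e).
have hV e : h1 (length e) (V e) (V' e) by have [] := H1_itv_ch1 (hf e).
pose close l (u g : R -> R) (d : R) := forall a b : R, `|a - u 0| <= d ->
  `|b - u l| <= d -> exists w k, [/\ profile l w k, w 0 = a, w l = b &
    ip l (fun x => u x - w x) (fun x => u x - w x) +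
    ip l (fun x => g x - k x) (fun x => g x - k x) <= e1 / 2].
have [d hd] : {d : edge G -> R & forall e, [/\ 0 < d e,
    close (length e) (U e) (U' e) (d e) & close (length e) (V e) (V' e) (d e)]}.
  apply: (@choice _ _ (fun e d => [/\ 0 < d,
    close (length e) (U e) (U' e) d & close (length e) (V e) (V' e) d])) => e.
  have l0 := length_gt0 e.
  have [d1 d10 h1] := h1_approx l0 (hU e) e12.
  have [d2 d20 h2] := h1_approx l0 (hV e) e12.
  exists (Num.min d1 d2); split; first by rewrite lt_min d10.
    by move=> a b; rewrite !le_min => /andP[+ _] /andP[+ _]; exact: h1.
  by move=> a b; rewrite !le_min => /andP[_ +] /andP[_ +]; exact: h2.
(* One threshold c within the tolerance of each edge of the finite set [F]. *)
have [c c0 cd] : exists2 c, 0 < c & forall e, F e -> c <= d e.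
  by apply: finite_min => // e; have [] := hd e.
pose phi v : R[i]^o := Complex (shrink c (Re (f (vpoint v)))) (shrink c (Im (f (vpoint v)))).
pose S := [set v | c ^+ 2 < sqnorm (f (vpoint v))].
have fS : finite_set S by apply: finite_level => //; exact: exprn_gt0.
have phi0 v : ~ S v -> phi v = 0.
  move=> /negP; rewrite -leNgt /sqnorm => h.
  have bnd (x y : R) : x ^+ 2 + y ^+ 2 <= c ^+ 2 -> `|x| <= c.
    move=> xy; rewrite -(ler_sqr (normr_ge0 x) (ltW c0)).
    rewrite real_normK ?num_real//; apply: le_trans xy.
    by rewrite lerDl sqr_ge0.
  by rewrite /phi !shrink_eq0 ?(bnd _ _ h)//; apply: bnd; rewrite addrC; exact: h.
have Us e : U e 0 = Re (f (vpoint (source e))) by rewrite /U /on_edge /= chart0.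
have Ut e : U e (length e) = Re (f (vpoint (target e))) by rewrite /U /on_edge /= chartl.
have Vs e : V e 0 = Im (f (vpoint (source e))) by rewrite /V /on_edge /= chart0.
have Vt e : V e (length e) = Im (f (vpoint (target e))) by rewrite /V /on_edge /= chartl.
pose good l (u g : R -> R) (F : Prop) (wk : (R -> R) * (R -> R)) :=
  [/\ profile l wk.1 wk.2, wk.1 0 = shrink c (u 0), wk.1 l = shrink c (u l) &
  (F -> ip l (fun x => u x - wk.1 x) (fun x => u x - wk.1 x) +
    ip l (fun x => g x - wk.2 x) (fun x => g x - wk.2 x) <= e1 / 2) /\
  (~ F -> ip l (fun x => u x - wk.1 x) (fun x => u x - wk.1 x) +
    ip l (fun x => g x - wk.2 x) (fun x => g x - wk.2 x) <=
      K * (ip l u u + ip l g g) /\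
    (shrink c (u 0) = 0 -> shrink c (u l) = 0 -> wk.1 = cst 0))].
have exgood l (u g : R -> R) (P : Prop) : 0 < l -> h1 l u g ->
    (P -> close l u g c) -> exists wk, good l u g P wk.
  move=> l0 hu Pc; have [hP|nP] := pselect P.
    have [w [k [pw w0 wl wb]]] := Pc hP _ _ (shrink_close (u 0) c0) (shrink_close (u l) c0).
    by exists (w, k); split.
  have [w [k [pw w0 wl wb wz]]] := interp l u g l0 hu _ _ (shrink_le (u 0) c0)
    (shrink_le (u l) c0) (shrink_lip (u l) (u 0) c0).
  exists (w, k); split => //; split => // _; split => //=.
  have [cu sg _] := hu.
  apply: le_trans (lerD (ip_sub_le (sqint_cont cu) (profile_sqint pw))
    (ip_sub_le sg (test_function_sqint pw.1))) _.
  by rewrite /K; lra.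
have close_le l (u g : R -> R) (d1 d2 : R) : d1 <= d2 -> close l u g d2 -> close l u g d1.
  by move=> dd h a b ha hb; apply: h; [exact: le_trans ha dd|exact: le_trans hb dd].
have [wr hwr] : {wk & forall e, good (length e) (U e) (U' e) (F e) (wk e)}.
  apply: (@choice _ _ (fun e wk => good (length e) (U e) (U' e) (F e) wk)) => e.
  apply: exgood => //; first exact: length_gt0.
  by move=> /cd cde; have [_ h _] := hd e; exact: close_le cde h.
have [wi hwi] : {wk & forall e, good (length e) (V e) (V' e) (F e) (wk e)}.
  apply: (@choice _ _ (fun e wk => good (length e) (V e) (V' e) (F e) wk)) => e.
  apply: exgood => //; first exact: length_gt0.
  by move=> /cd cde; have [_ _ h] := hd e; exact: close_le cde h.
have gp : graph_profile phi (fun e => (wr e).1) (fun e => (wr e).2)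
    (fun e => (wi e).1) (fun e => (wi e).2).
  move=> e; have [pr r0 rl _] := hwr e; have [pi i0 il _] := hwi e.
  by split => //; rewrite /phi ?r0 ?i0 ?rl ?il ?Us ?Vs ?Ut ?Vt.
pose g := glue_profile (fun e => (wr e).1) (fun e => (wi e).1).
exists g.
  (* Off this finite set both end values are zero, and the interpolant is then identically zero. *)
  apply: (glue_profile_core gp (F := F `|` [set e | S (source e) \/ S (target e)])).
    by rewrite finite_setU; split=> //; exact: finite_edges_at.
  move=> e /not_orP[nF /not_orP[/phi0 ns /phi0 nt]].
  have [_ _ _ [_ /(_ nF)[_ zr]]] := hwr e; have [_ _ _ [_ /(_ nF)[_ zi]]] := hwi e.
  by rewrite Us Ut in zr; rewrite Vs Vt in zi; case: ns => *; case: nt => *;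
    split; [exact: zr|exact: zi].
have He e := energy_sub_glue_profile gp e hf.
have hfg : edgewise_H1 (f \- g)%R by move=> e; have [] := He e.
apply/H1_norm_lt => //.
have bF e : F e -> energy (f \- g)%R e <= e1.
  move=> Fe; have [_ /= ->] := He e.
  have [_ _ _ [/(_ Fe) h _]] := hwr e; have [_ _ _ [/(_ Fe) h' _]] := hwi e.
  by move: h h'; rewrite /U /U' /V /V' /=; lra.
have bnF e : ~ F e -> energy (f \- g)%R e <= K * energy f e.
  move=> Fe; have [_ /= ->] := He e.
  have [_ _ _ [_ /(_ Fe)[h _]]] := hwr e; have [_ _ _ [_ /(_ Fe)[h' _]]] := hwi e.
  move: h h'; rewrite /energy /cip /U /U' /V /V' /= !mulrDr; lra.
have N0 e : [set: edge G] e -> (0 <= (energy (f \- g)%R e)%:E)%E.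
  by rewrite lee_fin energy_ge0.
rewrite (@esumID R _ F setT _ N0) !setTI.
apply: (@le_lt_trans _ _ ((eps ^+ 2 / 4)%:E + (K * eta)%:E)%E).
  apply: leeD.
    apply/esum_leP => s us sF.
    apply: (@le_trans _ _ (\sum_(e <- s) e1)).
      by rewrite big_seq [leRHS]big_seq; apply: ler_sum => e /sF; exact: bF.
    rewrite big_const_seq count_predT iter_addr_0 -[leLHS]mulr_natr.
    have ss : (size s <= (size s0).+1)%N.
      by apply/leqW/uniq_leq_size => // e /sF; rewrite Fs0.
    apply: (@le_trans _ _ (e1 * (size s0).+1%:R)).
      by rewrite ler_wpM2l ?ler_nat// ltW.
    by rewrite /e1 le_eqVlt; apply/orP; left; apply/eqP; field; rewrite nat1r.
  apply: le_trans (esum_scale (ltW K0) tail).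
  by apply: le_esum => e nFe; rewrite lee_fin bnF.
rewrite -EFinD lte_fin.
have -> : K * eta = eps ^+ 2 / 4 by rewrite /eta; field; rewrite gt_eqF.
have : 0 < eps ^+ 2 by rewrite exprn_gt0.
lra.
Qed.

End approximation.

(** * Ends of finite volume *)

Section end_edges.
Context {R : realType} (G : metric_graph R).
Implicit Types (e : edge G) (v : vertex G) (K : set (point_of G)).

Definition edges_meeting K : set (edge G) :=
  [set e | exists2 x, 0 <= x <= length e & K (chart e x)].

(** The stars of the first n vertices of an enumeration form an increasing open cover; one of them
    contains [K], and a finite set of vertices has finitely many incident edges. *)
Lemma compact_finite_edges K : compact K -> finite_set (edges_meeting K).
Proof.
move=> /compact_near_coveringP cK.
have [i ii] := countable_injP _ (@vertex_countable _ G).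
pose P (n : nat) (p : point_of G) := exists2 v, (i v < n)%N & star [set v] p.
have : \forall n \near \oo, K `<=` P n.
  apply: cK => p Kp; have [v vp] := star_cover p.
  exists (star [set v], [set n | (i v < n)%N]); last by move=> [q n] [/= ? ?]; exists v.
  split => /=; last exact: nbhs_infty_gt.
  by apply: open_nbhs_nbhs; split => //; exact: open_star.
move=> [n _ /(_ n (leqnn n)) KP].
have fi : finite_set [set v | (i v < n)%N].
  apply: (@finite_preimage _ _ `I_n i); last exact: finite_II.
  by move=> x y _ _; apply: ii; rewrite inE.
apply: sub_finite_set (finite_edges_at fi) => e [x xl /KP[v vn]].
by rewrite starE_in// => -[[/= sv _]|[/= tv _]]; [left|right]; rewrite /= ?sv ?tv.
Qed.

Lemma compact_edges (s : seq (edge G)) :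
  compact [set p | exists2 e, e \in s & exists2 x, 0 <= x <= length e & p = chart e x].
Proof.
elim: s => [|e s IH].
  rewrite (_ : [set p | _] = set0); first exact: compact0.
  by rewrite -subset0 => p [].
rewrite (_ : [set p | _] = chart e @` `[0, length e] `|`
    [set p | exists2 e, e \in s & exists2 x, 0 <= x <= length e & p = chart e x]).
  apply: compactU => //; apply: continuous_compact; last exact: segment_compact.
  by apply: continuous_subspaceT; exact: chart_continuous.
apply/seteqP; split => p /=.
  move=> [e']; rewrite inE => /orP[/eqP ->|es] [x xl ->].
    by left; exists x => //; rewrite /= in_itv.
  by right; exists e' => //; exists x.
move=> [[x + <-]|[e' es xp]]; last by exists e' => //; rewrite inE es orbT.
by rewrite in_itv/= => xl; exists e; [rewrite mem_head|exists x].
Qed.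

Lemma end_sequence_leq (U : nat -> set (point_of G)) m n : end_sequence U ->
  (m <= n)%N -> U n `<=` U m.
Proof.
move=> eU; elim: n => [|n IH]; first by rewrite leqn0 => /eqP ->.
rewrite leq_eqVlt => /orP[/eqP ->//|/IH h].
by apply: subset_trans h; exact: end_nested.
Qed.

(** Otherwise points x j of [U j] would eventually stay in a compact union of edges, and a cluster
    point would lie in every closure. *)
Lemma end_infinite_edges (U : nat -> set (point_of G)) n : end_sequence U ->
  infinite_set (edges_meeting (U n)).
Proof.
move=> eU /finite_seqP[s hs].
have [x xU] : {x : nat -> point_of G & forall j, U j (x j)}.
  by apply: choice => j; exact: end_nonempty eU j.
have cK := @compact_edges s.
have [|p [_ cp]] := cK (x @ \oo) _.
  exists n => // j /= nj; have := end_sequence_leq eU nj (xU j).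
  have [e [y [yl ->]]] := chart_surj (x j) => Ue; exists e; last by exists y.
  by have : [set` s] e by rewrite -hs; exists y.
have : (\bigcap_n closure (U n)) p.
  move=> m _ B pB; have xm : (x @ \oo) (U m).
    by exists m => // j /= mj; exact: end_sequence_leq eU mj _ (xU j).
  by have [q [? ?]] := cp _ _ xm pB; exists q.
by rewrite (end_escaping eU).
Qed.

(** On an edge that avoids the boundary, [K] is relatively open and closed, and the edge is
    connected. *)
Lemma edge_dichotomy K e : open K -> ~ edges_meeting (boundary K) e ->
  edges_meeting K e -> forall x, 0 <= x <= length e -> K (chart e x).
Proof.
move=> oK nb [x0 x0l Kx0].
have intK : interior K = K by apply/interior_id.
have /connected_intervalP cI := @interval_is_interval R `[0, length e].
pose B := `[0, length e]%classic `&` chart e @^-1` K.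
have BE : B = `[0, length e]%classic.
  apply: cI.
  - by exists x0; split => //; rewrite /= in_itv.
  - by exists (chart e @^-1` K) => //; exact: ((open_chartP _).1 oK e).
  exists (chart e @^-1` closure K).
    by apply: closed_comp; [move=> y _; exact: chart_continuous|exact: closed_closure].
  apply/seteqP; split => y [yl Ky]; split => //; first exact: subset_closure.
  apply: contrapT => nK; apply: nb; exists y; first by move: yl; rewrite /= in_itv.
  by split => //; rewrite intK.
move=> x xl; have : `[0, length e]%classic x by rewrite /= in_itv.
by rewrite -BE => -[].
Qed.

End end_edges.

(** * The cutoff function of an end of finite volume *)

Section not_approximable.
Context {R : realType} (G : metric_graph R).
Implicit Types (f g : point_of G -> R[i]^o) (e : edge G) (v : vertex G).
Local Notation Re := (@complex.Re R).
Local Notation Im := (@complex.Im R).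

Lemma edgewise_H1B f g : edgewise_H1 f -> edgewise_H1 g -> edgewise_H1 (f \- g)%R.
Proof.
move=> hf hg e; have [fr fi] := H1_itv_ch1 (hf e); have [gr gi] := H1_itv_ch1 (hg e).
pose f' := weak_derivative (length e) (on_edge f e).
pose g' := weak_derivative (length e) (on_edge g e).
apply: (@ch1_H1_itv _ _ _ (fun x => Complex (Re (f' x) - Re (g' x)) (Im (f' x) - Im (g' x)))).
split; [apply: eq_h1 (h1B fr gr)|apply: eq_h1 (h1B fi gi)] => x xl;
  by rewrite /on_edge /= raddfB.
Qed.

(** The supremum bound is used on the single reference edge [e0], then carried to v along a path by
    the additive estimate. The constant is thus uniform in v although edges may be arbitrarily
    short. *)
Lemma vertex_sup f (c : R) e0 v : edgewise_H1 f ->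
  (\esum_(e in [set: edge G]) (energy f e)%:E <= c%:E)%E ->
  Num.min (length e0) 1 * sqnorm (f (vpoint v)) <= 4 * c.
Proof.
move=> hf /esum_leP sc; have l0 := length_gt0 e0.
have [s [us _ hs]] := conn_estimate hf (conn_setT (source e0) v).
have h1 := sc s us (fun _ _ => I).
have h2 : energy f e0 <= c.
  by have := sc [:: e0] isT (fun _ _ => I); rewrite big_seq1.
have := @edge_sup _ _ f e0 0 hf; rewrite lexx (ltW l0) => /(_ isT); rewrite chart0.
set m := Num.min _ _; have m0 : 0 < m by rewrite /m lt_min l0 ltr01.
have m1 : m <= 1 by rewrite /m ge_min lexx orbT.
move=> h3; apply: (@le_trans _ _ (m * (sqnorm (f (vpoint (source e0))) + 2 * c))).
  by rewrite ler_pM2l//; lra.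
have c0 : 0 <= c by apply: le_trans h2; exact: energy_ge0.
have : m * c <= c by rewrite ler_piMl.
by rewrite mulrDr mulrCA; lra.
Qed.

Lemma finite_volume_end_cutoff (U : nat -> set (point_of G)) n :
  end_sequence U -> (vol (U n) < +oo)%E ->
  exists f F, [/\ H1 G f, finite_set F & forall e, ~ F e ->
    edges_meeting (U n) e -> f (vpoint (source e)) = 1].
Proof.
move=> eU volU; have oU : open (U n) by apply: end_open.
pose F := edges_meeting (boundary (U n)).
have fF : finite_set F by apply: compact_finite_edges; exact: end_compact_boundary eU n.
pose P := (@source _ _ @` F) `|` (@target _ _ @` F).
have fP : finite_set P by rewrite finite_setU; split; exact: finite_image.
(* Off [F1] an edge either lies in [U n], with value 1 at both ends, or misses [U n], with value 0
   at both ends. The cutoff is constant on it. *)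
pose F1 := F `|` [set e | P (source e) \/ P (target e)].
have fF1 : finite_set F1 by rewrite finite_setU; split => //; exact: finite_edges_at.
pose phi0 v : R := if `[< U n (vpoint v) /\ ~ P v >] then 1 else 0.
have l0 e : 0 <= length e by rewrite ltW// length_gt0.
have phi_in e : ~ F1 e -> edges_meeting (U n) e ->
    phi0 (source e) = 1 /\ phi0 (target e) = 1.
  move=> /not_orP[nF /not_orP[nPs nPt]] eUe.
  have h := edge_dichotomy oU nF eUe; rewrite /phi0.
  by split; rewrite asboolT//; split => //; rewrite -?chart0 -?chartl; apply: h;
    rewrite lexx l0.
have phi_out e : ~ edges_meeting (U n) e -> phi0 (source e) = 0 /\ phi0 (target e) = 0.
  move=> ne; rewrite /phi0.
  split; rewrite asboolF// => -[h _]; apply: ne.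
    by exists 0; rewrite ?chart0// lexx l0.
  by exists (length e); rewrite ?chartl// lexx l0.
have [wk hwk] : {wk : edge G -> (R -> R) * (R -> R) & forall e,
    [/\ profile (length e) (wk e).1 (wk e).2, (wk e).1 0 = phi0 (source e),
    (wk e).1 (length e) = phi0 (target e) & phi0 (source e) = phi0 (target e) ->
    (wk e).1 = cst (phi0 (source e)) /\ (wk e).2 = cst 0]}.
  apply: (@choice _ _ (fun e wk => [/\ profile (length e) wk.1 wk.2,
    wk.1 0 = phi0 (source e), wk.1 (length e) = phi0 (target e) &
    phi0 (source e) = phi0 (target e) ->
    wk.1 = cst (phi0 (source e)) /\ wk.2 = cst 0])) => e.
  have [w [k h]] := profile_between (phi0 (source e)) (phi0 (target e)) (length_gt0 e).
  by exists (w, k).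
have gp : graph_profile (fun v => Complex (phi0 v) 0 : R[i]^o) (fun e => (wk e).1)
    (fun e => (wk e).2) (fun=> cst 0) (fun=> cst 0).
  move=> e; have [pw w0 wl _] := hwk e; split => //; rewrite ?w0 ?wl//.
  by apply: profile_cst; exact: length_gt0.
pose f := glue_profile (fun e => (wk e).1) (fun=> cst 0).
have hf : edgewise_H1 f by exact: glue_profile_edgewise gp.
have const e : ~ F1 e -> (wk e).1 = cst (phi0 (source e)) /\ (wk e).2 = cst 0.
  move=> nF; have [_ _ _] := hwk e; apply.
  have [h|h] := pselect (edges_meeting (U n) e).
    by have [-> ->] := phi_in e nF h.
  by have [-> ->] := phi_out e h.
have fin (N : edge G -> R) : (forall e, 0 <= N e) -> (\esum_(e in F1) (N e)%:E < +oo)%E.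
  move=> N0; rewrite esum_fset//; last by move=> e _; rewrite lee_fin.
  by rewrite fsumEFin// ltry.
exists f, F1; split => //; last first.
  move=> e nF eUe; rewrite /f (glue_profile_vpoint gp).
  by have [-> _] := phi_in e nF eUe.
split => //.
- exact: glue_profile_continuous gp.
- split; first by move=> e; have [] := hf e.
  rewrite L2_normsqE//.
  have N0 e : [set: edge G] e ->
      (0 <= (cip (length e) (on_edge f e))%:E)%E by rewrite lee_fin cip_ge0.
  rewrite (@esumID R _ F1 setT _ N0) !setTI; apply: lte_add_pinfty.
    by apply: fin => e; exact: cip_ge0.
  (* Off [F1] the squared norm on an edge is its length when it lies in [U n] and 0 when it misses
     [U n], hence at most its contribution to the volume. *)
  apply: le_lt_trans volU.
  have V0 e : [set: edge G] e -> (0 <= lebesgue_measure (edge_itv e `&` chart e @^-1` U n))%E.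
    by move=> _; exact: measure_ge0.
  rewrite /vol (@esumID R _ F1 setT _ V0) !setTI.
  apply: (@le_trans _ _ (\esum_(e in ~` F1)
    lebesgue_measure (edge_itv e `&` chart e @^-1` U n))%E); last first.
    by rewrite leeDr//; apply: esum_ge0 => e _; exact: V0.
  apply: le_esum => e nF.
  have [cw _] := const e nF.
  have -> : cip (length e) (on_edge f e) = length e * phi0 (source e) ^+ 2.
    rewrite /cip (@eq_ip _ _ (Re \o _) (Re \o _) (cst (phi0 (source e))) (cst (phi0 (source e)))).
    + rewrite (@eq_ip _ _ (Im \o _) (Im \o _) (cst 0) (cst 0)).
      * by rewrite ip0l addr0 ip_cst.
      * by move=> x xl; rewrite /on_edge /f /= (glue_profileE gp).
      * by move=> x xl; rewrite /on_edge /f /= (glue_profileE gp).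
    + by move=> x xl; rewrite /on_edge /f /= (glue_profileE gp)// cw.
    + by move=> x xl; rewrite /on_edge /f /= (glue_profileE gp)// cw.
  have [h|h] := pselect (edges_meeting (U n) e); last first.
    by have [-> _] := phi_out e h; rewrite expr0n mulr0 measure_ge0.
  have [-> _] := phi_in e nF h; rewrite expr1n mulr1.
  have nFe : ~ F e by move=> Fe; apply: nF; left.
  rewrite setIidl; last first.
    move=> x; rewrite /edge_itv /= in_itv /=; exact: edge_dichotomy.
  by rewrite /edge_itv lebesgue_measure_itv/= lte_fin length_gt0 -EFinB subr0.
- rewrite L2_normsq_derivativeE//.
  apply: (@esum_finite_support _ _ _ F1) => //; first by move=> e; exact: cip_ge0.
  move=> e nF; rewrite (cip_weak_derivative (length_gt0 e) (glue_profile_ch1 gp e)).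
  have [_ ck] := const e nF.
  rewrite /cip (@eq_ip _ _ (Re \o _) (Re \o _) (cst 0) (cst 0)).
  + by rewrite (@eq_ip _ _ (Im \o _) (Im \o _) (cst 0) (cst 0))// !ip0l addr0.
  + by move=> x _ /=; rewrite ck.
  + by move=> x _ /=; rewrite ck.
Qed.

Lemma finite_volume_end_not_approximable (U : nat -> set (point_of G)) n :
  end_sequence U -> (vol (U n) < +oo)%E -> H1 G <> H1_0 G.
Proof.
move=> eU volU HH; have [f [F [Hf fF f1]]] := finite_volume_end_cutoff eU volU.
have [e0 _] := infinite_setN0 (@edge_infinite _ G).
pose m := Num.min (length e0) 1; have m0 : 0 < m by rewrite lt_min length_gt0 ltr01.
have : H1_0 G f by rewrite -HH.
(* At a vertex where f - g = 1, [vertex_sup] would give m <= 4 (m / 8), a contradiction. *)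
have eps0 : 0 < Num.sqrt (m / 8) by rewrite sqrtr_gt0 divr_gt0.
move=> [_ /(_ _ eps0)[g [Lg fg Hg _]]].
have [hf _] := H1_energy Hf.
have hg : edgewise_H1 g by move=> e; have [] := Hg e.
have hfg := edgewise_H1B hf hg.
have m8 : 0 <= m / 8 by rewrite divr_ge0// ltW.
move=> /(H1_norm_lt hfg eps0)/ltW; rewrite sqr_sqrtr// => hE.
(* [U n] meets infinitely many edges, so one lies outside both finite exceptional sets. *)
have [e [eU' nFg]] : exists e, edges_meeting (U n) e /\
    ~ (F `|` [set e | exists2 x, edge_itv e x & on_edge g e x != 0]) e.
  apply: contrapT => h; apply: (end_infinite_edges (n := n) eU).
  apply: (@sub_finite_set _ _ (F `|` [set e | exists2 x, edge_itv e x & on_edge g e x != 0])).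
    by move=> e eUe; apply: contrapT => nF; apply: h; exists e.
  by rewrite finite_setU.
move/not_orP : nFg => [nF ng].
have g0 : g (vpoint (source e)) = 0.
  rewrite -chart0; apply/eqP; apply: contraT => h; case: ng; exists 0 => //.
  by rewrite /edge_itv /= in_itv/= lexx ltW// length_gt0.
have := vertex_sup e0 (source e) hfg hE.
rewrite -/m /sqnorm /= (f1 e nF eU') g0 subr0 /= expr1n expr0n addr0 mulr1.
lra.
Qed.

End not_approximable.

Theorem corollary3p13 (R : realType) (G : metric_graph R) :
  H1 G = H1_0 G <->
  (forall gamma : set (nat -> set (point_of G)),
     topological_end gamma -> infinite_volume gamma).
Proof.
split=> [HH gamma [U0 eU0 ->] [U [eU _] [n volU]]|inf].
  exact: finite_volume_end_not_approximable eU volU HH.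
apply/seteqP; split=> [f Hf|f []//].
by split => // eps; exact: H1_approximation.
Qed.
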